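(* The horizontal cohomology spaces of the differential algebra $(\mathcal A(\mathbf{CE}),\{D_\mu\}_{\mu\in M})$ are $$H^q_{\mathrm H}(\mathbf{CE})\cong\begin{cases}0,& q<0,\ 1\le q\le m-2,\ q>m;\\ \mathbb R,& q=0;\\ \ker D_1^{m-1}=\mathbb R\cdot[u^\mu d_\mu x],& q=m-1;\\ H^{m-1}(\Theta)/\operatorname{im}D_1^{m-1},& q=m.\end{cases}$$
   Context: Fix an integer $m\ge 2$, $M=\{1,\dots,m\}$, $N=\{2,\dots,m\}$. Indices $\lambda,\mu,\nu$ range over $M$, indices $\alpha,\beta$ over $N$; repeated upper/lower indices are summed. $\mathbb I=\mathbb Z_+^m$ is the set of multi-indices $\mathrm i=(i^1,\dots,i^m)$; $\mathrm i+(\mu)$ is $\mathrm i$ with its $\mu$-th entry increased by $1$, $(\mu)=0+(\mu)$; $\mathbb I_0=\{\mathrm i\in\mathbb I: i^1=0\}$. The infinite-dimensional space $\mathbf B$ has coordinates $x^\mu$, $u^\mu_{\mathrm i}$, $p_{\mathrm i}$ ($\mu\in M$, $\mathrm i\in\mathbb I$); $\mathcal A(\mathbf B)$ is the algebra of smooth real functions on $\mathbf B$ depending on finitely many coordinates. Total derivatives: $D_\mu=\partial_{x^\mu}+u^\lambda_{\mathrm i+(\mu)}\partial_{u^\lambda_{\mathrm i}}+p_{\mathrm i+(\mu)}\partial_{p_{\mathrm i}}$; they commute. Let $\mathcal I\subset\mathcal A(\mathbf B)$ be the ideal generated by all $CE_{\mathrm i}=u^\mu_{\mathrm i+(\mu)}$,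 $\mathrm i\in\mathbb I$, and $\mathcal A(\mathbf{CE})=\mathcal A(\mathbf B)/\mathcal I$ with the induced derivations $D_\mu$ (concretely: smooth functions of finitely many of $x^\mu$, $u^1_{\mathrm i}$ ($\mathrm i\in\mathbb I_0$), $u^\alpha_{\mathrm i}$, $p_{\mathrm i}$ ($\mathrm i\in\mathbb I$), with $u^1_{\mathrm k}$, $k^1\ge1$, replaced recursively by $-u^\beta_{\mathrm k-(1)+(\beta)}$). Horizontal forms: $\Omega^0_{\mathrm H}(\mathbf{CE})=\mathcal A(\mathbf{CE})$, for $1\le q\le m$ $\Omega^q_{\mathrm H}(\mathbf{CE})$ consists of $\omega=\omega_{\mu_1\dots\mu_q}dx^{\mu_1}\wedge\dots\wedge dx^{\mu_q}$ with skew-symmetric coefficients in $\mathcal A(\mathbf{CE})$, $\Omega^q_{\mathrm H}=0$ otherwise; $d_{\mathrm H}\omega=(D_\mu\omega_{\mu_1\dots\mu_q})\,dx^\mu\wedge dx^{\mu_1}\wedge\dots\wedge dx^{\mu_q}$; $H^q_{\mathrm H}(\mathbf{CE})=\ker d_{\mathrm H}/\operatorname{im}d_{\mathrm H}$ in degree $q$. Auxiliary complex: $\Theta^q$ is the space of forms $\theta=\theta_{\alpha_1\dots\alpha_q}dx^{\alpha_1}\wedge\dots\wedge dx^{\alpha_q}$ involving only $dx^\alpha$, $\alpha\in N$, with skew-symmetric coefficients in $\mathcal A(\mathbf{CE})$ ($\Theta^0=\mathcal A(\mathbf{CE})$), with differential $d_\Theta\theta=(D_\alpha\theta_{\alpha_1\dots\alpha_q})dx^\alpha\wedge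 dx^{\alpha_1}\wedge\dots\wedge dx^{\alpha_q}$, and $H^q(\Theta)=\ker d_\Theta/\operatorname{im}d_\Theta$ in degree $q$. The derivation $D_1$ acting coefficientwise on $\Theta^q$ commutes with $d_\Theta$ and so induces linear maps $D_1^q:H^q(\Theta)\to H^q(\Theta)$, $[\theta]\mapsto[D_1\theta]$. $d_\mu x=(-1)^{\mu-1}dx^1\wedge\dots\wedge\widehat{dx^\mu}\wedge\dots\wedge dx^m$ (hat = omission). *)

(* Defs.v *)
From mathcomp Require Import all_boot all_order all_algebra.
From mathcomp Require Import all_classical all_reals all_analysis.
Set Implicit Arguments. Unset Strict Implicit. Unset Printing Implicit Defensive.
Import Order.TTheory GRing.Theory Num.Theory.
Import numFieldNormedType.Exports.
Local Open Scope ring_scope.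

Section CE.
Variables (R : realType) (m : nat).

(* multi-indices i = (i^1,...,i^m); index mu in M is represented by 'I_m
   (mu = 1 is the ordinal 0) *)
Definition mi := {ffun 'I_m -> nat}.
Definition incr (i : mi) (mu : 'I_m) : mi := [ffun nu => (i nu + (nu == mu))%N].
Definition mi0 : mi := [ffun => 0%N].

(* coordinates of B : x^mu | u^mu_i | p_i *)
Definition Coord := ('I_m + ('I_m * mi) + mi)%type.
Definition cX (mu : 'I_m) : Coord := inl (inl mu).
Definition cU (mu : 'I_m) (i : mi) : Coord := inl (inr (mu, i)).
Definition cP (i : mi) : Coord := inr i.

Definition Pt := Coord -> R.
Definition Fun := Pt -> R.

Fixpoint smooth_k (n k : nat) (g : 'rV[R]_n -> R) : Prop :=
  match k with
  | 0 => continuous g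
  | k'.+1 => (forall x v, derivable g x v) /\
             forall v, smooth_k k' (fun x => derive g x v)
  end.
Definition smooth n (g : 'rV[R]_n -> R) := forall k, smooth_k k g.

Definition inA (f : Fun) : Prop :=
  exists n (cs : 'I_n -> Coord) (g : 'rV[R]_n -> R),
    smooth g /\ forall y : Pt, f y = g (\row_k y (cs k)).

(* coefficients of the total derivative D_mu as a vector field on B *)
Definition Vf (mu : 'I_m) (y : Pt) (c : Coord) : R :=
  match c with
  | inl (inl nu) => (nu == mu)%:R
  | inl (inr (la, i)) => y (cU la (incr i mu))
  | inr i => y (cP (incr i mu))
  end.

Definition Dt (mu : 'I_m) (f : Fun) : Fun :=
  fun y => derive1 (fun t : R => f (fun c => y c + t * Vf mu y c)) 0.

Definition CE (i : mi) : Fun := fun y => \sum_(mu < m) y (cU mu (incr i mu)).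

Definition inI (f : Fun) : Prop :=
  exists n (a : 'I_n -> Fun) (ix : 'I_n -> mi),
    (forall k, inA (a k)) /\ forall y, f y = \sum_(k < n) a k y * CE (ix k) y.

(* horizontal forms: coefficient of dx^T (increasing wedge) for T a subset
   of M; a q-form has A(B)-coefficients on |T| = q and 0 elsewhere.
   Forms over A(CE) are forms over A(B) modulo I (coefficientwise). *)
Definition Form := {set 'I_m} -> Fun.
Definition zeroF : Form := fun _ _ => 0.
Definition isForm (q : nat) (w : Form) : Prop :=
  (forall T : {set 'I_m}, #|T| = q -> inA (w T)) /\ (forall T : {set 'I_m}, #|T| <> q -> w T = (fun _ => 0)).
Definition eqI (w w' : Form) : Prop := forall T, inI (fun y => w T y - w' T y).

Definition dH (w : Form) : Form :=
  fun T y => \sum_(nu in T) (-1) ^+ #|[set j in T | (j < nu)%N]| * Dt nu (w (T :\ nu)) y.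

Definition closedH (q : nat) (w : Form) : Prop := isForm q w /\ eqI (dH w) zeroF.
Definition exactH (q : nat) (w : Form) : Prop :=
  isForm q w /\
  (if q is q'.+1 then exists eta, isForm q' eta /\ eqI w (dH eta) else eqI w zeroF).

Definition isTheta (q : nat) (t : Form) : Prop :=
  isForm q t /\ forall (T : {set 'I_m}) (i : 'I_m), i \in T -> val i = 0%N -> t T = (fun _ => 0).
Definition dTh (t : Form) : Form :=
  fun T y => if [exists i in T, val i == 0%N] then 0 else dH t T y.
Definition closedTh (q : nat) (t : Form) : Prop := isTheta q t /\ eqI (dTh t) zeroF.
Definition exactTh (q : nat) (t : Form) : Prop :=
  isTheta q t /\
  (if q is q'.+1 then exists eta, isTheta q' eta /\ eqI t (dTh eta) else eqI t zeroF).

Definition D1 (t : Form) : Form :=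
  fun T y => \sum_(i < m | val i == 0%N) Dt i (t T) y.

(* representatives of ker D_1^{m-1} and of im D_1^{m-1} in H^{m-1}(Theta) *)
Definition kerD1 (t : Form) : Prop :=
  closedTh m.-1 t /\ exactTh m.-1 (D1 t).
Definition imD1 (t : Form) : Prop :=
  isTheta m.-1 t /\
  exists t', closedTh m.-1 t' /\
    exists eta, isTheta m.-2 eta /\ eqI t (fun T y => D1 t' T y + dTh eta T y).

(* the (m-1)-form u^mu d_mu x, d_mu x = (-1)^(mu-1) dx^1..^dx^mu..dx^m *)
Definition omega0 : Form :=
  fun T y => \sum_(mu < m) (if T == [set~ mu] then (-1) ^+ mu * y (cU mu mi0) else 0).

Definition constF (c : R) : Form := fun T _ => if T == finset.set0 then c else 0.

End CE.

(* Z1/B1 isomorphic to Z2/B2 (as real vector spaces), expressed through a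
   linear map on representatives inducing a bijection of the quotients *)
Definition IsoQuot (R : realType) (m : nat) (Z1 B1 Z2 B2 : Form R m -> Prop) : Prop :=
  exists phi : Form R m -> Form R m,
    (forall (a : R) w w', phi (fun T y => a * w T y + w' T y)
                          = (fun T y => a * phi w T y + phi w' T y)) /\
    (forall z, Z1 z -> Z2 (phi z)) /\
    (forall b, B1 b -> B2 (phi b)) /\
    (forall z2, Z2 z2 -> exists z1, Z1 z1 /\ B2 (fun T y => z2 T y - phi z1 T y)) /\
    (forall z1, Z1 z1 -> B2 (phi z1) -> B1 z1).

(* Main.v *)
Require Import Defs.
From mathcomp Require Import all_boot all_order all_algebra.
From mathcomp Require Import all_classical all_reals all_analysis.
From mathcomp Require Import ring lra zify.
Set Implicit Arguments. Unset Strict Implicit. Unset Printing Implicit Defensive.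
Import Order.TTheory GRing.Theory Num.Theory.
Import numFieldNormedType.Exports.
Local Open Scope ring_scope.

(** Let [onS] be the subspace of points where all the functions CE_i vanish.  By Hadamard's
    lemma an element of A(B) lies in the ideal iff it vanishes on [onS], and the D_mu are
    tangent to [onS]; so all equations below are equations of functions on [onS].

    The linearization f |-> [dv f] intertwines D_i with the operators [totT i] on vertical
    one-forms, and f - f(x, 0) is recovered from [dv f] by the radial homotopy [Hint], which
    commutes with the D_i.  On vertical one-forms totT k = D_k + (shift k), and the shift has a
    one-sided inverse, so the geometric series Lam_k = sum_r (-D_k)^r (shift k)^-(r+1), which is
    locally finite, is a left inverse of [totT k] (k > 1) commuting with the other [totT i].
    Transporting it back to functions gives an operator [Gop k] with Gop_k D_k f = f - f(x, 0)
    and Gop_k D_i = D_i Gop_k for i > 1, i <> k.  With Cartan's formula this contracts the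
    complex Theta below its top degree, up to functions of x, for which antiderivatives do the
    same job.

    In the direction 1 the same series inverts D_1 up to the u^1-part of [dv f].  If D_1 f is a
    divergence, then f is therefore, up to divergences, determined by its Euler derivative e
    along u^1; applying all Euler operators to D_1 f shows D_mu e = 0 for every mu, so e is a
    constant c and f is c u^1 up to divergences. *)


(** Lowering a multi-index makes sense for tangent vectors, not for nonlinear functions; hence the
    detour through linearization and an integral along the fibres. Each operator must also stay
    inside A(B), which asks for directional derivatives and parameter integrals of smooth functions
    of finitely many coordinates. The obstacle is the direction 1. For k > 1 raising n^k keeps free
    coordinates free, whereas D_1 sends u^1_n with n^1 = 0 to a dependent coordinate. The right
    inverse of the shift in direction 1 loses exactly these components, and this loss is the source
    of the class in degree m-1. Contraction with Gop_k removes from a closed Theta-form the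
    components without dx^k; only the component of dx^2 /\ ... /\ dx^m escapes all of them, whence
    the restriction on the degree. Antiderivatives remove instead the components that contain dx^k,
    so they need positive degree. The passage from Theta to horizontal forms writes w = theta + dx^1
    /\ xi; then dH w = 0 means that theta is closed and D_1 theta = d xi. *)

(** * Linearity and symmetry of directional derivatives *)

Section DirectionalDerivatives.
Local Open Scope classical_set_scope.
Variables (R : realType) (V : normedModType R).
Implicit Types (g : V -> R) (x v w : V).

Lemma is_derive_line g x v t : derivable g (t *: v + x) v ->
  is_derive t 1 (fun s : R => g (s *: v + x)) ('D_v g (t *: v + x)).
Proof.
have E : (fun h : R => h^-1 *: (((fun s : R => g (s *: v + x)) \o shift t) (h *: 1)
            - g (t *: v + x)))
       = (fun h => h^-1 *: ((g \o shift (t *: v + x)) (h *: v) - g (t *: v + x))).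
  by apply/funext => h /=; rewrite [h *: 1]mulr1 scalerDl addrA.
by move=> dg; split; rewrite /derivable /derive E.
Qed.

Lemma derive_line g x v : derive1 (fun t : R => g (x + t *: v)) 0 = 'D_v g x.
Proof.
rewrite /derive1 /derive; set a := (fun h : R => _); set b := (fun h : R => _).
suff -> : a = b by [].
by apply/funext => h; rewrite /a /b /= addr0 scale0r addr0 [x + _]addrC.
Qed.

Lemma derivableZdir g x v (a : R) : derivable g x v ->
  derivable g x (a *: v) /\ 'D_(a *: v) g x = a * 'D_v g x.
Proof.
move=> dg.
have := @is_derive_line g x v 0; rewrite scale0r add0r => /(_ dg) dl.
have d1 : is_derive (0 : R) 1 (fun t : R => t * a) a.
  apply: is_derive_eq; rewrite scaler0 add0r [_ *: _]mulr1 //.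
have : is_derive (0 : R) 1 ((fun s : R => g (s *: v + x)) \o (fun t : R => t * a))
         ('D_v g x * a).
  by apply: is_derive1_comp; rewrite mul0r.
have -> : ((fun s : R => g (s *: v + x)) \o (fun t : R => t * a)) =
   (fun t : R => g (t *: (a *: v) + x)).
  by apply/funext => t /=; rewrite scalerA.
case=> dd dv; split; first exact/derivable1P.
rewrite mulrC -dv -derive_line derive1E.
by under eq_fun do rewrite addrC.
Qed.

Lemma mean_value g x v (h : R) : (forall x, derivable g x v) ->
  exists2 s : R, 0 <= s <= 1 & g (h *: v + x) - g x = h * 'D_v g ((s * h) *: v + x).
Proof.
move=> dg.
have dh y : derivable g y (h *: v) by case: (derivableZdir h (dg y)).
have dl (t : R) : is_derive t 1 (fun s : R => g (s *: (h *: v) + x)) ('D_(h *: v) g (t *: (h *: v) + x)).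
  exact: is_derive_line.
have [] := @MVT_segment R _ _ 0 1 ler01 (fun t _ => dl t).
  apply: derivable_within_continuous => t _; exact: (@ex_derive _ _ _ _ _ _ _ (dl t)).
move=> c; rewrite in_itv /= => c01; rewrite scale1r scale0r add0r subr0 mulr1 => E.
exists c => //; rewrite E scalerA.
by case: (derivableZdir h (dg ((c * h) *: v + x))).
Qed.

(** The mean value theorem supplies intermediate points whose parameters [s], [t] depend on [h] in
    an unknown way, so the neighbourhood has to be uniform in them. *)
Lemma near_segment (P : set V) x v w : nbhs x P ->
  \forall h \near (0 : R), forall s t : R, 0 <= s <= 1 -> 0 <= t <= 1 ->
    P ((s * h) *: v + ((t * h) *: w + x)).
Proof.
move=> /nbhs_ballP[e /= e0 eP].
have d0 : 0 < e / (`|v| + `|w| + 1) by rewrite divr_gt0// ltr_wpDl// addr_ge0.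
near=> h => s t s01 t01; apply: eP.
rewrite -ball_normE /= addrA opprD addrCA subrr addr0 normrN.
have hh : `|h| < e / (`|v| + `|w| + 1).
  near: h; apply/nbhs_ballP; exists (e / (`|v| + `|w| + 1)) => //= z.
  by rewrite -ball_normE /= sub0r normrN.
apply: le_lt_trans (ler_normD _ _) _; rewrite !normrZ.
have le1 (s' : R) : 0 <= s' <= 1 -> `|s'| <= 1 by case/andP => ? ?; rewrite ger0_norm.
have vv : `|s| * `|h| * `|v| <= `|h| * `|v|.
  by rewrite ler_wpM2r// ler_piMl// le1.
have ww : `|t| * `|h| * `|w| <= `|h| * `|w|.
  by rewrite ler_wpM2r// ler_piMl// le1.
apply: (le_lt_trans (lerD vv ww)).
rewrite -mulrDr; move: hh; rewrite ltr_pdivlMr; last by rewrite ltr_wpDl// addr_ge0.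
apply: le_lt_trans; by rewrite ler_wpM2l// lerDl.
Unshelve. all: by end_near. Qed.

(** The increment along [h *: (v + w)] is split at [h *: v + x]. By the mean value theorem its
    second half is a derivative along [w] at a point tending to [x], so continuity of ['D_w g]
    concludes. *)
Lemma deriveDdir g x v w : (forall x v, derivable g x v) ->
  (forall v, continuous ('D_v g)) -> 'D_(v + w) g x = 'D_v g x + 'D_w g x.
Proof.
move=> dg cg; apply: cvg_lim => //.
have E : (fun h : R => h^-1 *: ((g \o shift x) (h *: (v + w)) - g x)) =
  (fun h => h^-1 *: ((g \o shift x) (h *: v) - g x) +
            h^-1 *: (g (h *: w + (h *: v + x)) - g (h *: v + x))).
  apply/funext => h /=; rewrite -scalerDr; congr (_ *: _).
  by rewrite scalerDr [h *: v + h *: w]addrC -[h *: w + _ + x]addrA; ring.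
rewrite E; apply: cvgD; first exact: (dg x v).
apply/cvgrPdist_lt => e e0.
have := cg w x => /cvgrPdist_lt /(_ _ e0) /(near_segment w v) N.
near=> h.
have h0 : h != 0 by near: h; exact: nbhs_dnbhs_neq.
have [s s01 ->] := mean_value (h *: v + x) h (fun y => dg y w).
rewrite [_ *: _]mulrA mulVf// mul1r.
have N' : forall s t : R, 0 <= s <= 1 -> 0 <= t <= 1 ->
    `|'D_w g x - 'D_w g ((s * h) *: w + ((t * h) *: v + x))| < e.
  by near: h; exact: (@nbhs_dnbhs _ (0 : R) _ N).
have := N' s 1 s01; rewrite mul1r; apply; by rewrite ler01 lexx.
Unshelve. all: by end_near. Qed.

(** The second difference quotient is symmetric in [v] and [w], and two applications of the mean
    value theorem write it as either mixed derivative at a nearby point. *)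
Lemma derive_comm g x v w : (forall x v, derivable g x v) ->
  (forall u, forall x v, derivable ('D_u g) x v) ->
  (forall u v, continuous ('D_v ('D_u g))) ->
  'D_v ('D_w g) x = 'D_w ('D_v g) x.
Proof.
move=> dg ddg cdd.
suff main (v' w' : V) (e : R) : 0 < e -> \forall h \near (0 : R)^',
    `|'D_v' ('D_w' g) x -
      h^-1 * h^-1 * (g (h *: v' + (h *: w' + x)) - g (h *: v' + x) - g (h *: w' + x) + g x)| < e.
  apply/eqP; rewrite -subr_eq0 -normr_le0; apply/ler_addgt0Pr => e e0; rewrite add0r.
  have e2 : 0 < e / 2 by rewrite divr_gt0.
  have N1 := main v w _ e2; have N2 := main w v _ e2.
  near (0 : R)^' => h.
  have A1 : `|'D_v ('D_w g) x -
      h^-1 * h^-1 * (g (h *: v + (h *: w + x)) - g (h *: v + x) - g (h *: w + x) + g x)| < e / 2.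
    by near: h.
  have A2 : `|'D_w ('D_v g) x -
      h^-1 * h^-1 * (g (h *: w + (h *: v + x)) - g (h *: w + x) - g (h *: v + x) + g x)| < e / 2.
    by near: h.
  move: A2; rewrite [h *: w + (h *: v + x)]addrCA [X in h^-1 * h^-1 * (X + _)]addrAC.
  move: A1; set Q := _ * _ * _ => A1; rewrite distrC => A2.
  rewrite [e]splitr ltW// (le_lt_trans (ler_distD Q _ _)) // ltrD//.
move=> e0.
have := cdd w' v' x => /cvgrPdist_lt /(_ _ e0) /(near_segment w' v') N.
near=> h.
have h0 : h != 0 by near: h; exact: nbhs_dnbhs_neq.
pose k := fun y => g (y + h *: v') - g y.
have dk y : derivable k y w' /\ 'D_w' k y = 'D_w' g (h *: v' + y) - 'D_w' g y.
  have dS : is_derive y w' (fun y => g (y + h *: v')) ('D_w' g (h *: v' + y)).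
    have E : (fun t : R => t^-1 *: (((fun y => g (y + h *: v')) \o shift y) (t *: w') - g (y + h *: v')))
       = (fun t => t^-1 *: ((g \o shift (h *: v' + y)) (t *: w') - g (h *: v' + y))).
      by apply/funext => t /=; rewrite [h *: v' + y]addrC addrA.
    by split; rewrite /derivable /derive E; [exact: dg|].
  have dg' := derivableP (dg y w').
  by split; [apply: ex_derive | apply: derive_val].
have [s s01] := mean_value x h (fun y => (dk y).1).
rewrite (dk _).2.
have [t t01 ->] := mean_value ((s * h) *: w' + x) h (fun y => ddg w' y v').
have -> : k (h *: w' + x) - k x = g (h *: v' + (h *: w' + x)) - g (h *: v' + x) - g (h *: w' + x) + g x.
  rewrite /k [h *: w' + x + _]addrC [x + h *: v']addrC; ring.
move=> ->; rewrite -mulrA mulKf// mulKf//.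
have N' : forall s t : R, 0 <= s <= 1 -> 0 <= t <= 1 ->
    `|'D_v' ('D_w' g) x - 'D_v' ('D_w' g) ((s * h) *: w' + ((t * h) *: v' + x))| < e.
  by near: h; exact: (@nbhs_dnbhs _ (0 : R) _ N).
rewrite addrCA; exact: N'.
Unshelve. all: by end_near. Qed.

End DirectionalDerivatives.

(** * The integral over the unit interval *)

Section UnitIntegral.
Local Open Scope classical_set_scope.
Variable R : realType.
Implicit Types f g F : R -> R.

Definition int01 f : R := \int[lebesgue_measure]_(t in `[0, 1]) f t.

Lemma int01_integrable f : continuous f ->
  lebesgue_measure.-integrable `[0, 1] (EFin \o f).
Proof.
move=> cf; apply: continuous_compact_integrable; first exact: segment_compact.
exact: continuous_subspaceT.
Qed.

Lemma int01D f g : continuous f -> continuous g ->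
  int01 (fun t => f t + g t) = int01 f + int01 g.
Proof. by move=> cf cg; rewrite /int01 RintegralD//; exact: int01_integrable. Qed.

Lemma int01Z a f : continuous f -> int01 (fun t => a * f t) = a * int01 f.
Proof. by move=> cf; rewrite /int01 RintegralZl//; exact: int01_integrable. Qed.

Lemma int01B f g : continuous f -> continuous g ->
  int01 (fun t => f t - g t) = int01 f - int01 g.
Proof. by move=> cf cg; rewrite /int01 RintegralB//; exact: int01_integrable. Qed.

Lemma int01_0 : int01 (fun=> 0) = 0.
Proof. by rewrite /int01 Rintegral_cst// mul0r. Qed.

Lemma int01_FTC f F : continuous f -> (forall t : R, is_derive t 1 F (f t)) ->
  int01 f = F 1 - F 0.
Proof.
move=> cf dF; rewrite /int01 /Rintegral (@continuous_FTC2 R f F 0 1)//.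
- exact: continuous_subspaceT.
- have cF : continuous F.
    move=> t; apply: differentiable_continuous; apply/derivable1_diffP.
    exact: (@ex_derive _ _ _ _ _ _ _ (dF t)).
  split; first by move=> t _; exact: (@ex_derive _ _ _ _ _ _ _ (dF t)).
  + by apply: cvg_at_right_filter; exact: cF.
  + by apply: cvg_at_left_filter; exact: cF.
- by move=> t _; rewrite derive1E; exact: (@derive_val _ _ _ _ _ _ _ (dF t)).
Qed.

Lemma int01_norm_le f (e : R) : continuous f ->
  (forall t, 0 <= t <= 1 -> `|f t| <= e) -> `|int01 f| <= e.
Proof.
move=> cf fe; apply: (le_trans (le_normr_Rintegral _ _)) => //.
  exact: int01_integrable.
have <- : int01 (fun=> e) = e.
  have dl (t : R) : is_derive t 1 (fun t : R => t * e) e.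
    by apply: is_derive_eq; rewrite scaler0 add0r [_ *: _]mulr1.
  have := @int01_FTC (fun=> e) _ (fun t => @cst_continuous _ _ _ t) dl.
  by rewrite mul1r mul0r subr0.
apply: le_Rintegral => //.
- apply: (@int01_integrable (fun t => `|f t|)) => t.
  exact: (@continuous_comp _ _ _ f Num.norm t (cf t) (@norm_continuous _ _ _)).
- exact: (@int01_integrable (fun=> e) (fun t => @cst_continuous _ _ _ t)).
Qed.

End UnitIntegral.

(** * Continuity and differentiation under the integral sign *)

Section ParameterIntegral.
Local Open Scope classical_set_scope.
Variables (R : realType) (V : normedModType R).
Implicit Type psi : V -> R -> R.

(** Tube lemma: compactness of [0, 1] makes the continuity in [x] uniform in [t]. *)
Lemma near_uniform01 psi : continuous (fun p : V * R => psi p.1 p.2) ->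
  forall x (e : R), 0 < e ->
  \forall x' \near x, forall t, 0 <= t <= 1 -> `|psi x t - psi x' t| < e.
Proof.
move=> cp x e e0.
have /compact_near_coveringP K : compact (`[0, 1] : set R) by exact: segment_compact.
have := K V (nbhs x) (fun x' t => `|psi x t - psi x' t| < e) _.
move=> /(_ _) H; apply: filterS (H _) => [x' /= H' t t01|t _].
  by apply: H'; rewrite /= in_itv.
have e2 : 0 < e / 2 by rewrite divr_gt0.
have := cp (x, t) => /cvgrPdist_lt /(_ _ e2) [[A B] /= [nA nB] AB].
exists (B, A) => //= -[t' x'] /= [Bt' Ax'].
have h1 := AB (x, t') (conj (nbhs_singleton nA) Bt').
have h2 := AB (x', t') (conj Ax' Bt').
rewrite [e]splitr (le_lt_trans (ler_distD (psi x t) _ _)) // ltrD//=.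
by rewrite distrC.
Qed.

Lemma continuous_section psi x : continuous (fun p : V * R => psi p.1 p.2) ->
  continuous (psi x).
Proof.
move=> cp t; have := cp (x, t).
move=> /(_ _) H A /= /H [[B C] /= [nB nC] BC].
by apply: filterS nC => t' Ct'; apply: (BC (x, t')); split => //=; exact: nbhs_singleton nB.
Qed.

Lemma int01_continuous psi : continuous (fun p : V * R => psi p.1 p.2) ->
  continuous (fun x => int01 (psi x)).
Proof.
move=> cp x; apply/cvgrPdist_le => e e0.
have := near_uniform01 cp x e0; apply: filterS => x' H.
rewrite -int01B; [|exact: continuous_section..].
apply: int01_norm_le => [|t t01]; last exact/ltW/H.
by move=> t; apply: continuousB; exact: continuous_section.
Qed.

(** For each [t] the difference quotient is the derivative at an intermediate point; that point
    depends on [t], but [near_uniform01] controls the derivative there for all [t] at once. *)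
Lemma int01_derive psi v : continuous (fun p : V * R => psi p.1 p.2) ->
  (forall x t, derivable (psi ^~ t) x v) ->
  continuous (fun p : V * R => 'D_v (psi ^~ p.2) p.1) ->
  forall x, is_derive x v (fun x => int01 (psi x)) (int01 (fun t => 'D_v (psi ^~ t) x)).
Proof.
move=> cp dp cdp x.
pose dpsi x t := 'D_v (psi ^~ t) x.
suff L : (fun h : R => h^-1 *: (((fun x => int01 (psi x)) \o shift x) (h *: v)
     - int01 (psi x))) @ 0^' --> int01 (dpsi x).
  by split; [exact: cvgP L|exact: cvg_lim L].
apply/cvgrPdist_le => e e0.
have := @near_uniform01 dpsi cdp x e e0 => /(near_segment v v) N.
near=> h.
have h0 : h != 0 by near: h; exact: nbhs_dnbhs_neq.
have cs z := @continuous_section psi z cp.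
have cd : continuous (dpsi x) by exact: continuous_section.
rewrite /= -int01B // [_ *: _]mulrC mulrC -int01Z; last first.
  by move=> t; apply: continuousB; exact: cs.
have cq : continuous (fun t => h^-1 * (psi (h *: v + x) t - psi x t)).
  move=> t; apply: cvgM; first exact: cvg_cst.
  by apply: cvgB; exact: cs.
rewrite -int01B//; apply: int01_norm_le => [t|t t01].
  by apply: cvgB; [exact: cd|exact: cq].
have [s s01 /= ->] := @mean_value R V (psi ^~ t) x v h (fun y => dp y t).
rewrite mulKf//.
have N' : forall s r : R, 0 <= s <= 1 -> 0 <= r <= 1 ->
   forall t, 0 <= t <= 1 -> `|dpsi x t - dpsi ((s * h) *: v + ((r * h) *: v + x)) t| < e.
  by near: h; exact: (@nbhs_dnbhs _ (0 : R) _ N).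
have := N' s 0 s01; rewrite lexx ler01 mul0r scale0r add0r => /(_ isT t t01) /ltW.
exact.
Unshelve. all: by end_near. Qed.

End ParameterIntegral.

(** * Closure properties of smooth functions of finitely many variables *)

Section SmoothCalculus.
Local Open Scope classical_set_scope.
Variable R : realType.

Lemma mulmx_continuous n k (M : 'M[R]_(n, k)) :
  continuous (fun x : 'rV[R]_n => x *m M).
Proof.
have -> : (fun x : 'rV[R]_n => x *m M) = (fun x => \sum_i x 0 i *: row i M).
  by apply/funext => x; exact: mulmx_sum_row.
apply: continuous_big => [|i _ x]; first exact: add_continuous.
apply: (@continuous_comp _ _ _ (fun x : 'rV[R]_n => x 0 i) (fun r : R => r *: row i M)).
  exact: coord_continuous.
exact: scalel_continuous.
Qed.

Section OneDomain.
Variable n : nat.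
Implicit Types (f g : 'rV[R]_n -> R) (x v : 'rV[R]_n).

Lemma smooth_continuous g : smooth g -> continuous g.
Proof. by move/(_ 0%N). Qed.

Lemma smooth_derivable g x v : smooth g -> derivable g x v.
Proof. by move/(_ 1%N) => -[+ _]; apply. Qed.

Lemma smooth_derive g v : smooth g -> smooth ('D_v g).
Proof. by move=> sg k; case: (sg k.+1) => _; apply. Qed.

Lemma smooth_deriveD g x v w : smooth g -> 'D_(v + w) g x = 'D_v g x + 'D_w g x.
Proof.
move=> sg; apply: deriveDdir => *; first exact: smooth_derivable.
exact/smooth_continuous/smooth_derive.
Qed.

Lemma smooth_deriveZ g x v a : smooth g -> 'D_(a *: v) g x = a * 'D_v g x.
Proof. by move=> sg; case: (derivableZdir a (@smooth_derivable _ x v sg)). Qed.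

Lemma smooth_derive_coord g x v : smooth g ->
  'D_v g x = \sum_k v 0 k * 'D_(delta_mx 0 k) g x.
Proof.
move=> sg; rewrite {1}[v]row_sum_delta.
elim/big_ind2: _ => [|a b c d <- <-|i _]; first exact: derive0.
  exact: smooth_deriveD.
exact: smooth_deriveZ.
Qed.

Lemma smooth_derive_comm g x v w : smooth g -> 'D_v ('D_w g) x = 'D_w ('D_v g) x.
Proof.
move=> sg; apply: derive_comm => *.
- exact: smooth_derivable.
- exact/smooth_derivable/smooth_derive.
- exact/smooth_continuous/smooth_derive/smooth_derive.
Qed.

Lemma smooth_kD k f g : smooth_k k f -> smooth_k k g -> smooth_k k (fun x => f x + g x).
Proof.
elim: k f g => [|k IH] f g /=.
  by move=> cf cg x; exact: (@continuousD _ _ _ f g x (cf x) (cg x)).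
move=> [df sf] [dg sg]; split=> [x v|v]; first exact: derivableD.
have -> : (fun x => 'D_v (fun x => f x + g x) x) = (fun x => 'D_v f x + 'D_v g x).
  by apply/funext => x; exact: deriveD.
exact: IH.
Qed.

Lemma smoothD f g : smooth f -> smooth g -> smooth (fun x => f x + g x).
Proof. by move=> sf sg k; exact: smooth_kD. Qed.

Lemma smooth_cst (a : R) : smooth (fun _ : 'rV[R]_n => a).
Proof.
move=> k; elim: k a => [|k IH] a /=; first by move=> x; exact: cst_continuous.
split=> [x v|v]; first exact: derivable_cst.
have -> : (fun x => 'D_v (fun _ : 'rV[R]_n => a) x) = (fun=> 0).
  by apply/funext => x; exact: derive_cst.
exact: IH.
Qed.

Lemma smoothM f g : smooth f -> smooth g -> smooth (fun x => f x * g x).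
Proof.
move=> sf sg k; elim: k f g sf sg => [|k IH] f g sf sg /=.
  by move=> x; apply: (@continuousM _ _ f g x); exact: smooth_continuous.
split=> [x v|v]; first by apply: derivableM; exact: smooth_derivable.
have -> : (fun x => 'D_v (fun x => f x * g x) x) =
   (fun x => f x * 'D_v g x + g x * 'D_v f x).
  by apply/funext => x; apply: deriveM; exact: smooth_derivable.
by apply: smooth_kD; apply: IH => //; exact: smooth_derive.
Qed.

End OneDomain.

Lemma derive_mulmx n k (M : 'M[R]_(n, k)) (g : 'rV[R]_k -> R) x v :
  smooth g -> is_derive x v (fun x : 'rV[R]_n => g (x *m M)) ('D_(v *m M) g (x *m M)).
Proof.
move=> sg.
have E : (fun h : R => h^-1 *: (((fun x : 'rV[R]_n => g (x *m M)) \o shift x) (h *: v)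
            - g (x *m M)))
       = (fun h => h^-1 *: ((g \o shift (x *m M)) (h *: (v *m M)) - g (x *m M))).
  by apply/funext => h /=; rewrite mulmxDl scalemxAl.
split; rewrite /derivable /derive E //.
exact: smooth_derivable.
Qed.

Lemma smooth_mulmx n k (M : 'M[R]_(n, k)) (g : 'rV[R]_k -> R) :
  smooth g -> smooth (fun x : 'rV[R]_n => g (x *m M)).
Proof.
move=> sg j; elim: j g sg => [|j IH] g sg /=.
  move=> x; apply: (@continuous_comp _ _ _ (fun x : 'rV[R]_n => x *m M) g).
    exact: mulmx_continuous.
  exact: smooth_continuous.
split=> [x v|v]; first by have [] := derive_mulmx M x v sg.
have -> : (fun x => 'D_v (fun x : 'rV[R]_n => g (x *m M)) x) = (fun x => 'D_(v *m M) g (x *m M)).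
  by apply/funext => x; have [] := derive_mulmx M x v sg.
exact: (IH _ (@smooth_derive _ _ (v *m M) sg)).
Qed.

Lemma smooth_coord n (i : 'I_n) : smooth (fun x : 'rV[R]_n => x 0 i).
Proof.
case=> [|k] /=; first by move=> x; exact: coord_continuous.
have d (x v : 'rV[R]_n) : is_derive x v (fun x : 'rV[R]_n => x 0 i) (v 0 i).
  have E : (fun h : R => h^-1 *: (((fun x : 'rV[R]_n => x 0 i) \o shift x) (h *: v) - x 0 i)) @ 0^' --> v 0 i.
    apply: cvg_near_cst; near=> h; rewrite /= !mxE addrK [_ *: _]mulKf//.
    by near: h; exact: nbhs_dnbhs_neq.
  by split; [exact: cvgP E|exact: cvg_lim E].
split=> [x v|v]; first by have [] := d x v.
have -> : (fun x => 'D_v (fun x : 'rV[R]_n => x 0 i) x) = (fun=> v 0 i).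
  by apply/funext => x; have [] := d x v.
exact: smooth_cst.
Unshelve. all: by end_near. Qed.

Section SmoothIntegral.
Variables (n k : nat) (M0 M1 : 'M[R]_(n, k)).
Implicit Types (g : 'rV[R]_k -> R).

(** Differentiation in [x] produces a factor [t] from the summand [t *: M1]; with all powers of [t]
    included, the family is stable under derivatives and the smoothness of its integrals follows by
    induction. *)
Let psi p g (x : 'rV[R]_n) (t : R) := t ^+ p * g (x *m (M0 + t *: M1)).

Lemma pencil_continuous p g : smooth g ->
  continuous (fun q : 'rV[R]_n * R => psi p g q.1 q.2).
Proof.
move=> sg q; apply: cvgM.
  apply: (@continuous_comp _ _ _ snd (fun t : R => t ^+ p)); first exact: cvg_snd.
  exact: exprn_continuous.
apply: (@continuous_comp _ _ _ (fun q : 'rV[R]_n * R => q.1 *m (M0 + q.2 *: M1)) g); last first.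
  exact: smooth_continuous.
have -> : (fun q : 'rV[R]_n * R => q.1 *m (M0 + q.2 *: M1)) =
  (fun q => q.1 *m M0 + q.2 *: (q.1 *m M1)).
  by apply/funext => r; rewrite mulmxDr -scalemxAr.
have c M : {for q, continuous (fun q : 'rV[R]_n * R => q.1 *m M : 'rV[R]_k)}.
  apply: (@continuous_comp _ _ _ fst (fun x : 'rV[R]_n => x *m M)); first exact: cvg_fst.
  exact: mulmx_continuous.
apply: cvgD; first exact: c.
by apply: cvgZ; [exact: cvg_snd|exact: c].
Qed.

Lemma pencil_section_continuous p g x : smooth g -> continuous (psi p g x).
Proof. by move=> sg; exact: continuous_section (pencil_continuous sg). Qed.

Lemma pencil_derive p g x v t : smooth g ->
  is_derive x v (psi p g ^~ t)
    (psi p ('D_(v *m M0) g) x t + psi p.+1 ('D_(v *m M1) g) x t).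
Proof.
move=> sg.
have d := derive_mulmx (M0 + t *: M1) x v sg.
suff <- : t ^+ p *: 'D_(v *m (M0 + t *: M1)) g (x *m (M0 + t *: M1)) =
    psi p ('D_(v *m M0) g) x t + psi p.+1 ('D_(v *m M1) g) x t by exact: is_deriveZ.
rewrite /psi [v *m _]mulmxDr -scalemxAr smooth_deriveD// smooth_deriveZ// exprSr.
by rewrite [_ *: _]mulrDr mulrA.
Qed.

Lemma pencil_int_derive p g x v : smooth g ->
  is_derive x v (fun x => int01 (psi p g x))
    (int01 (psi p ('D_(v *m M0) g) x) + int01 (psi p.+1 ('D_(v *m M1) g) x)).
Proof.
move=> sg.
have s0 := smooth_derive (v *m M0) sg; have s1 := smooth_derive (v *m M1) sg.
have E y t : 'D_v (psi p g ^~ t) y =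
   psi p ('D_(v *m M0) g) y t + psi p.+1 ('D_(v *m M1) g) y t.
  by have [] := pencil_derive p y v t sg.
have := @int01_derive R _ (psi p g) v (pencil_continuous sg) _ _ x.
rewrite (_ : (fun t => _) = (fun t => psi p ('D_(v *m M0) g) x t + psi p.+1 ('D_(v *m M1) g) x t)); last first.
  exact/funext.
rewrite int01D; [|exact: pencil_section_continuous..].
apply.
- by move=> y t; have [] := pencil_derive p y v t sg.
- rewrite (_ : (fun q => _) = (fun q : 'rV[R]_n * R => psi p ('D_(v *m M0) g) q.1 q.2 + psi p.+1 ('D_(v *m M1) g) q.1 q.2)); last first.
    by apply/funext => q; exact: E.
  by move=> q; apply: cvgD; exact: pencil_continuous.
Qed.

Lemma smooth_pencil_int p g : smooth g -> smooth (fun x => int01 (psi p g x)).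
Proof.
move=> sg j; elim: j p g sg => [|j IH] p g sg /=.
  exact: int01_continuous (pencil_continuous sg).
split=> [x v|v]; first by have [] := pencil_int_derive p x v sg.
have -> : (fun x => 'D_v (fun x => int01 (psi p g x)) x) =
  (fun x => int01 (psi p ('D_(v *m M0) g) x) + int01 (psi p.+1 ('D_(v *m M1) g) x)).
  by apply/funext => x; have [] := pencil_int_derive p x v sg.
by apply: smooth_kD; apply: IH; exact: smooth_derive.
Qed.

End SmoothIntegral.

End SmoothCalculus.

(** * The algebra A(B): directional derivatives, linear substitutions, integrals *)

Section FunctionsOnB.
Local Open Scope classical_set_scope.
Variables (R : realType) (m : nat).
Local Notation Pt := (Defs.Pt R m).
Local Notation Fun := (Defs.Fun R m).
Local Notation Coord := (Defs.Coord m).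
Implicit Types (f g : Fun) (y v w : Pt) (c : Coord).

Definition line y v (t : R) : Pt := fun c => y c + t * v c.

Definition dv f y v : R := derive1 (fun t => f (line y v t)) 0.

Lemma line_row n (cs : 'I_n -> Coord) y v t :
  \row_k line y v t (cs k) = \row_k y (cs k) + t *: \row_k v (cs k).
Proof. by apply/rowP => k; rewrite !mxE. Qed.

Lemma dvE n (cs : 'I_n -> Coord) (g : 'rV[R]_n -> R) f y v :
  (forall y, f y = g (\row_k y (cs k))) ->
  dv f y v = 'D_(\row_k v (cs k)) g (\row_k y (cs k)).
Proof.
move=> E; rewrite /dv -derive_line; congr (derive1 _ _).
by apply/funext => t; rewrite E line_row.
Qed.

Lemma is_derive_inA f y v (t : R) : inA f ->
  is_derive t 1 (fun t => f (line y v t)) (dv f (line y v t) v).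
Proof.
move=> [n [cs [g [sg E]]]].
have -> : (fun t => f (line y v t)) = (fun t => g (t *: \row_k v (cs k) + \row_k y (cs k))).
  by apply/funext => s; rewrite E line_row addrC.
rewrite (dvE _ _ E) line_row addrC; apply: is_derive_line.
exact: smooth_derivable.
Qed.

Lemma continuous_line f y v : inA f -> continuous (fun t => f (line y v t)).
Proof.
move=> Af t; apply: differentiable_continuous; apply/derivable1_diffP.
by have [] := is_derive_inA y v t Af.
Qed.

Lemma line0 y v : line y v 0 = y.
Proof. by apply/funext => c; rewrite /line mul0r addr0. Qed.

Lemma dv_unique f y v l : is_derive (0 : R) 1 (fun t => f (line y v t)) l -> dv f y v = l.
Proof. by case=> _ <-; rewrite /dv derive1E. Qed.

Lemma is_derive_inA0 f y v : inA f ->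
  is_derive (0 : R) 1 (fun t => f (line y v t)) (dv f y v).
Proof. by move=> /(is_derive_inA y v 0); rewrite line0. Qed.

Lemma dv_cst a y v : dv (fun=> a) y v = 0.
Proof. by rewrite /dv derive1_cst. Qed.

Lemma dv_coord c y v : dv (fun y => y c) y v = v c.
Proof.
apply: dv_unique; rewrite /line.
by apply: is_derive_eq; rewrite add0r mul1r scaler0 add0r [_ *: _]mulr1.
Qed.

Lemma dvD f g y v : inA f -> inA g -> dv (fun y => f y + g y) y v = dv f y v + dv g y v.
Proof.
move=> Af Ag; apply: dv_unique.
exact: is_deriveD (is_derive_inA0 y v Af) (is_derive_inA0 y v Ag).
Qed.

Lemma dvM f g y v : inA f -> inA g ->
  dv (fun y => f y * g y) y v = f y * dv g y v + g y * dv f y v.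
Proof.
move=> Af Ag; apply: dv_unique.
have := is_deriveM (is_derive_inA0 y v Af) (is_derive_inA0 y v Ag).
by rewrite !line0.
Qed.

Lemma dvZ f a y v : inA f -> dv (fun y => a * f y) y v = a * dv f y v.
Proof.
move=> Af; apply: dv_unique; exact: is_deriveZ (is_derive_inA0 y v Af).
Qed.

(** The two functions may depend on different lists of coordinates; both are pulled back to the
    concatenated list along the block projections [ml] and [mr]. *)
Lemma inA2 (op : forall n, ('rV[R]_n -> R) -> ('rV[R]_n -> R) -> 'rV[R]_n -> R)
    (opR : R -> R -> R) f g :
  (forall n h k x, op n h k x = opR (h x) (k x)) ->
  (forall n h k, smooth h -> smooth k -> smooth (op n h k)) ->
  inA f -> inA g -> inA (fun y => opR (f y) (g y)).
Proof.
move=> opE ops [n [cs [h [sh Eh]]]] [p [ds [k [sk Ek]]]].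
pose es i := match fintype.split i with inl j => cs j | inr j => ds j end.
pose ml : 'M[R]_(n + p, n) := col_mx 1%:M 0.
pose mr : 'M[R]_(n + p, p) := col_mx 0 1%:M.
exists (n + p)%N, es, (op _ (fun x => h (x *m ml)) (fun x => k (x *m mr))); split.
  by apply: ops; exact: smooth_mulmx.
move=> y; rewrite opE Eh Ek.
have -> : \row_i y (es i) = row_mx (\row_i y (cs i)) (\row_i y (ds i)).
  apply/rowP => i; rewrite !mxE /es; case: fintype.split => j; by rewrite mxE.
by rewrite !mul_row_col !mulmx0 !mulmx1 addr0 add0r.
Qed.

Lemma inA_add f g : inA f -> inA g -> inA (fun y => f y + g y).
Proof.
apply: (@inA2 (fun n h k x => h x + k x) +%R) => // n h k; exact: smoothD.
Qed.

Lemma inA_mul f g : inA f -> inA g -> inA (fun y => f y * g y).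
Proof.
apply: (@inA2 (fun n h k x => h x * k x) *%R) => // n h k; exact: smoothM.
Qed.

Lemma inA_cst a : inA (fun _ : Pt => a).
Proof.
exists 0%N, (fun i : 'I_0 => match ltn_ord i with e => cP (mi0 m) end), (fun=> a); split => //.
exact: smooth_cst.
Qed.

Lemma inA_coord c : inA (fun y : Pt => y c).
Proof.
exists 1%N, (fun=> c), (fun x => x 0 0); split; first exact: smooth_coord.
by move=> y; rewrite mxE.
Qed.

Lemma inA_scale a f : inA f -> inA (fun y => a * f y).
Proof. by apply: inA_mul; exact: inA_cst. Qed.

Lemma inA_opp f : inA f -> inA (fun y => - f y).
Proof.
move=> /(inA_scale (-1)); congr (inA _); apply/funext => y; exact: mulN1r.
Qed.

Lemma inA_sub f g : inA f -> inA g -> inA (fun y => f y - g y).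
Proof. by move=> Af /inA_opp; exact: inA_add. Qed.

Lemma inA_sum (I : Type) (r : seq I) (P : pred I) (F : I -> Fun) :
  (forall i, P i -> inA (F i)) -> inA (fun y => \sum_(i <- r | P i) F i y).
Proof.
move=> AF; elim: r => [|i r IH].
  by under eq_fun do rewrite big_nil; exact: inA_cst.
case Pi: (P i); under eq_fun do rewrite big_cons Pi; last exact: IH.
by apply: inA_add => //; exact: AF.
Qed.

Lemma dvB f g y v : inA f -> inA g -> dv (fun y => f y - g y) y v = dv f y v - dv g y v.
Proof.
move=> Af Ag; rewrite dvD//; last exact: inA_opp.
rewrite (_ : (fun y => - g y) = (fun y => -1 * g y)) ?dvZ ?mulN1r//.
by apply/funext => z; rewrite mulN1r.
Qed.

Lemma dv_sum (I : Type) (r : seq I) (P : pred I) (F : I -> Fun) y v :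
  (forall i, P i -> inA (F i)) ->
  dv (fun y => \sum_(i <- r | P i) F i y) y v = \sum_(i <- r | P i) dv (F i) y v.
Proof.
move=> AF; elim: r => [|i r IH].
  by rewrite big_nil; under eq_fun do rewrite big_nil; exact: dv_cst.
rewrite big_cons; case Pi: (P i); under eq_fun do rewrite big_cons Pi; last exact: IH.
by rewrite dvD ?IH//; [exact: AF|exact: inA_sum].
Qed.

Definition finlin (phi : Pt -> R) : Prop :=
  exists n (cs : 'I_n -> Coord) (a : 'I_n -> R), forall y, phi y = \sum_k a k * y (cs k).

(** Linearity alone would not do: each component has to involve finitely many coordinates, so that
    substitution preserves A(B). *)
Definition linmap (M : Pt -> Pt) : Prop := forall c, finlin (fun y => M y c).

Lemma finlin_line phi y v t : finlin phi -> phi (line y v t) = phi y + t * phi v.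
Proof.
move=> [n [cs [a E]]]; rewrite !E mulr_sumr -big_split; apply: eq_bigr => k _.
by rewrite /line mulrDr mulrCA.
Qed.

Lemma linmap_line M y v t : linmap M -> M (line y v t) = line (M y) (M v) t.
Proof. by move=> lM; apply/funext => c; rewrite (finlin_line _ _ _ (lM c)). Qed.

Lemma finlin0 : finlin (fun=> 0).
Proof.
exists 0%N, (fun i : 'I_0 => match ltn_ord i with e => cP (mi0 m) end), (fun=> 0).
by move=> y; rewrite big_ord0.
Qed.

Lemma finlin_coord c : finlin (fun y => y c).
Proof. by exists 1%N, (fun=> c), (fun=> 1) => y; rewrite big_ord1 mul1r. Qed.

Lemma finlinD phi psi : finlin phi -> finlin psi -> finlin (fun y => phi y + psi y).
Proof.
move=> [n [cs [a Ea]]] [p [ds [b Eb]]].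
exists (n + p)%N, (fun i => match fintype.split i with inl j => cs j | inr j => ds j end),
  (fun i => match fintype.split i with inl j => a j | inr j => b j end) => y.
rewrite big_split_ord Ea Eb; congr (_ + _); apply: eq_bigr => i _.
  by case: fintype.splitP => j /= => [/ord_inj <-//|E]; have := ltn_ord i; rewrite E ltnNge leq_addr.
case: fintype.splitP => j /= => [E|/addnI /ord_inj <-//].
by have := ltn_ord j; rewrite -E ltnNge leq_addr.
Qed.

Lemma finlinZ a phi : finlin phi -> finlin (fun y => a * phi y).
Proof.
move=> [n [cs [b Eb]]]; exists n, cs, (fun k => a * b k) => y.
by rewrite Eb mulr_sumr; apply: eq_bigr => k _; rewrite mulrA.
Qed.

Lemma finlinN phi : finlin phi -> finlin (fun y => - phi y).
Proof. by move=> /(finlinZ (-1)); congr finlin; apply/funext => y; exact: mulN1r. Qed.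

Lemma finlin_sum (I : Type) (r : seq I) (P : pred I) (F : I -> Pt -> R) :
  (forall i, P i -> finlin (F i)) -> finlin (fun y => \sum_(i <- r | P i) F i y).
Proof.
move=> AF; elim: r => [|i r IH].
  by under eq_fun do rewrite big_nil; exact: finlin0.
case Pi: (P i); under eq_fun do rewrite big_cons Pi; last exact: IH.
by apply: finlinD => //; exact: AF.
Qed.

Lemma finlin_comp phi M : finlin phi -> linmap M -> finlin (fun y => phi (M y)).
Proof.
move=> [n [cs [a E]]] lM; under eq_fun do rewrite E.
by apply: finlin_sum => k _; apply: finlinZ; exact: lM.
Qed.

Lemma linmap_comp M M' : linmap M -> linmap M' -> linmap (fun y => M (M' y)).
Proof. by move=> lM lM' c; exact: (finlin_comp (lM c)). Qed.

Lemma linmap_id : linmap id.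
Proof. by move=> c; exact: finlin_coord. Qed.

Lemma linmap_iter M k : linmap M -> linmap (iter k M).
Proof.
by move=> lM; elim: k => [|k IH]; [exact: linmap_id|exact: linmap_comp].
Qed.

Lemma finlin_rows n (phi : 'I_n -> Pt -> R) : (forall k, finlin (phi k)) ->
  exists N (cs : 'I_N -> Coord) (M : 'M[R]_(N, n)),
    forall y, \row_k phi k y = (\row_j y (cs j)) *m M.
Proof.
elim: n phi => [|n IH] phi fl.
  exists 0%N, (fun i : 'I_0 => match ltn_ord i with e => cP (mi0 m) end), 0 => y.
  by apply/rowP => -[].
have [N [cs [M EM]]] := IH (fun k => phi (lift ord0 k)) (fun k => fl _).
have [p [ds [a Ea]]] := fl ord0.
exists (p + N)%N, (fun i => match fintype.split i with inl j => ds j | inr j => cs j end),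
  (\matrix_(i, k) match fintype.split i, unlift ord0 k with
     | inl j, None => a j | inr j, Some k' => M j k' | _, _ => 0 end) => y.
have sl j : fintype.split (lshift N j) = inl j :> 'I_p + 'I_N := unsplitK (inl j).
have sr j : fintype.split (rshift p j) = inr j :> 'I_p + 'I_N := unsplitK (inr j).
apply/rowP => k; rewrite !mxE big_split_ord /=.
under eq_bigr do rewrite !mxE sl; under [X in _ + X]eq_bigr do rewrite !mxE sr.
case: (unliftP ord0 k) => [j|] ->.
  rewrite big1 ?add0r => [|i _]; last by rewrite mulr0.
  have := congr1 (fun A : 'rV[R]_n => A 0 j) (EM y); rewrite !mxE => ->.
  by apply: eq_bigr => i _; rewrite mxE.
rewrite [X in _ + X]big1 ?addr0 => [|i _]; last by rewrite mulr0.
by rewrite Ea; apply: eq_bigr => i _; rewrite mulrC.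
Qed.

Lemma inA_pencil f M0 M1 : inA f -> linmap M0 -> linmap M1 ->
  exists n (cs : 'I_n -> Coord) p (g : 'rV[R]_p -> R) (A0 A1 : 'M[R]_(n, p)),
  smooth g /\ forall y v, f (line (M0 y) (M1 v) 1) =
    g ((\row_j y (cs j)) *m A0 + (\row_j v (cs j)) *m A1).
Proof.
move=> [p [ds [g [sg E]]]] l0 l1.
pose phi (i : 'I_(p + p)) := match fintype.split i with inl j => (fun y => M0 y (ds j))
   | inr j => (fun y => M1 y (ds j)) end.
have /finlin_rows [n [cs [A EA]]] : forall i, finlin (phi i).
  by move=> i; rewrite /phi; case: fintype.split => j; [exact: l0|exact: l1].
exists n, cs, p, g, (lsubmx A), (rsubmx A); split => // y v.
rewrite E; congr g; rewrite line_row scale1r; congr (_ + _).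
  have := congr1 lsubmx (EA y); rewrite -[in RHS](hsubmxK A) mul_mx_row row_mxKl => <-.
  apply/rowP => j; rewrite !mxE /phi.
  by case: fintype.splitP => i /= => [/ord_inj <-//|E']; have := ltn_ord j; rewrite E' ltnNge leq_addr.
have := congr1 rsubmx (EA v); rewrite -[in RHS](hsubmxK A) mul_mx_row row_mxKr => <-.
apply/rowP => j; rewrite !mxE /phi.
case: fintype.splitP => i /= => [E'|/addnI /ord_inj <-//].
by have := ltn_ord i; rewrite -E' ltnNge leq_addr.
Qed.

(** Common shape of three operators below: the radial homotopy, the antiderivative in x^k, and the
    coefficients in Hadamard's lemma. *)
Definition int_pencil (M0 M1 : Pt -> Pt) f : Fun :=
  fun y => int01 (fun t => f (line (M0 y) (M1 y) t)).

Lemma inA_int_pencil f M0 M1 : inA f -> linmap M0 -> linmap M1 ->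
  inA (int_pencil M0 M1 f) /\
  forall y v, dv (int_pencil M0 M1 f) y v =
    int01 (fun t => dv f (line (M0 y) (M1 y) t) (line (M0 v) (M1 v) t)).
Proof.
move=> Af l0 l1; have [n [cs [p [g [A0 [A1 [sg E]]]]]]] := inA_pencil Af l0 l1.
have E2 y t : f (line (M0 y) (M1 y) t) = g ((\row_j y (cs j)) *m (A0 + t *: A1)).
  (* The second argument is the vector t y, so that the point with parameter 1 on the new line is
     the point with parameter [t] on the old one. *)
  have := E y (line (fun=> 0) y t); rewrite linmap_line//.
  have -> : line (M0 y) (line (M1 (fun=> 0)) (M1 y) t) 1 = line (M0 y) (M1 y) t.
    have M10 : M1 (fun=> 0) = fun=> 0.
      apply/funext => c; have [q [es [b ->]]] := l1 c.
      by apply: big1 => k _; rewrite mulr0.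
    by rewrite M10; apply/funext => c; rewrite /line mul1r add0r.
  move=> ->; congr g; rewrite mulmxDr -scalemxAr; congr (_ + _).
  rewrite line_row mulmxDl -scalemxAl (_ : \row__ _ = 0) ?mul0mx ?add0r//.
  by apply/rowP => j; rewrite !mxE.
pose G x := int01 (fun t => t ^+ 0 * g (x *m (A0 + t *: A1))).
have EI y : int_pencil M0 M1 f y = G (\row_j y (cs j)).
  by rewrite /int_pencil /G; congr int01; apply/funext => t; rewrite mul1r E2.
split.
  exists n, cs, G.
  by split => //; exact: smooth_pencil_int.
move=> y v; rewrite (dvE y v EI).
set x := \row_j y (cs j); set w := \row_j v (cs j).
have [_ ->] := pencil_int_derive A0 A1 0 x w sg.
have c0 := @pencil_section_continuous R n p A0 A1 0 _ x (@smooth_derive _ _ _ (w *m A0) sg).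
have c1 := @pencil_section_continuous R n p A0 A1 1 _ x (@smooth_derive _ _ _ (w *m A1) sg).
rewrite -(int01D c0 c1).
congr int01; apply/funext => t.
rewrite mul1r expr1 -smooth_deriveZ// -smooth_deriveD// scalemxAr -mulmxDr.
rewrite /dv -derive_line; congr (derive1 _ _); apply/funext => s.
have -> : line (line (M0 y) (M1 y) t) (line (M0 v) (M1 v) t) s =
    line (M0 (line y v s)) (M1 (line y v s)) t.
  by rewrite !linmap_line//; apply/funext => c; rewrite /line; ring.
by rewrite E2 line_row mulmxDl scalemxAl.
Qed.

Lemma dv_subst f M y v : linmap M -> dv (fun y => f (M y)) y v = dv f (M y) (M v).
Proof.
move=> lM; rewrite /dv; congr (derive1 _ _).
by apply/funext => t; rewrite linmap_line.
Qed.

Lemma inA_subst f M : inA f -> linmap M -> inA (fun y => f (M y)).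
Proof.
move=> [n [cs [g [sg E]]]] lM.
have [N [ds [A EA]]] := finlin_rows (fun k => lM (cs k)).
exists N, ds, (fun x => g (x *m A)); split; first exact: smooth_mulmx.
by move=> y; rewrite E EA.
Qed.

Lemma int01_dv f y v : inA f ->
  int01 (fun t => dv f (line y v t) v) = f (line y v 1) - f y.
Proof.
move=> Af; transitivity (f (line y v 1) - f (line y v 0)); last by rewrite line0.
apply: (@int01_FTC _ _ (fun t => f (line y v t))); last first.
  by move=> t; exact: is_derive_inA.
have [n [cs [g [sg E]]]] := Af.
apply: (@continuous_line (fun y => dv f y v)).
exists n, cs, ('D_(\row_k v (cs k)) g); split; first exact: smooth_derive.
by move=> z; rewrite (dvE _ _ E).
Qed.

Lemma dv_comm f y v w : inA f ->
  dv (fun y => dv f y v) y w = dv (fun y => dv f y w) y v.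
Proof.
move=> [n [cs [g [sg E]]]].
have F v' w' : dv (fun y => dv f y v') y w' =
    'D_(\row_k w' (cs k)) ('D_(\row_k v' (cs k)) g) (\row_k y (cs k)).
  by apply: dvE => z; exact: dvE.
by rewrite !F smooth_derive_comm.
Qed.

End FunctionsOnB.

(** * One-forms, total derivatives and the radial homotopy *)

Section VerticalForms.
Local Open Scope classical_set_scope.
Variables (R : realType) (m : nat).
Local Notation Pt := (Defs.Pt R m).
Local Notation Fun := (Defs.Fun R m).
Local Notation Coord := (Defs.Coord m).
Implicit Types (f g : Fun) (y v : Pt) (c : Coord) (i j k : 'I_m).

Lemma DtE i f y : Dt i f y = dv f y (Vf i y).
Proof. by []. Qed.

(* [nice w]: w(y, v) is a finite sum of terms a(y) v_c with a in A(B), i.e. a vertical one-form. *)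
Inductive nice : (Pt -> Pt -> R) -> Prop :=
| nice0 : nice (fun _ _ => 0)
| nice_cons a c w : inA a -> nice w -> nice (fun y v => a y * v c + w y v).

Lemma nice_add w w' : nice w -> nice w' -> nice (fun y v => w y v + w' y v).
Proof.
move=> nw nw'; elim: nw => [|a c u Aa _ IH].
  by under eq_fun do under eq_fun do rewrite add0r.
under eq_fun do under eq_fun do rewrite -addrA.
exact: nice_cons.
Qed.

Lemma nice_mono a c : inA a -> nice (fun y v => a y * v c).
Proof.
move=> Aa; have := nice_cons c Aa nice0.
by under eq_fun do under eq_fun do rewrite addr0.
Qed.

Lemma nice_sum (I : Type) (r : seq I) (P : pred I) (F : I -> Pt -> Pt -> R) :
  (forall i : I, P i -> nice (F i)) -> nice (fun y v => \sum_(i <- r | P i) F i y v).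
Proof.
move=> nF; elim: r => [|i r IH].
  under eq_fun do under eq_fun do rewrite big_nil; exact: nice0.
case Pi: (P i); under eq_fun do under eq_fun do rewrite big_cons Pi; last exact: IH.
by apply: nice_add => //; exact: nF.
Qed.

Lemma nice_mul a w : inA a -> nice w -> nice (fun y v => a y * w y v).
Proof.
move=> Aa; elim=> [|b c u Ab _ IH].
  under eq_fun do under eq_fun do rewrite mulr0; exact: nice0.
under eq_fun do under eq_fun do rewrite mulrDr mulrA.
by apply: nice_cons => //; exact: inA_mul.
Qed.

Lemma nice_scale (a : R) w : nice w -> nice (fun y v => a * w y v).
Proof. by apply: nice_mul; exact: inA_cst. Qed.

Lemma nice_line w y v v' t : nice w -> w y (line v v' t) = w y v + t * w y v'.
Proof.
elim=> [|a c u _ _ IH]; first by rewrite mulr0 addr0.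
by rewrite IH /line; ring.
Qed.

Lemma nice_zero w y : nice w -> w y (fun=> 0) = 0.
Proof. by elim=> [//|a c u _ _ ->]; rewrite mulr0 addr0. Qed.

Lemma nice_vscale w y a v : nice w -> w y (fun c => a * v c) = a * w y v.
Proof. by elim=> [|b c u _ _ ->]; [rewrite mulr0|ring]. Qed.

Lemma nice_vsub w y v v' : nice w -> w y (fun c => v c - v' c) = w y v - w y v'.
Proof. by elim=> [|b c u _ _ ->]; [rewrite subr0|ring]. Qed.

Lemma nice_inA_comp w (phi : Pt -> Pt) : nice w -> (forall c, inA (fun y => phi y c)) ->
  inA (fun y => w y (phi y)).
Proof.
move=> nw Aphi; elim: nw => [|a c u Aa _ IH]; first exact: inA_cst.
by apply: inA_add => //; apply: inA_mul.
Qed.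

Lemma nice_inA w v : nice w -> inA (w^~ v).
Proof. by move=> nw; apply: (@nice_inA_comp _ (fun=> v)) => // c; exact: inA_cst. Qed.

Lemma nice_subst w M : nice w -> linmap M -> nice (fun y v => w y (M v)).
Proof.
move=> nw lM; elim: nw => [|a c u Aa _ IH]; first exact: nice0.
apply: nice_add => //; have [n [cs [b E]]] := lM c.
under eq_fun do under eq_fun do rewrite E.
apply: nice_mul => //; apply: nice_sum => k _.
by apply: (@nice_mono (fun=> b k)); exact: inA_cst.
Qed.

Lemma dv_nice f : inA f -> nice (dv f).
Proof.
move=> [n [cs [g [sg E]]]].
have -> : dv f = (fun y v => \sum_k ('D_(delta_mx 0 k) g) (\row_j y (cs j)) * v (cs k)).
  apply/funext => y; apply/funext => v; rewrite (dvE _ _ E) smooth_derive_coord//.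
  by apply: eq_bigr => k _; rewrite mxE mulrC.
apply: nice_sum => k _; apply: (@nice_mono (fun y => ('D_(delta_mx 0 k) g) (\row_j y (cs j)))).
exists n, cs, ('D_(delta_mx 0 k) g); split => //; exact: smooth_derive.
Qed.

Lemma inA_Vf i c : inA (fun y => Vf i y c).
Proof.
case: c => [[j|[la k]]|k] /=; [exact: inA_cst|exact: inA_coord|exact: inA_coord].
Qed.

Lemma inA_Dt i f : inA f -> inA (Dt i f).
Proof.
by move=> /dv_nice nf; apply: (nice_inA_comp nf) => c; exact: inA_Vf.
Qed.

Lemma DtD i f g y : inA f -> inA g -> Dt i (fun y => f y + g y) y = Dt i f y + Dt i g y.
Proof. exact: dvD. Qed.

Lemma DtB i f g y : inA f -> inA g -> Dt i (fun y => f y - g y) y = Dt i f y - Dt i g y.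
Proof. exact: dvB. Qed.

Lemma DtZ i a f y : inA f -> Dt i (fun y => a * f y) y = a * Dt i f y.
Proof. exact: dvZ. Qed.

Lemma Dt_sum i (I : Type) (r : seq I) (P : pred I) (F : I -> Fun) y :
  (forall i : I, P i -> inA (F i)) ->
  Dt i (fun y => \sum_(j <- r | P j) F j y) y = \sum_(j <- r | P j) Dt i (F j) y.
Proof. by move=> AF; rewrite DtE dv_sum. Qed.

Lemma Dt0 i y : Dt i (fun=> 0) y = 0 :> R.
Proof. by rewrite DtE dv_cst. Qed.

(* The linear part of D_i, acting on tangent vectors. *)
Definition Ash i v : Pt := fun c => match c with
  | inl (inl _) => 0
  | inl (inr (la, k)) => v (cU la (incr k i))
  | inr k => v (cP (incr k i))
  end.

Lemma linmap_Ash i : linmap (Ash i).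
Proof.
by case=> [[j|[la k]]|k] /=; [exact: finlin0|exact: finlin_coord|exact: finlin_coord].
Qed.

Lemma incr_comm (k : mi m) i j : incr (incr k i) j = incr (incr k j) i.
Proof. by apply/ffunP => n; rewrite !ffunE addnAC. Qed.

Lemma Ash_Vf i j y : Ash i (Vf j y) = Ash j (Vf i y).
Proof.
by apply/funext; case=> [[l|[la k]]|k] //=; rewrite incr_comm.
Qed.

Lemma Ash_comm i j v : Ash i (Ash j v) = Ash j (Ash i v).
Proof.
by apply/funext; case=> [[l|[la k]]|k] //=; rewrite incr_comm.
Qed.

(** The Lie derivative of a one-form along D_i: its coefficients are differentiated and its argument
    is shifted. *)
Definition totT i (w : Pt -> Pt -> R) : Pt -> Pt -> R :=
  fun y v => Dt i (w^~ v) y + w y (Ash i v).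

Lemma nice_Dt i w : nice w -> nice (fun y v => Dt i (w^~ v) y).
Proof.
elim=> [|a c u Aa nu IH].
  under eq_fun do under eq_fun do rewrite Dt0; exact: nice0.
have -> : (fun y v => Dt i ((fun y v => a y * v c + u y v)^~ v) y) =
    (fun y v => Dt i a y * v c + Dt i (u^~ v) y).
  apply/funext => y; apply/funext => v; rewrite DtD; last exact: nice_inA.
    by congr (_ + _); under eq_fun do rewrite mulrC; rewrite DtZ// mulrC.
  by apply: inA_mul => //; exact: inA_cst.
by apply: nice_cons => //; exact: inA_Dt.
Qed.

Lemma nice_totT i w : nice w -> nice (totT i w).
Proof.
move=> nw; apply: nice_add; first exact: nice_Dt.
by apply: nice_subst => //; exact: linmap_Ash.
Qed.

Lemma dv_nice_Vf i w y v : nice w ->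
  dv (fun y => w y (Vf i y)) y v = dv (w^~ (Vf i y)) y v + w y (Ash i v).
Proof.
elim=> [|a c u Aa nu IH]; first by rewrite !dv_cst addr0.
have Au := nice_inA_comp nu (inA_Vf i).
have Ac := inA_Vf i c.
rewrite dvD//; last exact: inA_mul.
rewrite [X in _ = X + _]dvD; [|by apply: inA_mul => //; exact: inA_cst|exact: nice_inA].
rewrite IH dvM// dvM//; last exact: inA_cst.
rewrite dv_cst mulr0 add0r.
have -> : dv (fun y => Vf i y c) y v = Ash i v c; last by ring.
case: c {Ac} => [[l|[la k]]|k] /=; [exact: dv_cst|exact: dv_coord|exact: dv_coord].
Qed.

(** Differentiating D_i f along [v] gives a second derivative of f, whose symmetry yields the first
    term of [totT], and the derivative of the coefficients of D_i, which is the shift. *)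
Lemma dv_Dt i f y v : inA f -> dv (Dt i f) y v = totT i (dv f) y v.
Proof.
by move=> Af; rewrite (dv_nice_Vf i y v (dv_nice Af)) /totT DtE (dv_comm _ _ _ Af).
Qed.

Lemma Dt_comm i j f y : inA f -> Dt i (Dt j f) y = Dt j (Dt i f) y.
Proof.
move=> Af; rewrite !DtE (dv_Dt j _ _ Af) (dv_Dt i _ _ Af) /totT !DtE Ash_Vf.
by rewrite (dv_comm _ _ _ Af).
Qed.

Definition keepX y : Pt := fun c => match c with inl (inl _) => y c | _ => 0 end.
Definition keepU y : Pt := fun c => match c with inl (inl _) => 0 | _ => y c end.

Lemma linmap_keepX : linmap keepX.
Proof. by case=> [[j|[la k]]|k] /=; [exact: finlin_coord|exact: finlin0..]. Qed.

Lemma linmap_keepU : linmap keepU.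
Proof. by case=> [[j|[la k]]|k] /=; [exact: finlin0|exact: finlin_coord..]. Qed.

Definition scaleU y t := line (keepX y) (keepU y) t.

Lemma scaleU1 y : scaleU y 1 = y.
Proof.
apply/funext; case=> [[l|[la k]]|k]; by rewrite /scaleU /line /= mul1r ?addr0 ?add0r.
Qed.

(** The fibre components of D_i are linear in the fibre and its x-components are constant, so
    scaling the fibre preserves the vector field. This is why the radial homotopy commutes with
    D_i. *)
Lemma Vf_scaleU i y t : Vf i (scaleU y t) = line (keepX (Vf i y)) (keepU (Vf i y)) t.
Proof.
apply/funext; case=> [[l|[la k]]|k]; by rewrite /scaleU /line /= ?mulr0 ?addr0 ?add0r.
Qed.

Lemma Ash_keepU i y : Ash i (keepU y) = keepU (Vf i y).
Proof. by apply/funext; case=> [[l|[la k]]|k]. Qed.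

Definition Hint (w : Pt -> Pt -> R) : Fun := fun y => int01 (fun t => w (scaleU y t) (keepU y)).

Lemma Hint_continuous w y v : nice w -> continuous (fun t => w (scaleU y t) v).
Proof. by move=> nw; apply: (@continuous_line _ _ (w^~ v)); exact: nice_inA. Qed.

Lemma HintD w w' y : nice w -> nice w' -> Hint (fun y v => w y v + w' y v) y = Hint w y + Hint w' y.
Proof. by move=> nw nw'; rewrite /Hint int01D//; exact: Hint_continuous. Qed.

Lemma HintZ a w y : nice w -> Hint (fun y v => a * w y v) y = a * Hint w y.
Proof. by move=> nw; rewrite /Hint int01Z//; exact: Hint_continuous. Qed.

Lemma HintB w w' y : nice w -> nice w' -> Hint (fun y v => w y v - w' y v) y = Hint w y - Hint w' y.
Proof. by move=> nw nw'; rewrite /Hint int01B//; exact: Hint_continuous. Qed.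

Lemma Hint_cons a c w y : inA a -> nice w ->
  Hint (fun y v => a y * v c + w y v) y = int_pencil keepX keepU a y * keepU y c + Hint w y.
Proof.
move=> Aa nw; rewrite (HintD _ (nice_mono c Aa) nw); congr (_ + _).
rewrite /Hint; under eq_fun do rewrite mulrC.
by rewrite int01Z; [rewrite mulrC|exact: continuous_line].
Qed.

Lemma inA_keepU c : inA (fun y => keepU y c).
Proof. by case: c => [[j|[la k]]|k] /=; [exact: inA_cst|exact: inA_coord..]. Qed.

Lemma Hint0 : Hint (fun _ _ => 0) = fun=> 0.
Proof. by apply/funext => y; exact: int01_0. Qed.

Lemma inA_Hint w : nice w -> inA (Hint w).
Proof.
elim=> [|a c u Aa nu IH]; first by rewrite Hint0; exact: inA_cst.
rewrite (_ : Hint _ = fun y => int_pencil keepX keepU a y * keepU y c + Hint u y); last first.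
  by apply/funext => y; exact: Hint_cons.
apply: inA_add => //; apply: inA_mul; last exact: inA_keepU.
by case: (inA_int_pencil Aa linmap_keepX linmap_keepU).
Qed.

Lemma Dt_int_scaleU i a y : inA a ->
  Dt i (int_pencil keepX keepU a) y = int_pencil keepX keepU (Dt i a) y.
Proof.
move=> Aa; rewrite DtE.
have [_ ->] := inA_int_pencil Aa linmap_keepX linmap_keepU.
by rewrite /int_pencil; congr int01; apply/funext => t; rewrite DtE -Vf_scaleU.
Qed.

(** Checked on one term a(y) v_c: its integral is the radial mean of [a] times [keepU y c]. D_i
    passes through the mean by [Vf_scaleU], and acts on the second factor as the shift by
    [Ash_keepU]. *)
Lemma Hint_totT i w y : nice w -> Hint (totT i w) y = Dt i (Hint w) y.
Proof.
elim=> [|a c u Aa nu IH].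
  rewrite Hint0 Dt0 (_ : totT i _ = fun _ _ => 0) ?Hint0//.
  by apply/funext => z; apply/funext => v; rewrite /totT Dt0 addr0.
have [Aint _] := inA_int_pencil Aa linmap_keepX linmap_keepU.
rewrite (_ : Hint (fun y v => a y * v c + u y v) = fun y => int_pencil keepX keepU a y * keepU y c + Hint u y); last first.
  by apply/funext => z; exact: Hint_cons.
rewrite DtD; [|by apply: inA_mul => //; exact: inA_keepU|exact: inA_Hint].
rewrite -IH DtE dvM//; last exact: inA_keepU.
rewrite -(DtE i (int_pencil keepX keepU a)) Dt_int_scaleU//.
have -> : dv (fun y => keepU y c) y (Vf i y) = keepU (Vf i y) c.
  by case: (c) => [[j|[la k]]|k] /=; [exact: dv_cst|exact: dv_coord..].
have nT := nice_totT i nu.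
have na : nice (fun y v => a y * Ash i v c).
  apply: (nice_subst (nice_mono c Aa)); exact: linmap_Ash.
rewrite (_ : totT i _ = fun y v => Dt i a y * v c + (a y * Ash i v c + totT i u y v)); last first.
  apply/funext => z; apply/funext => v; rewrite /totT DtD.
  - rewrite (_ : (fun y => a y * v c) = fun y => v c * a y) ?DtZ//; first ring.
    by apply/funext => ?; rewrite mulrC.
  - by apply: inA_mul => //; exact: inA_cst.
  - exact: nice_inA.
rewrite Hint_cons//; [|exact: inA_Dt|exact: nice_add].
rewrite HintD// -Ash_keepU.
have -> : Hint (fun y v => a y * Ash i v c) y = int_pencil keepX keepU a y * Ash i (keepU y) c.
  rewrite /Hint; under eq_fun do rewrite mulrC.
  by rewrite int01Z; [rewrite mulrC|exact: continuous_line].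
ring.
Qed.

Lemma Hint_dv f y : inA f -> Hint (dv f) y = f y - f (keepX y).
Proof. by move=> Af; rewrite /Hint int01_dv// -/(scaleU y 1) scaleU1. Qed.

Lemma Hint_keepX w y : nice w -> Hint w (keepX y) = 0.
Proof.
move=> nw; rewrite /Hint (_ : keepU (keepX y) = fun=> 0).
  by under eq_fun do rewrite nice_zero//; exact: int01_0.
by apply/funext; case=> [[j|[la k]]|k].
Qed.

End VerticalForms.

(** * The subspace of the continuity equation and inverse shifts on its tangent vectors *)

Section ContinuitySubspace.
Local Open Scope classical_set_scope.
Variables (R : realType) (m : nat).
Local Notation Pt := (Defs.Pt R m).
Local Notation Fun := (Defs.Fun R m).
Local Notation Coord := (Defs.Coord m).
Implicit Types (f g : Fun) (y v : Pt) (c : Coord) (i j : 'I_m) (n : mi m).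

Definition onS y := forall n, CE n y = 0.
(** The vertical tangent vectors: the equations of [onS] are linear, so they also describe its
    tangent directions. *)
Definition tanS v := onS v /\ forall i, v (cX i) = 0.

Lemma CE_line n y v t : CE n (line y v t) = CE n y + t * CE n v.
Proof. by rewrite /CE mulr_sumr -big_split. Qed.

Lemma onS_line y v t : onS y -> tanS v -> onS (line y v t).
Proof. by move=> Sy [Sv _] n; rewrite CE_line Sy Sv mulr0 addr0. Qed.

Lemma CE_Vf n i y : CE n (Vf i y) = CE (incr n i) y.
Proof. by apply: eq_bigr => j _ /=; rewrite incr_comm. Qed.

Lemma onS_lineVf i y t : onS y -> onS (line y (Vf i y) t).
Proof. by move=> Sy n; rewrite CE_line CE_Vf !Sy mulr0 addr0. Qed.

Lemma onS_keepX y : onS (keepX y).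
Proof. by move=> n; rewrite /CE big1. Qed.

Lemma tanS_keepU y : onS y -> tanS (keepU y).
Proof. by move=> Sy; split => // n; have := Sy n. Qed.

Lemma onS_scaleU y t : onS y -> onS (scaleU y t).
Proof. by move=> Sy; apply: onS_line; [exact: onS_keepX|exact: tanS_keepU]. Qed.

Lemma tanS_Ash i v : tanS v -> tanS (Ash i v).
Proof.
move=> [Sv _]; split => // n; rewrite -[RHS](Sv (incr n i)).
by apply: eq_bigr => j _ /=; rewrite incr_comm.
Qed.

Definition eqS f g := forall y, onS y -> f y = g y.

Lemma Dt_eqS i f g : eqS f g -> eqS (Dt i f) (Dt i g).
Proof.
move=> fg y Sy; rewrite !DtE /dv; congr (derive1 _ _); apply/funext => t.
exact/fg/onS_lineVf.
Qed.

Lemma dv_eqS f g y v : eqS f g -> onS y -> tanS v -> dv f y v = dv g y v.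
Proof.
move=> fg Sy Sv; rewrite /dv; congr (derive1 _ _); apply/funext => t.
exact/fg/onS_line.
Qed.

Lemma Hint_eqS w w' : (forall y v, onS y -> tanS v -> w y v = w' y v) -> eqS (Hint w) (Hint w').
Proof.
move=> ww y Sy; rewrite /Hint; congr int01; apply/funext => t.
by apply: ww; [exact: onS_scaleU|exact: tanS_keepU].
Qed.

Definition decr n i : mi m := [ffun j => (n j - (j == i))%N].

Lemma incrK n i : decr (incr n i) i = n.
Proof. by apply/ffunP => j; rewrite !ffunE addnK. Qed.

Lemma decrK n i : (0 < n i)%N -> incr (decr n i) i = n.
Proof.
move=> ni; apply/ffunP => j; rewrite !ffunE.
by case: eqP => [->|_]; rewrite ?subn0 ?addn0// subnK.
Qed.

Lemma decr_incr n i j : i != j -> decr (incr n i) j = incr (decr n j) i.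
Proof.
move=> ij; apply/ffunP => l; rewrite !ffunE.
by case: (eqVneq l i) => [->|_]; rewrite ?(negbTE ij) ?subn0 ?addn0.
Qed.

Lemma decr_comm n i j : decr (decr n i) j = decr (decr n j) i.
Proof. by apply/ffunP => l; rewrite !ffunE subnAC. Qed.

Lemma incr_ne n i j : j != i -> (incr n i) j = n j.
Proof. by move=> ij; rewrite ffunE (negbTE ij) addn0. Qed.

Lemma decr_ne n i j : j != i -> (decr n i) j = n j.
Proof. by move=> ij; rewrite ffunE (negbTE ij) subn0. Qed.

Lemma incr_eq n i : (incr n i) i = (n i).+1.
Proof. by rewrite ffunE eqxx addn1. Qed.

Lemma decr_eq n i : (decr n i) i = (n i).-1.
Proof. by rewrite ffunE eqxx subn1. Qed.

(* The direction [o] is singled out: on [onS] the coordinates u^o_n with n^o > 0 are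
   functions of the remaining ("free") ones. *)
Variable o : 'I_m.

Definition freec c := if c is inl (inr (la, n)) then ~~ ((la == o) && (0 < n o)%N) else true.

(** A linear projection onto [onS]. One substitution is enough, because the replacing coordinates
    u^b have b different from [o] and are free. *)
Definition sigma y : Pt := fun c => match c with
  | inl (inr (la, n)) => if (la == o) && (0 < n o)%N
      then - \sum_(b < m | b != o) y (cU b (incr (decr n o) b)) else y c
  | _ => y c end.

Lemma sigma_freec y c : freec c -> sigma y c = y c.
Proof. by case: c => [[j|[la n]]|n] //= /negbTE ->. Qed.

Lemma linmap_sigma : linmap sigma.
Proof.
case=> [[j|[la n]]|n] /=; [exact: finlin_coord| |exact: finlin_coord].
case: (_ && _); last exact: finlin_coord.
by apply: finlinN; apply: finlin_sum => b _; exact: finlin_coord.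
Qed.

Lemma onS_sigma y : onS (sigma y).
Proof.
move=> n; rewrite /CE (bigD1 o) //= eqxx incr_eq /= incrK.
rewrite [X in _ + X](eq_bigr (fun b => y (cU b (incr n b)))) ?addNr // => b bo.
by rewrite (negbTE bo).
Qed.

Lemma sigma_id y : onS y -> sigma y = y.
Proof.
move=> Sy; apply/funext; case=> [[j|[la n]]|n] //=.
case: ifP => // /andP[/eqP -> no]; have := Sy (decr n o).
by rewrite /CE (bigD1 o) //= decrK// => /eqP; rewrite addr_eq0 => /eqP ->.
Qed.

Lemma eq_sigma y z : (forall c, freec c -> y c = z c) -> sigma y = sigma z.
Proof.
move=> yz; apply/funext => c; case: (boolP (freec c)) => [fc|].
  by rewrite !sigma_freec// yz.
case: c => [[j|[la n]]|n] //=; rewrite negbK => -> .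
by congr (- _); apply: eq_bigr => b bo; apply: yz; rewrite /= (negbTE bo).
Qed.

(** The tool behind the shift identities below: between points of [onS] they need checking on free
    coordinates only. *)
Lemma onS_ext y z : onS y -> onS z -> (forall c, freec c -> y c = z c) -> y = z.
Proof. by move=> Sy Sz /eq_sigma; rewrite !sigma_id. Qed.

Definition low i v : Pt := fun c => match c with
  | inl (inl _) => 0
  | inl (inr (la, n)) => if n i == 0%N then 0 else v (cU la (decr n i))
  | inr n => if n i == 0%N then 0 else v (cP (decr n i)) end.

(** [low] alone may leave the tangent space; [sigma] keeps its free coordinates and recomputes the
    dependent ones. *)
Definition shB i v := sigma (low i v).

Lemma linmap_shB i : linmap (shB i).
Proof.
apply: linmap_comp; first exact: linmap_sigma.
case=> [[j|[la n]]|n] /=; first exact: finlin0.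
- by case: (_ == _); [exact: finlin0|exact: finlin_coord].
- by case: (_ == _); [exact: finlin0|exact: finlin_coord].
Qed.

Lemma shB_freec i v c : freec c -> shB i v c = low i v c.
Proof. exact: sigma_freec. Qed.

Lemma tanS_shB i v : tanS (shB i v).
Proof. by split => //; exact: onS_sigma. Qed.

Lemma tanS_iter_shB i v r : tanS v -> tanS (iter r (shB i) v).
Proof. by case: r => // r _; exact: tanS_shB. Qed.

(** Raising n^i with i != o leaves n^o alone, so on free coordinates only values of [low] are
    read. *)
Lemma Ash_shB i v : i != o -> tanS v -> Ash i (shB i v) = v.
Proof.
move=> io [Sv v0]; have oi : o != i by rewrite eq_sym.
apply: onS_ext => //; first by case: (tanS_Ash i (tanS_shB i v)).
case=> [[j|[la n]]|n] /= fc.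
- by rewrite -/(cX j) v0.
- by rewrite (incr_ne _ oi) (negbTE fc) incr_eq incrK.
- by rewrite incr_eq incrK.
Qed.

Definition pr v : Pt := fun c =>
  if c is inl (inr (la, n)) then if (la == o) && (n o == 0%N) then v c else 0 else 0.

Lemma tanS_pr v : tanS (pr v).
Proof.
split => // n; rewrite /CE big1 // => j _ /=.
by case: ifP => // /andP[/eqP ->]; rewrite incr_eq.
Qed.

Lemma linmap_pr : linmap pr.
Proof.
case=> [[j|[la n]]|n] /=; [exact: finlin0| |exact: finlin0].
by case: (_ && _); [exact: finlin_coord|exact: finlin0].
Qed.

Lemma pr_shB v : pr (shB o v) = fun=> 0.
Proof.
apply/funext; case=> [[j|[la n]]|n] //=.
by case: ifP => // /andP[/eqP -> /eqP no]; rewrite eqxx no.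
Qed.

(** For n^o = 0 the shift reads the dependent coordinate u^o_(n+(o)), minus the sum of the
    u^b_(n+(b)) with b != o; these are zero in [shB o v], as their o-th entry cannot be lowered.
    Exactly the components kept by [pr] are lost. *)
Lemma Ash_shB_o v : tanS v -> Ash o (shB o v) = fun c => v c - pr v c.
Proof.
move=> [Sv v0]; apply: onS_ext.
- by case: (tanS_Ash o (tanS_shB o v)).
- by move=> n; rewrite /CE sumrB; have := Sv n; rewrite /CE => ->; have [+ _] := tanS_pr v => /(_ n);
    rewrite /CE => ->; rewrite subr0.
case=> [[j|[la n]]|n] /= fc.
- by rewrite -/(cX j) v0 subr0.
- rewrite incr_eq /= incrK; case: (eqVneq la o) fc => [->|lo] /=.
    rewrite -eqn0Ngt => /eqP no; rewrite no eqxx subrr big1 ?oppr0// => b bo.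
    by rewrite incr_ne ?no// eq_sym.
  by rewrite subr0.
- by rewrite incr_eq incrK subr0.
Qed.

Lemma Ash_shB_ne i k v : i != o -> i != k -> tanS v -> Ash i (shB k v) = shB k (Ash i v).
Proof.
move=> io ik [Sv v0].
have oi : o != i by rewrite eq_sym.
have ki : k != i by rewrite eq_sym.
apply: onS_ext.
- by case: (tanS_Ash i (tanS_shB k v)).
- by case: (tanS_shB k (Ash i v)).
case=> [[j|[la n]]|n] //= fc.
- by rewrite (incr_ne _ oi) (negbTE fc) (incr_ne _ ki) decr_incr.
- by rewrite (incr_ne _ ki) decr_incr.
Qed.

Lemma Ash_iter_shB_ne i k r v : i != o -> i != k -> tanS v ->
  Ash i (iter r (shB k) v) = iter r (shB k) (Ash i v).
Proof.
move=> io ik Sv; elim: r => //= r IH.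
by rewrite Ash_shB_ne// ?IH//; exact: tanS_iter_shB.
Qed.

Lemma freec_decr la n i : freec (cU la n) -> freec (cU la (decr n i)).
Proof.
rewrite /freec /=; case: (la == o) => //=; rewrite -!leqNgt !leqn0 => /eqP no.
by rewrite ffunE no.
Qed.

Lemma shB_comm i k v : shB i (shB k v) = shB k (shB i v).
Proof.
have [->//|ik] := eqVneq i k.
have ki : k != i by rewrite eq_sym.
apply: eq_sigma; case=> [[j|[la n]]|n] // fc.
- rewrite /low; case: (eqVneq (n i) 0%N) => [ni|ni]; case: (eqVneq (n k) 0%N) => [nk|nk] //.
  + by rewrite shB_freec ?freec_decr//= (decr_ne _ ik) ni eqxx.
  + by rewrite shB_freec ?freec_decr//= (decr_ne _ ki) nk eqxx.
  + rewrite !shB_freec ?freec_decr//= (decr_ne _ ik) (decr_ne _ ki) (negbTE ni) (negbTE nk).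
    by rewrite decr_comm.
- rewrite /low; case: (eqVneq (n i) 0%N) => [ni|ni]; case: (eqVneq (n k) 0%N) => [nk|nk] //.
  + by rewrite /= (decr_ne _ ik) ni eqxx.
  + by rewrite /= (decr_ne _ ki) nk eqxx.
  + by rewrite /= (decr_ne _ ik) (decr_ne _ ki) (negbTE ni) (negbTE nk) decr_comm.
Qed.

Definition idx c i : nat := match c with
  | inl (inl _) => 0%N | inl (inr (_, n)) => n i | inr n => n i end.

Lemma iter_shB_freec K i v c : freec c -> (idx c i < K)%N -> iter K (shB i) v c = 0.
Proof.
elim: K c => // K IH c fc cK; rewrite iterS shB_freec//.
case: c fc cK => [[j|[la n]]|n] //= fc cK; case: eqVneq => // ni; apply: IH.
- exact: freec_decr.
- by rewrite /= decr_eq; lia.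
- by [].
- by rewrite /= decr_eq; lia.
Qed.

(** A dependent u^o_n is expressed by the u^b_(n-(o)+(b)), whose i-th entry can exceed n^i by one;
    hence a bound one larger than for free coordinates. *)
Lemma iter_shB_vanish K i v c : ((idx c i).+1 < K)%N -> iter K (shB i) v c = 0.
Proof.
move=> cK; case: (boolP (freec c)) => [fc|].
  by apply: iter_shB_freec => //; exact: ltnW.
case: K cK => // K; case: c => [[j|[la n]]|n] //= cK; rewrite negbK => la0; rewrite la0.
rewrite big1 ?oppr0// => b bo.
have := @iter_shB_freec K.+1 i v (cU b (incr (decr n o) b)).
rewrite iterS shB_freec /= ?(negbTE bo)//; apply => //.
by rewrite !ffunE; case: (i == o); case: (i == b); lia.
Qed.

(** Local finiteness of the geometric series: only finitely many coordinates of the vector are read,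
    so one truncation order serves all directions, base points and vectors. *)
Lemma nice_vanish (w : Pt -> Pt -> R) : nice w ->
  exists K0, forall K, (K0 <= K)%N -> forall i y v, w y (iter K (shB i) v) = 0.
Proof.
elim=> [|a c u _ _ [K0 IH]]; first by exists 0%N.
exists (maxn K0 (\max_i idx c i).+2) => K; rewrite geq_max => /andP[K0K cK] i y v.
rewrite IH// iter_shB_vanish ?mulr0 ?addr0//.
by apply: leq_trans cK; rewrite !ltnS; exact: (leq_bigmax i).
Qed.

Definition Dn k r f : Fun := iter r (Dt k) f.

Lemma inA_Dn k r f : inA f -> inA (Dn k r f).
Proof. by move=> Af; elim: r => //= r IH; exact: inA_Dt. Qed.

Lemma Dn_add k r f g : inA f -> inA g ->
  Dn k r (fun y => f y + g y) = fun y => Dn k r f y + Dn k r g y.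
Proof.
move=> Af Ag; elim: r => //= r IH; rewrite /Dn /= -/(Dn _ _ _) IH.
by apply/funext => y; rewrite DtD//; exact: inA_Dn.
Qed.

Lemma Dn_scale k r a f : inA f -> Dn k r (fun y => a * f y) = fun y => a * Dn k r f y.
Proof.
move=> Af; elim: r => //= r IH; rewrite /Dn /= -/(Dn _ _ _) IH.
by apply/funext => y; rewrite DtZ//; exact: inA_Dn.
Qed.

Lemma Dn0 k r : Dn k r (fun=> 0) = fun=> 0.
Proof.
by elim: r => //= r IH; rewrite /Dn /= -/(Dn _ _ _) IH; apply/funext => y; rewrite Dt0.
Qed.

Lemma Dn_Dt k r i f : inA f -> Dn k r (Dt i f) = Dt i (Dn k r f).
Proof.
move=> Af; elim: r => //= r IH; rewrite /Dn /= -!/(Dn _ _ _) IH.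
by apply/funext => y; rewrite Dt_comm//; exact: inA_Dn.
Qed.

Lemma DnSr k r f : Dn k r (Dt k f) = Dn k r.+1 f.
Proof. by rewrite /Dn iterSr. Qed.

Lemma Dn_eqS k r f g : eqS f g -> eqS (Dn k r f) (Dn k r g).
Proof. by move=> fg; elim: r => //= r IH; exact: Dt_eqS. Qed.

Lemma nice_Dn k r w : nice w -> nice (fun y v => Dn k r (w^~ v) y).
Proof. by move=> nw; elim: r => //= r IH; exact: (nice_Dt k IH). Qed.

(* The geometric series for the inverse of totT k, truncated after K terms. *)
Definition Lam k K (w : Pt -> Pt -> R) : Pt -> Pt -> R :=
  fun y v => \sum_(r < K) (-1) ^+ r * Dn k r (w^~ (iter r.+1 (shB k) v)) y.

Lemma nice_Lam k K w : nice w -> nice (Lam k K w).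
Proof.
move=> nw; apply: nice_sum => r _; apply: nice_scale.
apply: (nice_subst (nice_Dn k r nw)); exact/linmap_iter/linmap_shB.
Qed.

Lemma Lam_totT_ne i k K w y v : nice w -> i != o -> i != k -> tanS v ->
  Lam k K (totT i w) y v = totT i (Lam k K w) y v.
Proof.
move=> nw io ik Sv; rewrite /totT /Lam Dt_sum => [|r _]; last first.
  by apply: inA_scale; apply: inA_Dn; exact: nice_inA.
rewrite -big_split; apply: eq_bigr => r _ /=.
rewrite DtZ; last by apply: inA_Dn; exact: nice_inA.
rewrite Dn_add; [|by apply: inA_Dt; exact: nice_inA|exact: nice_inA].
rewrite Dn_Dt; last exact: nice_inA.
rewrite -/(iter r.+1 _ _) -/(iter r.+1 _ (Ash i v)) Ash_iter_shB_ne//; ring.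
Qed.

(** The initial value [b] is separate from [a 0] because of the direction [o], where the zeroth term
    is w at v - pr v instead of v. *)
Lemma telescope_sign (a : nat -> R) (b : R) K :
  \sum_(r < K.+1) (-1) ^+ r * (a r.+1 + (if r == 0%N :> nat then b else a r)) =
  b - (-1) ^+ K.+1 * a K.+1.
Proof.
elim: K => [|K IH]; first by rewrite big_ord1 /=; ring.
by rewrite big_ord_recr IH /= !exprS; ring.
Qed.

Lemma Lam_totT_eq k K w y v u0 : nice w -> Ash k (shB k v) = u0 ->
  (forall r, Ash k (iter r.+2 (shB k) v) = iter r.+1 (shB k) v) ->
  Lam k K.+1 (totT k w) y v =
    w y u0 - (-1) ^+ K.+1 * Dn k K.+1 (w^~ (iter K.+1 (shB k) v)) y.
Proof.
move=> nw E0 E1; rewrite -(telescope_sign (fun r => Dn k r (w^~ (iter r (shB k) v)) y)).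
rewrite /Lam; apply: eq_bigr => -[r rK] _ /=; congr (_ * _).
rewrite /totT Dn_add; [|by apply: inA_Dt; exact: nice_inA|exact: nice_inA].
rewrite DnSr; congr (_ + _); case: r {rK} => [|r] /=; first by rewrite E0.
by rewrite -/(iter r.+2 (shB k) v) E1.
Qed.

Lemma Lam_totT k K w y v : nice w -> k != o -> tanS v ->
  (forall y v, w y (iter K.+1 (shB k) v) = 0) -> Lam k K.+1 (totT k w) y v = w y v.
Proof.
move=> nw ko Sv van; rewrite (Lam_totT_eq _ _ nw (Ash_shB ko Sv)) => [|r].
  by under eq_fun do rewrite van; rewrite Dn0 mulr0 subr0.
by rewrite [iter r.+2 _ _]/= Ash_shB//; exact: tanS_shB.
Qed.

Lemma Lam_totT_o K w y v : nice w -> tanS v ->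
  (forall y v, w y (iter K.+1 (shB o) v) = 0) ->
  Lam o K.+1 (totT o w) y v = w y v - w y (pr v).
Proof.
move=> nw Sv van; rewrite (Lam_totT_eq _ _ nw (Ash_shB_o Sv)) => [|r].
  rewrite (_ : w^~ _ = fun=> 0); last by apply/funext => z; exact: van.
  by rewrite Dn0 mulr0 subr0 nice_vsub.
rewrite [iter r.+2 _ _]/= Ash_shB_o; last exact: tanS_shB.
by rewrite pr_shB; apply/funext => c; rewrite subr0.
Qed.

Definition Gop k K f := Hint (Lam k K (dv f)).

Lemma inA_Gop k K f : inA f -> inA (Gop k K f).
Proof. by move=> Af; apply: inA_Hint; apply: nice_Lam; exact: dv_nice. Qed.

Lemma Lam_eqS k K (w w' : Pt -> Pt -> R) :
  (forall y v, onS y -> tanS v -> w y v = w' y v) ->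
  forall y v, onS y -> tanS v -> Lam k K w y v = Lam k K w' y v.
Proof.
move=> ww y v Sy Sv; apply: eq_bigr => r _; congr (_ * _).
apply: Dn_eqS => // z Sz; apply: ww => //; exact: (tanS_iter_shB k r.+1).
Qed.

Lemma Gop_eqS k K f g : eqS f g -> eqS (Gop k K f) (Gop k K g).
Proof.
by move=> fg; apply: Hint_eqS; apply: Lam_eqS => y v; exact: dv_eqS.
Qed.

Lemma dv_DtE i f : inA f -> dv (Dt i f) = totT i (dv f).
Proof. by move=> Af; apply/funext => y; apply/funext => v; exact: dv_Dt. Qed.

Lemma Gop_Dt_ne i k K f : inA f -> i != o -> i != k ->
  eqS (Gop k K (Dt i f)) (Dt i (Gop k K f)).
Proof.
move=> Af io ik y Sy; rewrite /Gop dv_DtE// -Hint_totT; last by apply: nice_Lam; exact: dv_nice.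
move: y Sy; apply: Hint_eqS => y v Sy Sv; apply: Lam_totT_ne => //; exact: dv_nice.
Qed.

Lemma Gop_Dt k K f : inA f -> k != o -> (forall y v, dv f y (iter K.+1 (shB k) v) = 0) ->
  eqS (Gop k K.+1 (Dt k f)) (fun y => f y - f (keepX y)).
Proof.
move=> Af ko van y Sy; rewrite /Gop dv_DtE// -Hint_dv//.
move: y Sy; apply: Hint_eqS => y v Sy Sv; apply: Lam_totT => //; exact: dv_nice.
Qed.

Lemma Gop_Dt_o K f : inA f -> (forall y v, dv f y (iter K.+1 (shB o) v) = 0) ->
  eqS (Gop o K.+1 (Dt o f)) (fun y => f y - f (keepX y) - Hint (fun y v => dv f y (pr v)) y).
Proof.
move=> Af van y Sy; rewrite /Gop dv_DtE// -Hint_dv// -HintB; [|exact: dv_nice|]; last first.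
  by apply: nice_subst; [exact: dv_nice|exact: linmap_pr].
move: y Sy; apply: Hint_eqS => y v Sy Sv; apply: Lam_totT_o => //; exact: dv_nice.
Qed.

Lemma LamD k K w w' y v : nice w -> nice w' ->
  Lam k K (fun y v => w y v + w' y v) y v = Lam k K w y v + Lam k K w' y v.
Proof.
move=> nw nw'; rewrite /Lam -big_split; apply: eq_bigr => r _.
by rewrite Dn_add ?mulrDr//; exact: nice_inA.
Qed.

Lemma LamZ k K a w y v : nice w ->
  Lam k K (fun y v => a * w y v) y v = a * Lam k K w y v.
Proof.
move=> nw; rewrite /Lam mulr_sumr; apply: eq_bigr => r _.
by rewrite Dn_scale 1?mulrCA//; exact: nice_inA.
Qed.

Lemma GopD k K f g y : inA f -> inA g -> Gop k K (fun y => f y + g y) y = Gop k K f y + Gop k K g y.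
Proof.
move=> Af Ag; have nf := dv_nice Af; have ng := dv_nice Ag.
rewrite /Gop -HintD; [|exact: nice_Lam..].
congr (Hint _ y); apply/funext => z; apply/funext => v; rewrite -LamD//.
by congr (Lam k K _ z v); apply/funext => z'; apply/funext => v'; rewrite dvD.
Qed.

Lemma GopZ k K a f y : inA f -> Gop k K (fun y => a * f y) y = a * Gop k K f y.
Proof.
move=> Af; have nf := dv_nice Af.
rewrite /Gop -HintZ; last exact: nice_Lam.
congr (Hint _ y); apply/funext => z; apply/funext => v; rewrite -LamZ//.
by congr (Lam k K _ z v); apply/funext => z'; apply/funext => v'; rewrite dvZ.
Qed.

Lemma Gop_keepX k K f y : inA f -> Gop k K f (keepX y) = 0.
Proof. by move=> Af; apply: Hint_keepX; apply: nice_Lam; exact: dv_nice. Qed.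

(* Hadamard's lemma along the segment from sigma y to y, whose direction has
   the functions CE_n as its only non-zero coordinates. *)
Lemma inI_onS f : inA f -> inI f <-> eqS f (fun=> 0).
Proof.
move=> Af; split.
  move=> [n [a [ix [_ E]]]] y Sy; rewrite E big1// => k _; by rewrite Sy mulr0.
move=> fS; pose Mr y : Pt := fun c => y c - sigma y c.
have lMr : linmap Mr.
  move=> c; apply: finlinD; first exact: finlin_coord.
  by apply: finlinN; exact: linmap_sigma.
have Er y : f y = int01 (fun t => dv f (line (sigma y) (Mr y) t) (Mr y)).
  rewrite int01_dv// (fS _ (onS_sigma y)) subr0; congr f.
  by apply/funext => c; rewrite /line /Mr mul1r addrC subrK.
suff [n [a [ix [Aa E]]]] : exists (n : nat) (a : 'I_n -> Fun) (ix : 'I_n -> mi m),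
    (forall k, inA (a k)) /\ forall y,
    int01 (fun t => dv f (line (sigma y) (Mr y) t) (Mr y)) = \sum_k a k y * CE (ix k) y.
  by exists n, a, ix; split => // y; rewrite Er E.
elim: (dv_nice Af) => [|a c w Aa nw [n [b [ix [Ab E]]]]].
  by exists 0%N, (fun=> fun=> 0), (fun=> mi0 m); split => [[]//|y]; rewrite big_ord0 int01_0.
have [Ai _] := inA_int_pencil Aa linmap_sigma lMr.
have Es y : int01 (fun t => a (line (sigma y) (Mr y) t) * Mr y c +
        w (line (sigma y) (Mr y) t) (Mr y)) =
      int_pencil sigma Mr a y * Mr y c + \sum_k b k y * CE (ix k) y.
  have c1 : continuous (fun t => Mr y c * a (line (sigma y) (Mr y) t)).
    by apply: (@continuous_line _ _ (fun z => Mr y c * a z)); exact: inA_scale.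
  have c2 : continuous (fun t => w (line (sigma y) (Mr y) t) (Mr y)).
    by apply: (@continuous_line _ _ (w^~ (Mr y))); exact: nice_inA.
  rewrite -E mulrC -int01Z; last exact: continuous_line.
  by rewrite -int01D//; congr int01; apply/funext => t; rewrite mulrC.
case: (boolP (freec c)) => fc.
  exists n, b, ix; split => // y; rewrite Es /Mr sigma_freec// subrr mulr0 add0r//.
case: c Es fc => [[j|[la q]]|q] //= Es; rewrite negbK => /andP[/eqP lao qo].
exists n.+1, (fun k => if unlift ord0 k is Some k' then b k' else int_pencil sigma Mr a),
  (fun k => if unlift ord0 k is Some k' then ix k' else decr q o); split.
  by move=> k; case: unlift.
move=> y; rewrite big_ord_recl unlift_none Es; congr (_ * _ + _).
  rewrite /Mr /= lao eqxx qo /= opprK /CE [RHS](bigD1 o)//=.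
  by rewrite decrK.
by apply: eq_bigr => k _; rewrite liftK.
Qed.

End ContinuitySubspace.

(** * Antiderivatives of functions of x alone *)

Section Antiderivative.
Variables (R : realType) (m : nat).
Local Notation Pt := (Defs.Pt R m).
Local Notation Fun := (Defs.Fun R m).
Local Notation Coord := (Defs.Coord m).
Implicit Types (f g : Fun) (y v : Pt) (c : Coord) (i j k : 'I_m).

Definition zeroX k y : Pt := fun c =>
  if c is inl (inl j) then if j == k then 0 else y c else 0.
Definition onlyX k y : Pt := fun c =>
  if c is inl (inl j) then if j == k then y c else 0 else 0.
Definition unitX k : Pt := fun c => if c is inl (inl j) then (j == k)%:R else 0.

Lemma linmap_zeroX k : linmap (zeroX k).
Proof.
case=> [[j|[la n]]|n] /=; [|exact: finlin0..].
by case: (_ == _); [exact: finlin0|exact: finlin_coord].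
Qed.

Lemma linmap_onlyX k : linmap (onlyX k).
Proof.
case=> [[j|[la n]]|n] /=; [|exact: finlin0..].
by case: (_ == _); [exact: finlin_coord|exact: finlin0].
Qed.

Lemma onS_zeroX k y : onS (zeroX k y).
Proof. by move=> n; rewrite /CE big1. Qed.

Definition segX k y t := line (zeroX k y) (onlyX k y) t.

Lemma segX1 k y : segX k y 1 = keepX y.
Proof.
apply/funext; case=> [[j|[la n]]|n]; rewrite /segX /line /= mul1r ?addr0//.
by case: eqP; rewrite ?add0r ?addr0.
Qed.

Lemma Vf_segX i k y t : Vf i (segX k y t) = unitX i.
Proof.
by apply/funext; case=> [[j|[la n]]|n] //=; rewrite /segX /line /= mulr0 addr0.
Qed.

Lemma onlyX_unit k y : onlyX k y = fun c => y (cX k) * unitX k c.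
Proof.
apply/funext; case=> [[j|[la n]]|n] /=; rewrite ?mulr0//.
by case: eqP => [->|]; rewrite ?mulr1 ?mulr0.
Qed.

(** The integral of f(x, 0) over the k-th variable from 0 to x^k, brought to the unit interval by
    the substitution s = t x^k; hence the factor x^k. *)
Definition Qx k f : Fun := fun y => y (cX k) * int_pencil (zeroX k) (onlyX k) f y.

Lemma inA_Qx k f : inA f -> inA (Qx k f).
Proof.
move=> Af; apply: inA_mul; first exact: inA_coord.
by case: (inA_int_pencil Af (linmap_zeroX k) (linmap_onlyX k)).
Qed.

Lemma Qx_Dt_ne i k f y : inA f -> i != k -> Qx k (Dt i f) y = Dt i (Qx k f) y.
Proof.
move=> Af ik.
have [Ai Di] := inA_int_pencil Af (linmap_zeroX k) (linmap_onlyX k).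
have ki : (k == i) = false by apply/negbTE; rewrite eq_sym.
rewrite [RHS]DtE dvM//; last exact: inA_coord.
have -> : dv (fun y => y (cX k)) y (Vf i y) = 0 by rewrite dv_coord /= ki.
have E t : Dt i f (line (zeroX k y) (onlyX k y) t) =
    dv f (line (zeroX k y) (onlyX k y) t) (line (zeroX k (Vf i y)) (onlyX k (Vf i y)) t).
  rewrite DtE Vf_segX; congr dv; apply/funext.
  case=> [[j|[la n]]|n]; rewrite /line /= ?mulr0 ?addr0//.
  by case: (eqVneq j k) => [->|_]; rewrite ?ki ?mulr0 ?addr0.
by rewrite mulr0 addr0 Di /Qx /int_pencil; under eq_fun do rewrite E.
Qed.

Lemma Qx_Dt k f y : inA f -> Qx k (Dt k f) y = f (keepX y) - f (zeroX k y).
Proof.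
move=> Af; rewrite -(segX1 k) -(int01_dv _ _ Af) /Qx /int_pencil -int01Z; last first.
  by apply: continuous_line; exact: inA_Dt.
congr int01; apply/funext => t; rewrite DtE Vf_segX [X in _ = dv _ _ X]onlyX_unit.
by rewrite (nice_vscale _ _ _ (dv_nice Af)).
Qed.

(** The two terms of the product rule are together the t-derivative of t f(segX k y t), integrated
    from 0 to 1. *)
Lemma Dt_Qx k f y : inA f -> Dt k (Qx k f) y = f (keepX y).
Proof.
move=> Af.
have [Ai Di] := inA_int_pencil Af (linmap_zeroX k) (linmap_onlyX k).
rewrite DtE dvM//; last exact: inA_coord.
rewrite dv_coord /= eqxx mulr1 Di.
have E t : line (zeroX k (Vf k y)) (onlyX k (Vf k y)) t = fun c => t * unitX k c.
  apply/funext; case=> [[j|[la n]]|n]; rewrite /line /= ?mulr0 ?addr0//.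
  by case: eqP; rewrite ?mulr0 ?addr0 ?add0r.
have nf := dv_nice Af.
have cF := @continuous_line R m f (zeroX k y) (onlyX k y) Af.
have cD : continuous (fun t : R => dv f (segX k y t) (unitX k)).
  by apply: (@continuous_line _ _ (fun z => dv f z (unitX k))); exact: nice_inA.
have cD' : continuous (fun t : R => t * dv f (segX k y t) (unitX k)).
  by move=> t; apply: cvgM; [exact: cvg_id|exact: cD].
rewrite /int_pencil -/(segX k y).
rewrite (_ : (fun t => dv f _ _) = fun t => t * dv f (segX k y t) (unitX k)); last first.
  by apply/funext => t; rewrite E (nice_vscale _ _ _ nf).
rewrite -int01Z// -int01D//; last first.
  by move=> t; apply: cvgM; [exact: cvg_cst|exact: cD'].
have dF (t : R) : is_derive t 1 (fun t => t * f (segX k y t))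
    (f (segX k y t) + y (cX k) * (t * dv f (segX k y t) (unitX k))).
  have D := is_deriveM (is_derive_id t 1) (is_derive_inA (zeroX k y) (onlyX k y) t Af).
  suff <- : t *: dv f (segX k y t) (onlyX k y) + f (segX k y t) *: 1 =
    f (segX k y t) + y (cX k) * (t * dv f (segX k y t) (unitX k)) by exact: D.
  rewrite onlyX_unit (nice_vscale _ _ _ nf) [_ *: 1]mulr1 addrC; congr (_ + _).
  exact: mulrCA.
under eq_fun do rewrite addrC.
have -> := @int01_FTC R _ _ _ dF; first by rewrite mul1r mul0r subr0 segX1.
move=> t; apply: cvgD; first exact: cF.
by apply: cvgM; [exact: cvg_cst|exact: cD'].
Qed.

Lemma QxD k f g y : inA f -> inA g -> Qx k (fun y => f y + g y) y = Qx k f y + Qx k g y.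
Proof.
move=> Af Ag; rewrite /Qx -mulrDr; congr (_ * _).
exact: (int01D (@continuous_line _ _ _ _ _ Af) (@continuous_line _ _ _ _ _ Ag)).
Qed.

Lemma QxZ k a f y : inA f -> Qx k (fun y => a * f y) y = a * Qx k f y.
Proof.
move=> Af; rewrite /Qx mulrCA; congr (_ * _).
exact: (int01Z a (@continuous_line _ _ _ _ _ Af)).
Qed.

Lemma Qx_eqS k f g : eqS f g -> eqS (Qx k f) (Qx k g).
Proof.
move=> fg y Sy; rewrite /Qx /int_pencil; congr (_ * int01 _); apply/funext => t.
by apply: fg => n; rewrite /CE big1// => j _; rewrite /line /= mulr0 addr0.
Qed.

End Antiderivative.

(** * The differential on forms *)

Section Koszul.
Variables (R : realType) (m : nat).
Local Notation Pt := (Defs.Pt R m).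
Local Notation Fun := (Defs.Fun R m).
Local Notation Form := (Defs.Form R m).
Implicit Types (f g : Fun) (y v : Pt) (i j k nu mu : 'I_m) (T N : {set 'I_m}) (t : Form).

Definition sg nu T : nat := #|[set j in T | (j < nu)%N]|.

Lemma sg_setU1 nu k T : k \notin T -> sg nu (k |: T) = (sg nu T + (k < nu))%N.
Proof.
move=> kT; rewrite /sg.
have -> : [set j in k |: T | (j < nu)%N] =
    if (k < nu)%N then k |: [set j in T | (j < nu)%N] else [set j in T | (j < nu)%N].
  apply/setP => j; rewrite !inE; case: ifP => kn; rewrite !inE; case: (eqVneq j k) => //= ->;
  by rewrite kn ?(negbTE kT).
by case: ifP => kn; rewrite ?addn0// cardsU1 !inE (negbTE kT) /= addnC.
Qed.

Lemma sg_setD1 nu k T : k \in T -> sg nu T = (sg nu (T :\ k) + (k < nu))%N.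
Proof. by move=> kT; rewrite -{1}(finset.setD1K kT) sg_setU1 // !inE eqxx. Qed.

Lemma dHE t T y : dH t T y = \sum_(nu in T) (-1) ^+ sg nu T * Dt nu (t (T :\ nu)) y.
Proof. by []. Qed.

Lemma signM_self n : (-1) ^+ n * (-1) ^+ n = 1 :> R.
Proof. by rewrite -exprD addnn -mul2n exprM sqrrN !expr1n. Qed.

Lemma dH_inA t T : (forall T, inA (t T)) -> inA (dH t T).
Proof.
move=> At; apply: inA_sum => nu _; apply: inA_scale; apply: inA_Dt; exact: At.
Qed.

Lemma dHB t t' T y : (forall T, inA (t T)) -> (forall T, inA (t' T)) ->
  dH (fun T y => t T y - t' T y) T y = dH t T y - dH t' T y.
Proof.
move=> At At'; rewrite !dHE -sumrB; apply: eq_bigr => nu _.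
by rewrite DtB// mulrBr.
Qed.

Lemma dHD t t' T y : (forall T, inA (t T)) -> (forall T, inA (t' T)) ->
  dH (fun T y => t T y + t' T y) T y = dH t T y + dH t' T y.
Proof.
move=> At At'; rewrite !dHE -big_split; apply: eq_bigr => nu _.
by rewrite DtD// mulrDr.
Qed.

Lemma dHZ a t T y : (forall T, inA (t T)) ->
  dH (fun T y => a * t T y) T y = a * dH t T y.
Proof.
move=> At; rewrite !dHE mulr_sumr; apply: eq_bigr => nu _.
by rewrite DtZ// mulrCA.
Qed.

(** Removing nu and mu in the other order changes one of the two positions by one, hence the sign;
    the double sum equals its own opposite. *)
Lemma dH_dH t T y : (forall T, inA (t T)) -> dH (dH t) T y = 0.
Proof.
move=> At.
pose a nu mu := (-1) ^+ sg nu T * (-1) ^+ sg mu (T :\ nu) *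
   Dt nu (Dt mu (t (T :\ nu :\ mu))) y.
have aC nu mu : nu \in T -> mu \in T -> nu != mu -> a nu mu = - a mu nu.
  move=> nT mT nm; rewrite /a Dt_comm//.
  have -> : T :\ nu :\ mu = T :\ mu :\ nu by apply/setP => j; rewrite !inE andbCA.
  rewrite [sg nu T](sg_setD1 nu mT) [sg mu T](sg_setD1 mu nT) !exprD.
  case: (ltngtP mu nu) nm => [||/val_inj ->]; rewrite ?eqxx//= ?expr0 ?expr1 => _ _; ring.
have -> : dH (dH t) T y = \sum_(nu in T) \sum_(mu in T | mu != nu) a nu mu.
  rewrite dHE; apply: eq_bigr => nu nT.
  rewrite Dt_sum => [|mu _]; last by apply: inA_scale; apply: inA_Dt.
  rewrite mulr_sumr; apply: eq_big => [mu|mu _]; first by rewrite !inE andbC.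
  by rewrite DtZ ?mulrA//; exact: inA_Dt.
set X := \sum_(nu in T) _.
have : X = - X.
  rewrite {2}/X (exchange_big_dep (mem T)) /=; last by move=> nu mu _ /andP[].
  rewrite /X -sumrN; apply: eq_bigr => nu nT; rewrite -sumrN.
  apply: eq_big => [mu|mu /andP[mT mn]]; first by rewrite nT eq_sym.
  by rewrite aC// eq_sym.
by move=> E; lra.
Qed.

(* Contraction with d/dx^k followed by the operator F. *)
Definition contract k (F : Fun -> Fun) t : Form := fun T =>
  if k \in T then fun=> 0 else fun y => (-1) ^+ sg k (k |: T) * F (t (k |: T)) y.

(** * Cartan's formula and exactness by successive contractions *)

Section Cartan.
Variables (N : {set 'I_m}) (k : 'I_m) (F : Fun -> Fun).
Hypotheses (kN : k \in N)
  (FA : forall f, inA f -> inA (F f))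
  (FD : forall f g y, inA f -> inA g -> F (fun y => f y + g y) y = F f y + F g y)
  (FZ : forall a f y, inA f -> F (fun y => a * f y) y = a * F f y)
  (FS : forall f g, eqS f g -> eqS (F f) (F g))
  (FC : forall i f, inA f -> i \in N -> i != k -> eqS (F (Dt i f)) (Dt i (F f))).

Lemma op_zero y : F (fun=> 0) y = 0.
Proof.
by have := @FZ 0 (fun=> 0) y (inA_cst _ _); rewrite !mul0r.
Qed.

Lemma op_sum (I : Type) (r : seq I) (P : pred I) (f : I -> Fun) y :
  (forall i : I, P i -> inA (f i)) ->
  F (fun y => \sum_(i <- r | P i) f i y) y = \sum_(i <- r | P i) F (f i) y.
Proof.
move=> Af; elim: r => [|i r IH].
  rewrite big_nil -[RHS](op_zero y); congr F; apply/funext => z; exact: big_nil.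
rewrite big_cons; case Pi: (P i); last first.
  by rewrite -IH; congr F; apply/funext => z; rewrite big_cons Pi.
rewrite -IH -FD; [|exact: Af|exact: inA_sum].
by congr F; apply/funext => z; rewrite big_cons Pi.
Qed.

Lemma contract_inA t T : (forall T, inA (t T)) -> inA (contract k F t T).
Proof.
move=> At; rewrite /contract; case: ifP => _; first exact: inA_cst.
by apply: inA_scale; exact: FA.
Qed.

(** If k is in T, only the term nu = k of [dH] survives the contraction. Otherwise the terms with nu
    in T cancel in pairs, since exactly one of k < nu and nu < k contributes a sign, and nu = k
    leaves F D_k. *)
Lemma cartan t T y : (forall T, inA (t T)) -> T \subset N -> onS y ->
  dH (contract k F t) T y + contract k F (dH t) T y =
  if k \in T then Dt k (F (t T)) y else F (Dt k (t T)) y.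
Proof.
move=> At TN Sy; rewrite {2}/contract; case: ifPn => kT.
  rewrite addr0 dHE (bigD1 k)//= [X in _ + X]big1 ?addr0 => [|nu /andP[nT nk]].
    rewrite {1}/contract !inE eqxx /= finset.setD1K// DtZ; last exact: FA.
    by rewrite mulrA signM_self mul1r.
  by rewrite {1}/contract !inE eq_sym nk kT Dt0 mulr0.
have kTk : (k |: T) :\ k = T.
  apply/setP => j; rewrite !inE; case: (eqVneq j k) => //= ->; by rewrite (negbTE kT).
rewrite [dH t]/dH -/(sg _ _).
have -> : F (fun y0 => \sum_(nu in k |: T) (-1) ^+ sg nu (k |: T) * Dt nu (t ((k |: T) :\ nu)) y0) y =
  \sum_(nu in k |: T) (-1) ^+ sg nu (k |: T) * F (Dt nu (t ((k |: T) :\ nu))) y.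
  rewrite op_sum => [|nu _]; last by apply: inA_scale; exact: inA_Dt.
  by apply: eq_bigr => nu _; rewrite FZ//; exact: inA_Dt.
rewrite (big_setU1 _ kT) /= kTk mulrDr mulrA signM_self mul1r addrCA -[RHS]addr0; congr (_ + _).
rewrite mulr_sumr dHE -big_split big1// => nu nT /=.
have nk : nu != k by apply: contraNneq kT => <-.
rewrite /contract !inE (negbTE kT) andbF DtZ; last exact: FA.
rewrite FC//; last exact: (fintype.subsetP TN).
have -> : (k |: T) :\ nu = k |: (T :\ nu).
  by apply/setP => j; rewrite !inE; case: (eqVneq j k) => //= ->; rewrite eq_sym nk.
have kTn : k \notin T :\ nu by rewrite !inE (negbTE kT) andbF.
rewrite !(sg_setU1 _ kT) (sg_setU1 _ kTn) ltnn !addn0 (sg_setD1 k nT) !exprD.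
case: (ltngtP nu k) nk => [||/val_inj ->]; rewrite ?eqxx//= ?expr0 ?expr1 => _ _; ring.
Qed.

(** One notion for both complexes: N is the whole index set for horizontal forms and the complement
    of [o] for Theta. *)
Definition closedOn q t := forall T, T \subset N -> #|T| = q.+1 -> eqS (dH t T) (fun=> 0).

(** The side on which F inverts D_k decides what disappears: components without k if F D_k = 1,
    components with k if D_k F = 1. *)
Lemma cartan_step q t : (forall T, inA (t T)) -> closedOn q t ->
  let t' := fun T y => t T y - dH (contract k F t) T y in
  [/\ forall T, inA (t' T), closedOn q t' &
   forall T y, T \subset N -> #|T| = q -> onS y -> t' T y =
     if k \in T then t T y - Dt k (F (t T)) y else t T y - F (Dt k (t T)) y].
Proof.
move=> At ct t'.
have Ai T : inA (contract k F t T) by exact: contract_inA.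
split=> [T|T TN Tq y Sy|T y TN Tq Sy].
- by apply: inA_sub => //; exact: dH_inA.
- by rewrite dHB// => [|T']; [rewrite dH_dH// subr0 ct|exact: dH_inA].
- rewrite /t'; have := cartan At TN Sy.
  have -> : contract k F (dH t) T y = 0.
    rewrite /contract; case: ifPn => // kT.
    rewrite (FS (ct (k |: T) _ _))// ?op_zero ?mulr0//.
      by rewrite finset.subUset finset.sub1set kN TN.
    by rewrite cardsU1 kT Tq.
  by rewrite addr0 => ->; case: ifP.
Qed.

End Cartan.

(** As D_k Qx_k = 1 on functions of x, each step removes the components with k. The others are only
    restricted to x^k = 0, so components removed earlier stay zero. *)
Lemma Qx_chain N q t (ks : seq 'I_m) : (forall k, k \in ks -> k \in N) ->
  (forall T, inA (t T)) -> closedOn N q t ->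
  (forall T y, T \subset N -> #|T| = q -> onS y -> t T (keepX y) = t T y) ->
  exists t' eta : Form, [/\ (forall T, inA (t' T)) /\ (forall T, inA (eta T)),
    closedOn N q t',
    (forall T y, T \subset N -> #|T| = q -> onS y -> t' T (keepX y) = t' T y),
    (forall T y, T \subset N -> #|T| = q -> onS y -> t T y = t' T y + dH eta T y) &
    (forall T k, T \subset N -> #|T| = q -> k \in ks -> k \in T -> eqS (t' T) (fun=> 0))].
Proof.
move=> + At ct xt; elim: ks => [|k ks IH] ksN.
  exists t, (fun _ _ => 0); split=> //.
  - by split => // T; exact: inA_cst.
  - move=> T y _ _ _; rewrite dHE big1 ?addr0// => nu _; by rewrite Dt0 mulr0.
have [|t1 [e1 [[At1 Ae1] ct1 xt1 E1 V1]]] := IH.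
  by move=> j jk; apply: ksN; rewrite inE jk orbT.
have kN : k \in N by apply: ksN; rewrite inE eqxx.
have [] := @cartan_step N k (Qx k) kN (@inA_Qx R m k) (@QxD R m k) (@QxZ R m k)
  (@Qx_eqS R m k) (fun i f Af _ ik y _ => Qx_Dt_ne y Af ik) q t1 At1 ct1.
set t2 := (fun _ _ => _) => At2 ct2 E2.
have Ai T : inA (contract k (Qx k) t1 T) by exact: contract_inA (@inA_Qx R m k) _ _ At1.
have E2' T y : T \subset N -> #|T| = q -> onS y ->
    t2 T y = if k \in T then 0 else t1 T (zeroX k y).
  move=> TN Tq Sy; rewrite [LHS](E2 T y TN Tq Sy); case: ifP => kT.
    by rewrite Dt_Qx// xt1// subrr.
  by rewrite Qx_Dt// xt1//; ring.
exists t2, (fun T y => e1 T y + contract k (Qx k) t1 T y); split=> //.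
- by split => // T; exact: inA_add.
- move=> T y TN Tq Sy; rewrite !E2'//; last exact: onS_keepX.
  case: ifP => // _; congr (t1 T _).
  by apply/funext; case=> [[j|[la n]]|n].
- move=> T y TN Tq Sy; rewrite E1// dHD// /t2; ring.
- move=> T j TN Tq; rewrite inE => /predU1P[->|jk] jT y Sy; rewrite E2'//.
    by rewrite jT.
  by case: ifP => // _; rewrite (V1 _ j)//; exact: onS_zeroX.
Qed.

(** As Gop_k D_k = 1 on functions vanishing at u = p = 0, each step removes the components without
    k. The others change by D_k Gop_k, which maps zero to zero, so earlier removals persist. *)
Lemma Gop_chain o N q t (ks : seq 'I_m) : N = [set~ o] -> (forall k, k \in ks -> k \in N) ->
  (forall T, inA (t T)) -> closedOn N q t ->
  (forall T y, T \subset N -> #|T| = q -> onS y -> t T (keepX y) = 0) ->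
  exists t' eta : Form, [/\ (forall T, inA (t' T)) /\ (forall T, inA (eta T)),
    closedOn N q t',
    (forall T y, T \subset N -> #|T| = q -> onS y -> t' T (keepX y) = 0),
    (forall T y, T \subset N -> #|T| = q -> onS y -> t T y = t' T y + dH eta T y) &
    (forall T k, T \subset N -> #|T| = q -> k \in ks -> k \notin T -> eqS (t' T) (fun=> 0))].
Proof.
move=> NE + At ct xt; elim: ks => [|k ks IH] ksN.
  exists t, (fun _ _ => 0); split=> //.
  - by split => // T; exact: inA_cst.
  - move=> T y _ _ _; rewrite dHE big1 ?addr0// => nu _; by rewrite Dt0 mulr0.
have [|t1 [e1 [[At1 Ae1] ct1 xt1 E1 V1]]] := IH.
  by move=> j jk; apply: ksN; rewrite inE jk orbT.
have kN : k \in N by apply: ksN; rewrite inE eqxx.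
have ko : k != o by move: kN; rewrite NE !inE.
(* The truncation order is chosen anew at each step, since [t1] may involve further coordinates, and
   serves its finitely many components at once. *)
have [K0 HK0] : exists K0, forall T K, (K0 <= K)%N -> forall i y v, dv (t1 T) y (iter K (shB o i) v) = 0.
  have /fin_all_exists [K0 HK] : forall T, exists K0, forall K, (K0 <= K)%N ->
      forall i y v, dv (t1 T) y (iter K (shB o i) v) = 0.
    by move=> T; apply: nice_vanish; exact: dv_nice.
  exists (\max_T K0 T) => T K KK; apply: HK; apply: leq_trans KK; exact: (leq_bigmax T).
pose F := @Gop R m o k K0.+1.
have FA f : inA f -> inA (F f) by exact: inA_Gop.
have FC i f : inA f -> i \in N -> i != k -> eqS (F (Dt i f)) (Dt i (F f)).
  by move=> Af iN ik; apply: Gop_Dt_ne => //; move: iN; rewrite NE !inE.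
have FS f g : eqS f g -> eqS (F f) (F g) by exact: Gop_eqS.
have FZ a f y : inA f -> F (fun y => a * f y) y = a * F f y by exact: GopZ.
have [] := @cartan_step N k F kN FA (fun f g y => @GopD R m o k K0.+1 f g y) FZ FS FC q t1 At1 ct1.
set t2 := (fun _ _ => _) => At2 ct2 E2.
have Ai T : inA (contract k F t1 T) by exact: contract_inA FA _ _ At1.
have E2' T y : T \subset N -> #|T| = q -> onS y ->
    t2 T y = if k \in T then t1 T y - Dt k (F (t1 T)) y else 0.
  move=> TN Tq Sy; rewrite [LHS](E2 T y TN Tq Sy); case: ifP => // kT.
  by rewrite /F Gop_Dt// ?xt1// ?subr0 ?subrr// => z v; exact: HK0.
exists t2, (fun T y => e1 T y + contract k F t1 T y); split=> //.
- by split => // T; exact: inA_add.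
- move=> T y TN Tq Sy; rewrite E2'//; last exact: onS_keepX.
  (* The line in direction D_k through a point with u = p = 0 stays among such points, where [Gop]
     vanishes. *)
  case: ifP => // _; rewrite xt1// sub0r DtE /dv.
  rewrite (_ : (fun s => _) = fun=> 0) ?derive1_cst ?oppr0//.
  apply/funext => s; rewrite (_ : line _ _ _ = keepX (line y (Vf k y) s)) /F ?Gop_keepX//.
  by apply/funext; case=> [[j|[la n]]|n]; rewrite /line //= mulr0 addr0.
- move=> T y TN Tq Sy; rewrite E1// dHD// /t2; ring.
- move=> T j TN Tq; rewrite inE => /predU1P[->|jk] jT y Sy; rewrite E2'//.
    by rewrite (negbTE jT).
  case: ifP => // _; rewrite (V1 _ j)// sub0r.
  rewrite (Dt_eqS k (FS _ _ (V1 T j TN Tq jk jT)))//.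
  by rewrite (_ : F _ = fun=> 0) ?Dt0 ?oppr0//; apply/funext => z; exact: op_zero FZ z.
Qed.

(** A nonempty T contains some k, and its component disappears at the step of that k. *)
Lemma xonly_exact N q t : (0 < q)%N -> (forall T, inA (t T)) -> closedOn N q t ->
  (forall T y, T \subset N -> #|T| = q -> onS y -> t T (keepX y) = t T y) ->
  exists2 eta : Form, (forall T, inA (eta T)) &
    forall T, T \subset N -> #|T| = q -> eqS (t T) (dH eta T).
Proof.
move=> q0 At ct xt.
have [|t' [eta [[At' Ae] _ _ E V]]] := @Qx_chain N q t (enum N) _ At ct xt.
  by move=> k; rewrite mem_enum.
exists eta => // T TN Tq y Sy; rewrite E//.
have /card_gt0P [k kT] : (0 < #|T|)%N by rewrite Tq.
by rewrite (V T k)// ?add0r// mem_enum (fintype.subsetP TN).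
Qed.

(** For q < m-1 every T misses some k != o, and its component disappears at the step of that k; in
    degree m-1 nothing is missed. *)
Lemma plus_exact o q t : (q < m.-1)%N -> (forall T, inA (t T)) -> closedOn [set~ o] q t ->
  (forall T y, T \subset [set~ o] -> #|T| = q -> onS y -> t T (keepX y) = 0) ->
  exists2 eta : Form, (forall T, inA (eta T)) &
    forall T, T \subset [set~ o] -> #|T| = q -> eqS (t T) (dH eta T).
Proof.
move=> qm At ct xt.
have [|t' [eta [[At' Ae] _ _ E V]]] := @Gop_chain o _ q t (enum [set~ o]) erefl _ At ct xt.
  by move=> k; rewrite mem_enum.
exists eta => // T TN Tq y Sy; rewrite E//.
have : T \proper [set~ o].
  by rewrite properEcard TN Tq cardsC1 card_ord.
case/properP => _ [k kN kT].
by rewrite (V T k)// ?add0r// mem_enum.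
Qed.

End Koszul.

(** * Euler operators: vanishing on divergences and its converse *)

Section EulerOperators.
Variables (R : realType) (m : nat) (o : 'I_m).
Local Notation Pt := (Defs.Pt R m).
Local Notation Fun := (Defs.Fun R m).
Local Notation Coord := (Defs.Coord m).
Local Notation B := (@shB R m o).
Local Notation pr := (@pr R m o).
Implicit Types (f g : Fun) (y v : Pt) (c : Coord) (i j k : 'I_m) (w : Pt -> Pt -> R).

Lemma finlin_vsub (phi : Pt -> R) v v' : finlin phi ->
  phi (fun c => v c - v' c) = phi v - phi v'.
Proof.
by move=> [n [cs [a E]]]; rewrite !E -sumrB; apply: eq_bigr => k _; rewrite mulrBr.
Qed.

Lemma linmap_vsub M v v' : linmap M ->
  M (fun c => v c - v' c) = fun c => M v c - M v' c.
Proof. by move=> lM; apply/funext => c; rewrite (finlin_vsub _ _ (lM c)). Qed.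

Lemma linmap_0 (M : Pt -> Pt) : linmap M -> M (fun=> 0) = fun=> 0.
Proof.
move=> lM; apply/funext => c; have [n [cs [a ->]]] := lM c.
by apply: big1 => k _; rewrite mulr0.
Qed.

Lemma tanS_sub v v' : tanS v -> tanS v' -> tanS (fun c => v c - v' c).
Proof.
move=> [Sv Xv] [Sv' Xv']; split => [n|i]; last by rewrite Xv Xv' subr0.
by have := Sv n; have := Sv' n; rewrite /CE sumrB => -> ->; rewrite subr0.
Qed.

Lemma iter_shB_shB j k q v : iter q (B j) (B k v) = B k (iter q (B j) v).
Proof. by elim: q => //= q ->; rewrite shB_comm. Qed.

Lemma iter_shB_comm j k q r v : iter r (B k) (iter q (B j) v) = iter q (B j) (iter r (B k) v).
Proof. by elim: r => //= r ->; rewrite iter_shB_shB. Qed.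

(* For K large this is the Euler operator of the single direction k. *)
Definition Qop k K w : Pt -> Pt -> R :=
  fun y v => \sum_(r < K) (-1) ^+ r * Dn k r (w^~ (iter r (B k) v)) y.

Lemma nice_Qop k K w : nice w -> nice (Qop k K w).
Proof.
move=> nw; apply: nice_sum => r _; apply: nice_scale.
apply: (nice_subst (nice_Dn k r nw)); exact/linmap_iter/linmap_shB.
Qed.

Lemma Qop_eqS k K w w' :
  (forall y v, onS y -> tanS v -> w y v = w' y v) ->
  forall y v, onS y -> tanS v -> Qop k K w y v = Qop k K w' y v.
Proof.
move=> ww y v Sy Sv; apply: eq_bigr => r _; congr (_ * _).
by apply: Dn_eqS => // z Sz; apply: ww => //; exact: tanS_iter_shB.
Qed.

Lemma QopD k K w w' y v : nice w -> nice w' ->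
  Qop k K (fun y v => w y v + w' y v) y v = Qop k K w y v + Qop k K w' y v.
Proof.
move=> nw nw'; rewrite /Qop -big_split; apply: eq_bigr => r _.
by rewrite Dn_add ?mulrDr//; exact: nice_inA.
Qed.

Lemma QopZ k K a w y v : nice w ->
  Qop k K (fun y v => a * w y v) y v = a * Qop k K w y v.
Proof.
move=> nw; rewrite /Qop mulr_sumr; apply: eq_bigr => r _.
by rewrite Dn_scale 1?mulrCA//; exact: nice_inA.
Qed.

Lemma Qop_Dt k K i w y v : nice w ->
  Qop k K (fun y v => Dt i (w^~ v) y) y v = Dt i (Qop k K w ^~ v) y.
Proof.
move=> nw; rewrite /Qop Dt_sum => [|r _]; last first.
  by apply: inA_scale; apply: inA_Dn; exact: nice_inA.
apply: eq_bigr => r _; rewrite DtZ; last by apply: inA_Dn; exact: nice_inA.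
by rewrite Dn_Dt//; exact: nice_inA.
Qed.

Lemma Qop_subst k K w (M : Pt -> Pt) y v :
  (forall u, tanS u -> M (B k u) = B k (M u)) -> tanS v ->
  Qop k K (fun y v => w y (M v)) y v = Qop k K w y (M v).
Proof.
move=> MB Sv; apply: eq_bigr => r _; congr (_ * _); congr (Dn k r _ y).
apply/funext => z; congr (w z _); elim: (r : nat) => //= q IH.
by rewrite MB ?IH//; exact: tanS_iter_shB.
Qed.

Lemma Qop_zero k K w y v : (forall z r, w z (iter r (B k) v) = 0) -> Qop k K w y v = 0.
Proof.
move=> wv; rewrite /Qop big1// => r _.
by under eq_fun do rewrite wv; rewrite Dn0 mulr0.
Qed.

Lemma Qop_totT_ne i k K w y v : nice w -> i != o -> i != k -> tanS v ->
  Qop k K (totT i w) y v = totT i (Qop k K w) y v.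
Proof.
move=> nw io ik Sv.
have nA : nice (fun y v => w y (Ash i v)) by apply: nice_subst => //; exact: linmap_Ash.
rewrite [LHS](QopD _ _ _ _ (nice_Dt i nw) nA) Qop_Dt// (Qop_subst _ _ _ _ Sv)//.
by move=> u Su; rewrite Ash_shB_ne.
Qed.

Lemma telescope_sign0 (a : nat -> R) K :
  \sum_(r < K) (-1) ^+ r * (a r.+1 + a r) = a 0%N - (-1) ^+ K * a K.
Proof.
elim: K => [|K IH]; first by rewrite big_ord0 expr0; ring.
by rewrite big_ord_recr IH /= exprS; ring.
Qed.

(** The sum telescopes: at the lower end remains w at [Ash k v], zero by assumption, at the upper
    end a term of order K, zero by truncation. *)
Lemma Qop_totT k K w y v : nice w -> k != o -> tanS v -> Ash k v = (fun=> 0) ->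
  (forall y, w y (iter K (B k) v) = 0) -> Qop k K.+1 (totT k w) y v = 0.
Proof.
move=> nw ko Sv Akv van; pose b r := Dn k r.+1 (w^~ (iter r (B k) v)) y.
have E r : Dn k r ((totT k w)^~ (iter r (B k) v)) y = b r + (if r is q.+1 then b q else 0).
  rewrite /totT Dn_add; [|by apply: inA_Dt; exact: nice_inA|exact: nice_inA].
  rewrite DnSr; congr (_ + _); case: r => [|r] /=.
    by rewrite Akv nice_zero.
  by rewrite Ash_shB//; exact: tanS_iter_shB.
have bK : b K = 0.
  by rewrite /b; under eq_fun do rewrite van; rewrite Dn0.
rewrite /Qop; under eq_bigr do rewrite E.
pose a r := if r is q.+1 then b q else 0.
by rewrite (telescope_sign0 a) /= bK mulr0 subr0.
Qed.

(* The homotopy identity 1 = T_k Lam_k + Q_k (1 - B_k A_k). *)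
Lemma Lam_Qop k K w y v : nice w ->
  (forall y, w y (iter K (B k) v) = 0) ->
  w y v = totT k (Lam o k K w) y v + Qop k K w y (fun c => v c - B k (Ash k v) c).
Proof.
move=> nw van; pose a r := Dn k r (w^~ (iter r (B k) v)) y.
have aK : a K = 0 by rewrite /a; under eq_fun do rewrite van; rewrite Dn0.
have := telescope_sign0 a K; rewrite aK mulr0 subr0 [a 0%N]/a /= => <-.
rewrite /totT /Lam /Qop Dt_sum => [|r _]; last first.
  by apply: inA_scale; apply: inA_Dn; exact: nice_inA.
rewrite -!big_split; apply: eq_bigr => r _ /=.
rewrite DtZ; last by apply: inA_Dn; exact: nice_inA.
have -> : Dn k r (w^~ (iter r (B k) (fun c => v c - B k (Ash k v) c))) y =
    a r - Dn k r (w^~ (B k (iter r (B k) (Ash k v)))) y.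
  rewrite linmap_vsub; last exact/linmap_iter/linmap_shB.
  rewrite -iterSr iterS.
  rewrite (_ : w^~ _ = fun z => w z (iter r (B k) v) + -1 * w z (B k (iter r (B k) (Ash k v)))); last first.
    by apply/funext => z; rewrite nice_vsub// mulN1r.
  rewrite Dn_add; [|exact: nice_inA|by apply: inA_scale; exact: nice_inA].
  by rewrite Dn_scale ?mulN1r//; exact: nice_inA.
rewrite /a /=; ring.
Qed.

(** With [ks] all directions other than [o], K large and w = dv f, the value at the unit vector of
    u^o is the Euler derivative: the sum of (-1)^|n| D^n of the derivative of f along u^o_n, over
    n^o = 0. *)
Definition Qs K (ks : seq 'I_m) w := foldl (fun w k => Qop k K w) w ks.

Lemma nice_Qs K ks w : nice w -> nice (Qs K ks w).
Proof. by elim: ks w => //= k ks IH w nw; apply: IH; exact: nice_Qop. Qed.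

Lemma Qs_eqS K ks w w' :
  (forall y v, onS y -> tanS v -> w y v = w' y v) ->
  forall y v, onS y -> tanS v -> Qs K ks w y v = Qs K ks w' y v.
Proof. by elim: ks w w' => //= k ks IH w w' ww; apply: IH; exact: Qop_eqS. Qed.

Lemma Qop_ext2 k K w w' : (forall y v, tanS v -> w y v = w' y v) ->
  forall y v, tanS v -> Qop k K w y v = Qop k K w' y v.
Proof.
move=> ww y v Sv; apply: eq_bigr => r _; congr (_ * Dn k r _ y).
by apply/funext => z; apply: ww; exact: tanS_iter_shB.
Qed.

Lemma Qs_ext2 K ks w w' : (forall y v, tanS v -> w y v = w' y v) ->
  forall y v, tanS v -> Qs K ks w y v = Qs K ks w' y v.
Proof. by elim: ks w w' => //= k ks IH w w' ww; apply: IH; exact: Qop_ext2. Qed.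

Lemma QsD K ks w w' y v : nice w -> nice w' ->
  Qs K ks (fun y v => w y v + w' y v) y v = Qs K ks w y v + Qs K ks w' y v.
Proof.
elim: ks w w' => //= k ks IH w w' nw nw'.
rewrite -IH; [|exact: nice_Qop..]; congr (Qs K ks _ y v).
by apply/funext => z; apply/funext => u; exact: QopD.
Qed.

Lemma QsZ K ks a w y v : nice w ->
  Qs K ks (fun y v => a * w y v) y v = a * Qs K ks w y v.
Proof.
elim: ks w => //= k ks IH w nw.
rewrite -IH; last exact: nice_Qop; congr (Qs K ks _ y v).
by apply/funext => z; apply/funext => u; exact: QopZ.
Qed.

Lemma Qs0 K ks y v : Qs K ks (fun _ _ => 0) y v = 0.
Proof.
by have := @QsZ K ks 0 (fun _ _ => 0) y v (nice0 R m); rewrite !mul0r.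
Qed.

Lemma Qs_sum K ks (I : Type) (r : seq I) (P : pred I) (F : I -> Pt -> Pt -> R) y v :
  (forall i : I, P i -> nice (F i)) ->
  Qs K ks (fun y v => \sum_(i <- r | P i) F i y v) y v = \sum_(i <- r | P i) Qs K ks (F i) y v.
Proof.
move=> nF; elim: r => [|i r IH].
  rewrite big_nil -[RHS](Qs0 K ks y v); congr (Qs K ks _ y v).
  by apply/funext => z; apply/funext => u; rewrite big_nil.
rewrite big_cons; case Pi: (P i); last first.
  rewrite -IH; congr (Qs K ks _ y v); by apply/funext => z; apply/funext => u; rewrite big_cons Pi.
rewrite -IH -QsD; [|exact: nF|exact: nice_sum].
by congr (Qs K ks _ y v); apply/funext => z; apply/funext => u; rewrite big_cons Pi.
Qed.

Lemma Qs_Dt K ks i w y v : nice w ->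
  Qs K ks (fun y v => Dt i (w^~ v) y) y v = Dt i (Qs K ks w ^~ v) y.
Proof.
elim: ks w => //= k ks IH w nw; rewrite -IH; last exact: nice_Qop.
by congr (Qs K ks _ y v); apply/funext => z; apply/funext => u; exact: Qop_Dt.
Qed.

Lemma Qs_subst K ks w (M : Pt -> Pt) y v :
  (forall k u, k \in ks -> tanS u -> M (B k u) = B k (M u)) -> tanS v ->
  (forall u, tanS u -> tanS (M u)) ->
  Qs K ks (fun y v => w y (M v)) y v = Qs K ks w y (M v).
Proof.
elim: ks w y v => //= k ks IH w y v MB Sv SM.
rewrite -IH//; last by move=> j u jk; apply: MB; rewrite inE jk orbT.
apply: Qs_ext2 => // z u Su; apply: Qop_subst => // u' Su'.
by apply: MB; rewrite ?inE ?eqxx.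
Qed.

Lemma Qs_vanish K ks w k : (forall y v, w y (iter K (B k) v) = 0) ->
  forall y v, tanS v -> Qs K ks w y (iter K (B k) v) = 0.
Proof.
move=> van y v Sv; rewrite -(Qs_subst _ _ (M := iter K (B k))).
- by rewrite (_ : (fun _ _ => _) = fun _ _ => 0) ?Qs0//; apply/funext => z; apply/funext => u.
- by move=> j u _ _; exact: iter_shB_shB.
- by [].
- by move=> u Su; exact: tanS_iter_shB.
Qed.

(** Vectors whose nonzero fibre components have multi-indices supported on [o]: the vectors at which
    the Euler operators annihilate all divergences. *)
Definition base v := forall i, i != o -> Ash i v = fun=> 0.

(** [totT i] moves through the factors before [Qop i], which then annihilates it. The later factors
    only evaluate at lowered vectors, still killed by [Ash i]. *)
Lemma Qs_totT K ks i w y v : nice w -> i != o -> i \in ks -> uniq ks -> tanS v ->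
  Ash i v = (fun=> 0) -> (forall y v, w y (iter K (B i) v) = 0) ->
  Qs K.+1 ks (totT i w) y v = 0.
Proof.
move=> nw io; elim: ks w y v nw => //= k ks IH w y v nw; rewrite inE => iks /andP[kks uks] Sv Aiv van.
have [ik|ik] := eqVneq i k.
  subst k.
  have E : forall (l : seq 'I_m) u z, i \notin l -> tanS u -> Ash i u = (fun=> 0) ->
      Qs K.+1 l (Qop i K.+1 (totT i w)) z u = 0.
    elim/last_ind => [|l j IHl] u z; first by move=> _ Su Au; exact: Qop_totT.
    rewrite mem_rcons inE negb_or => /andP[ij il] Su Au.
    rewrite /Qs -cats1 foldl_cat /=; apply: Qop_zero => z' r; apply: IHl => //.
      exact: tanS_iter_shB.
    by rewrite Ash_iter_shB_ne// Au linmap_0//; exact/linmap_iter/linmap_shB.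
  exact: E.
move: iks; rewrite (negbTE ik) /= => iks.
transitivity (Qs K.+1 ks (totT i (Qop k K.+1 w)) y v).
  by apply: Qs_ext2 => // z u Su; exact: Qop_totT_ne.
apply: IH => //; first exact: nice_Qop.
move=> z u; apply: Qop_zero => z' r.
by rewrite iter_shB_comm van.
Qed.

Lemma Ash_sub_shB k v : k != o -> tanS v -> Ash k (fun c => v c - B k (Ash k v) c) = fun=> 0.
Proof.
move=> ko Sv; rewrite linmap_vsub; last exact: linmap_Ash.
by rewrite Ash_shB//; [apply/funext => c; rewrite subrr|exact: tanS_Ash].
Qed.

(** Induction on the directions: [Lam_Qop] splits off the divergence of [Lam o k K w], and the
    remainder is [Qop k K w] composed with the projection M = 1 - B_k A_k onto the kernel of
    [Ash k]. M commutes with the other lowerings, so the hypothesis on Euler operators passes to the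
    remaining directions. *)
Lemma Euler_exact K ks w : nice w -> uniq ks -> (forall k, k \in ks -> k != o) ->
  (forall k y v, k \in ks -> tanS v -> w y (iter K (B k) v) = 0) ->
  (forall y v, onS y -> tanS v -> (forall k, k \in ks -> Ash k v = fun=> 0) ->
     Qs K ks w y v = 0) ->
  exists2 h : 'I_m -> Fun, (forall k, inA (h k)) &
    eqS (Hint w) (fun y => \sum_(k <- ks) Dt k (h k) y).
Proof.
elim: ks w => [|k ks IH] w nw uks kso van Ew.
  exists (fun=> fun=> 0) => [k|y Sy]; first exact: inA_cst.
  rewrite big_nil -[RHS](congr1 (fun F => F y) (Hint0 R m)); move: y Sy.
  by apply: Hint_eqS => y v Sy Sv; exact: Ew.
have /andP[kks uks'] := uks.
have ko : k != o by apply: kso; rewrite inE eqxx.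
pose M (v : Pt) : Pt := fun c => v c - B k (Ash k v) c.
have lM : linmap M.
  move=> c; apply: finlinD; first exact: finlin_coord.
  by apply: finlinN; apply: (linmap_comp (@linmap_shB R m o k) (@linmap_Ash R m k)).
have SM u : tanS u -> tanS (M u).
  by move=> Su; apply: tanS_sub => //; exact: tanS_shB.
have MB j u : j \in ks -> tanS u -> M (B j u) = B j (M u).
  move=> jks Su; have kj : k != j by apply: contraNneq kks => ->.
  by rewrite /M linmap_vsub ?Ash_shB_ne// 1?shB_comm//; exact: linmap_shB.
have nQ := nice_Qop k K nw.
have nw' : nice (fun y v => Qop k K w y (M v)) by exact: nice_subst.
have [] := IH _ nw' uks'.
- by move=> j jks; apply: kso; rewrite inE jks orbT.
- move=> j y v jks Sv; apply: Qop_zero => z r.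
  have -> q : M (iter q (B j) v) = iter q (B j) (M v).
    by elim: q => //= q IHq; rewrite MB ?IHq//; exact: tanS_iter_shB.
  by rewrite iter_shB_comm; apply: van; [rewrite inE jks orbT|apply: tanS_iter_shB; exact: SM].
- move=> y v Sy Sv Av; rewrite Qs_subst//.
  apply: (Ew y (M v)) => //; first exact: SM.
  move=> j; rewrite inE => /predU1P[->|jks]; first exact: Ash_sub_shB.
  have jo : j != o by apply: kso; rewrite inE jks orbT.
  have jk : j != k by apply: contraNneq kks => <-.
  rewrite /M linmap_vsub ?(Av _ jks); last exact: linmap_Ash.
  rewrite Ash_shB_ne//; last exact: tanS_Ash.
  rewrite Ash_comm (Av _ jks) (linmap_0 (@linmap_Ash R m k)) (linmap_0 (@linmap_shB R m o k)).
  by apply/funext => c; rewrite subrr.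
move=> h Ah Eh.
have nL := nice_Lam o k K nw.
exists (fun j => if j == k then Hint (Lam o k K w) else h j) => [j|y Sy].
  by case: ifP => _ //; exact: inA_Hint.
rewrite big_cons eqxx.
rewrite (eq_big_seq (fun j => Dt j (h j) y)) => [|j jks]; last first.
  by case: eqP jks kks => // -> ->.
rewrite -Eh// -Hint_totT// -HintD//; last exact: nice_totT.
move: y Sy; apply: Hint_eqS => y v Sy Sv; apply: Lam_Qop => // z.
by apply: van => //; rewrite inE eqxx.
Qed.

End EulerOperators.

(** * Functions whose derivative in direction 1 is a divergence *)

Section KernelOfD1.
Variables (R : realType) (m : nat) (o : 'I_m).
Local Notation Pt := (Defs.Pt R m).
Local Notation Fun := (Defs.Fun R m).
Local Notation Coord := (Defs.Coord m).
Local Notation B := (@shB R m o).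
Local Notation pr := (@pr R m o).
Implicit Types (f g : Fun) (y v : Pt) (c : Coord) (i j k : 'I_m) (w : Pt -> Pt -> R) (n : mi m).

(* Copies the components v_(u^b_n), n^o = 0, to the free u^o-components. *)
Definition Zb b v : Pt := fun c =>
  if c is inl (inr (la, n)) then if (la == o) && (n o == 0%N) then v (cU b n) else 0 else 0.

Lemma tanS_Zb b v : tanS (Zb b v).
Proof.
split => // n; rewrite /CE big1 // => j _ /=.
by case: ifP => // /andP[/eqP ->]; rewrite incr_eq.
Qed.

Lemma prE v : pr v = Zb o v.
Proof.
apply/funext; case=> [[j|[la n]]|n] //=.
by case: (eqVneq la o) => //= ->.
Qed.

Lemma linmap_Zb b : linmap (Zb b).
Proof.
case=> [[j|[la n]]|n] /=; [exact: finlin0| |exact: finlin0].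
by case: (_ && _); [exact: finlin_coord|exact: finlin0].
Qed.

Lemma Zb_shB b k v : k != o -> Zb b (B k v) = B k (Zb b v).
Proof.
move=> ko; apply: (@onS_ext R m o).
- by case: (tanS_Zb b (B k v)).
- by case: (tanS_shB o k (Zb b v)).
case=> [[j|[la n]]|n] fc; rewrite (shB_freec _ _ fc)//=; last by case: ifP.
case: (eqVneq la o) fc => [->|lo] /=; last by case: ifP.
rewrite /freec eqxx /= -eqn0Ngt => no; rewrite no.
have ok : o != k by rewrite eq_sym.
rewrite (decr_ne _ ok) no; case: (n k == 0%N) => //.
  by rewrite (eqP no) andbF.
by rewrite (eqP no) andbF.
Qed.

Lemma Ash_Zb b k v : k != o -> Ash k (Zb b v) = Zb b (Ash k v).
Proof.
move=> ko; have ok : o != k by rewrite eq_sym.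
by apply/funext; case=> [[j|[la n]]|n] //=; rewrite (incr_ne _ ok).
Qed.

(** [Ash o] does not commute with the lowerings [shB k], because its free u^o-components come from
    the dependent coordinates; without these components it does. *)
Definition Yo v : Pt := fun c => Ash o v c - pr (Ash o v) c.

Lemma linmap_Yo : linmap Yo.
Proof.
move=> c; apply: finlinD; first exact: linmap_Ash.
apply: finlinN; exact: (linmap_comp (@linmap_pr R m o) (@linmap_Ash R m o)).
Qed.

Lemma tanS_Yo v : tanS v -> tanS (Yo v).
Proof. by move=> Sv; apply: tanS_sub; [exact: tanS_Ash|exact: tanS_pr]. Qed.

Lemma Yo_o v n : n o = 0%N -> Yo v (cU o n) = 0.
Proof. by move=> no; rewrite /Yo /= no !eqxx /= subrr. Qed.

Lemma Yo_shB k v : k != o -> tanS v -> Yo (B k v) = B k (Yo v).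
Proof.
move=> ko Sv; apply: (@onS_ext R m o).
- by case: (tanS_Yo (tanS_shB o k v)).
- by case: (tanS_shB o k (Yo v)).
have ko' : o != k by rewrite eq_sym.
case=> [[j|[la n]]|n] fc; rewrite (shB_freec _ _ fc).
- by rewrite /Yo /= subr0.
- case: (eqVneq la o) fc => [->|lo] fc.
    have no : n o = 0%N by move: fc; rewrite /= eqxx /= -eqn0Ngt => /eqP.
    rewrite Yo_o//= ; case: ifP => // _.
    by rewrite -/(cU _ _) Yo_o// decr_ne.
  by rewrite /Yo /= (negbTE lo) /= !subr0 (incr_ne _ ko) decr_incr.
- by rewrite /Yo /= !subr0 (incr_ne _ ko) decr_incr.
Qed.

(* The equation u^o_(n+(o)) = - sum_b u^b_(n+(b)), read on tangent vectors. *)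
Lemma Ash_o_decomp v : tanS v ->
  Ash o v = fun c => Yo v c - \sum_(b < m | b != o) Ash b (Zb b v) c.
Proof.
move=> [Sv _]; apply/funext => c; rewrite /Yo -addrA -[LHS]addr0; congr (_ + _).
apply/esym/eqP; rewrite -opprD oppr_eq0 addr_eq0; apply/eqP.
case: c => [[j|[la n]]|n] /=; [by rewrite big1 ?oppr0| |by rewrite big1 ?oppr0].
case: (eqVneq la o) => [->|lo] /=; last by rewrite big1 ?oppr0.
have ne b : b != o -> (incr n b) o = n o by move=> bo; rewrite incr_ne// eq_sym.
case: ifP => no; last by rewrite big1 ?oppr0// => b bo; rewrite ne ?no.
rewrite -{1}(sigma_id o Sv) /= eqxx incr_eq /= incrK; congr (- _).
by apply: eq_bigr => b bo; rewrite ne ?no.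
Qed.

Lemma nice_vsum w y (I : Type) (r : seq I) (P : pred I) (F : I -> Pt) : nice w ->
  w y (fun c => \sum_(i <- r | P i) F i c) = \sum_(i <- r | P i) w y (F i).
Proof.
move=> nw; elim: r => [|i r IH].
  by rewrite big_nil -[RHS](nice_zero y nw); congr (w y _); apply/funext => c; rewrite big_nil.
rewrite big_cons; case Pi: (P i); last first.
  by rewrite -IH; congr (w y _); apply/funext => c; rewrite big_cons Pi.
rewrite -IH -[X in _ + X]mul1r -nice_line//; congr (w y _); apply/funext => c.
by rewrite big_cons Pi /line mul1r.
Qed.

Section Identity.
Variables (w : Pt -> Pt -> R) (K : nat).
Hypotheses (nw : nice w) (van : forall k y v, w y (iter K (B k) v) = 0).

Let ks := [seq k <- enum 'I_m | k != o].
Local Notation E := (Qs o K.+1 ks).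

Lemma ks_uniq : uniq ks. Proof. by rewrite filter_uniq// enum_uniq. Qed.
Lemma ks_mem k : (k \in ks) = (k != o). Proof. by rewrite mem_filter mem_enum andbT. Qed.

Lemma vanish_succ k y v : w y (iter K.+1 (B k) v) = 0.
Proof. by rewrite iterSr van. Qed.

(** Integration by parts: the Euler operator kills [totT k w], the sum of D_k and the shift. *)
Lemma Euler_Ash k y v : k != o -> tanS v -> Ash k v = (fun=> 0) ->
  E (fun y v => w y (Ash k v)) y v = - Dt k (E w ^~ v) y.
Proof.
move=> ko Sv Av.
have nA : nice (fun y v => w y (Ash k v)) by apply: nice_subst => //; exact: linmap_Ash.
have := @Qs_totT R m o K ks k w y v nw ko _ ks_uniq Sv Av (van k).
rewrite ks_mem => /(_ ko); rewrite [totT k w](_ : _ = fun y v => Dt k (w^~ v) y + w y (Ash k v))//.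
rewrite QsD//; last exact: nice_Dt.
by rewrite Qs_Dt// => /eqP; rewrite addrC addr_eq0 => /eqP.
Qed.

(** The direction [o] is not among those of E, so no integration by parts applies to its shift.
    [Ash_o_decomp] trades that shift for [Yo], which passes through E, and for shifts in directions
    b != o, which [Euler_Ash] turns into D_b. *)
Lemma Euler_totT_o y v : tanS v -> base o v ->
  E (totT o w) y v = Dt o (E w ^~ v) y + E w y (Yo v)
     + \sum_(b < m | b != o) Dt b (E w ^~ (Zb b v)) y.
Proof.
move=> Sv bv.
have nA : nice (fun y v => w y (Ash o v)) by apply: nice_subst => //; exact: linmap_Ash.
rewrite [totT o w](_ : _ = fun y v => Dt o (w^~ v) y + w y (Ash o v))//.
rewrite QsD//; last exact: nice_Dt.
rewrite Qs_Dt// -addrA; congr (_ + _).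
have nY : nice (fun y v => w y (Yo v)) by apply: nice_subst => //; exact: linmap_Yo.
have nZ b : nice (fun y v => w y (Ash b (Zb b v))).
  apply: nice_subst => //; exact: (linmap_comp (@linmap_Ash R m b) (@linmap_Zb b)).
have nS : nice (fun y v => \sum_(b < m | b != o) w y (Ash b (Zb b v))) by exact: nice_sum.
transitivity (E (fun y v => w y (Yo v) + -1 * \sum_(b < m | b != o) w y (Ash b (Zb b v))) y v).
  apply: Qs_ext2 => // z u Su; rewrite {1}Ash_o_decomp// nice_vsub// mulN1r.
  by rewrite nice_vsum.
rewrite QsD//; last exact: nice_scale.
rewrite QsZ// Qs_sum// mulN1r -sumrN; congr (_ + _).
  apply: Qs_subst => //; last exact: tanS_Yo.
  by move=> k u; rewrite ks_mem => ko Su; exact: Yo_shB.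
apply: eq_bigr => b bo.
have Zv : Ash b (Zb b v) = fun=> 0.
  by rewrite Ash_Zb// bv// linmap_0//; exact: linmap_Zb.
rewrite -[RHS]opprK -Euler_Ash//; last exact: tanS_Zb.
congr (- _); apply: (@Qs_subst R m o K.+1 ks (fun y v => w y (Ash b v)) (Zb b)) => //.
  by move=> k u; rewrite ks_mem => ko Su; exact: Zb_shB.
by move=> u _; exact: tanS_Zb.
Qed.

Hypothesis closed : forall y v, onS y -> tanS v -> base o v -> E (totT o w) y v = 0.

(** On these vectors [shB o] is a right inverse of [Ash o], so the identity of [Euler_totT_o] can be
    solved for E at v. *)
Let W v := [/\ tanS v, base o v & pr v = fun=> 0].

Lemma W_shB v : W v -> W (B o v).
Proof.
move=> [Sv bv pv]; split; [exact: tanS_shB| |exact: pr_shB].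
by move=> i io; rewrite Ash_shB_ne// bv// linmap_0//; exact: linmap_shB.
Qed.

Lemma Euler_step v : W v -> eqS (E w ^~ v) (fun y => -1 * Dt o (E w ^~ (B o v)) y).
Proof.
move=> Wv y Sy; have [SB bB pB] := W_shB Wv; have [Sv bv pv] := Wv.
have Yv : Yo (B o v) = v.
  have A : Ash o (B o v) = v.
    by rewrite Ash_shB_o// pv; apply/funext => c; rewrite subr0.
  by rewrite /Yo A pv; apply/funext => c; rewrite subr0.
have nE := @nice_Qs R m o K.+1 ks w nw.
have := closed Sy SB bB; rewrite Euler_totT_o// Yv big1 ?addr0 => [/eqP|b bo].
  by rewrite addrC addr_eq0 mulN1r => /eqP.
rewrite (_ : Zb b (B o v) = fun=> 0).
  by under eq_fun do rewrite nice_zero//; rewrite Dt0.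
apply/funext; case=> [[j|[la n]]|n] //=.
by case: ifP => // /andP[_ /eqP no]; rewrite (negbTE bo) /= no eqxx.
Qed.

(** [Euler_step] trades each lowering in direction [o] for a derivative D_o; after enough of them w
    no longer sees the vector. So the Euler derivatives along the other dependent variables
    vanish. *)
Lemma Euler_W0 y v : onS y -> W v -> E w y v = 0.
Proof.
move=> Sy Wv.
have nE := @nice_Qs R m o K.+1 ks w nw.
have WB q : W (iter q (B o) v) by elim: q => //= q; exact: W_shB.
have it r : eqS (E w ^~ v) (fun y => (-1) ^+ r * Dn o r (E w ^~ (iter r (B o) v)) y).
  elim: r => [|r IH] z Sz; first by rewrite mul1r.
  rewrite IH// (Dn_eqS o r (Euler_step (WB r)))// Dn_scale; last first.
    by apply: inA_Dt; exact: nice_inA.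
  by rewrite DnSr exprSr mulrA.
rewrite (it K.+1)//.
rewrite (_ : E w ^~ _ = fun=> 0) ?Dn0 ?mulr0//; apply/funext => z.
have [Sv _ _] := Wv.
by apply: Qs_vanish => // z' u; exact: vanish_succ.
Qed.

Definition unitU b : Pt := fun c => (c == cU b (mi0 m))%:R.

Lemma incr_neq0 n i : (incr n i == mi0 m) = false.
Proof.
by apply/eqP => /ffunP /(_ i); rewrite incr_eq ffunE.
Qed.

Lemma cU_eq b b' n n' : (cU b n == cU b' n') = (b == b') && (n == n').
Proof. by []. Qed.

Lemma tanS_unitU b : tanS (unitU b).
Proof.
split => // n; rewrite /CE big1// => j _.
by rewrite /unitU cU_eq incr_neq0 andbF.
Qed.

Lemma Ash_unitU i b : Ash i (unitU b) = fun=> 0.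
Proof.
apply/funext; case=> [[j|[la n]]|n] //=.
by rewrite /unitU cU_eq incr_neq0 andbF.
Qed.

Lemma Zb_unitU b b' : Zb b (unitU b') = if b == b' then unitU o else fun=> 0.
Proof.
apply/funext; case=> [[j|[la n]]|n] /=; [by case: ifP| |by case: ifP].
rewrite /unitU cU_eq; case: (eqVneq b b') => [_|_] /=; last by rewrite if_same.
rewrite cU_eq; case: (eqVneq la o) => //= _; case: (eqVneq n (mi0 m)) => [->|_].
  by rewrite ffunE eqxx.
by rewrite if_same.
Qed.

Lemma Yo_unitU b : Yo (unitU b) = fun=> 0.
Proof.
rewrite /Yo Ash_unitU (linmap_0 (@linmap_pr R m o)).
by apply/funext => c; rewrite subrr.
Qed.

(** [Euler_totT_o] at the unit vector of u^i gives D_o e = 0 for i = o. For i != o it gives D_i e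
    plus D_o of the Euler derivative along u^i, and the latter is zero by [Euler_W0]. *)
Lemma Dt_Euler_unit i : eqS (Dt i (E w ^~ (unitU o))) (fun=> 0).
Proof.
move=> y Sy; have nE := @nice_Qs R m o K.+1 ks w nw.
have bU b : base o (unitU b) by move=> j _; exact: Ash_unitU.
have [->|io] := eqVneq i o.
  have := closed Sy (tanS_unitU o) (bU o); rewrite Euler_totT_o//; last exact: tanS_unitU.
  rewrite Yo_unitU (nice_zero _ nE) addr0 big1 ?addr0// => b bo.
  rewrite Zb_unitU (negbTE bo).
  by under eq_fun do rewrite nice_zero//; rewrite Dt0.
have := closed Sy (tanS_unitU i) (bU i); rewrite Euler_totT_o//; last exact: tanS_unitU.
rewrite Yo_unitU (nice_zero _ nE) addr0 (bigD1 i)//= Zb_unitU eqxx big1 ?addr0 => [|b /andP[bo bi]]; last first.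
  rewrite Zb_unitU (negbTE bi).
  by under eq_fun do rewrite nice_zero//; rewrite Dt0.
rewrite (Dt_eqS o (g := fun=> 0)) ?Dt0 ?add0r// => z Sz; apply: Euler_W0 => //; split => //.
  exact: tanS_unitU.
by rewrite prE Zb_unitU eq_sym (negbTE io).
Qed.

End Identity.

Lemma Dn_cst k q (a : R) : Dn k q.+1 (fun=> a) = fun=> 0.
Proof.
by rewrite -DnSr (_ : Dt k _ = fun=> 0) ?Dn0//; apply/funext => z; rewrite DtE dv_cst.
Qed.

Lemma Qs_coord K ks c : Qs o K.+1 ks (fun _ v => v c) = fun (_ : Pt) v => v c.
Proof.
elim: ks => //= k ks IH; rewrite -[RHS]IH; congr (Qs _ _ _ _).
apply/funext => y; apply/funext => v; rewrite /Qop big_ord_recl.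
rewrite [X in _ + X]big1 => [|r _]; first by rewrite addr0 /= mul1r.
by rewrite lift0 Dn_cst mulr0.
Qed.

(** A single k != o removes all fibre coordinates, as Gop_k D_k f = f - f(x, 0); the existence of
    such a k reflects m >= 2. The antiderivatives then remove the x^i. *)
Lemma const_of_Dt0 f : inA f -> (exists k, k != o) ->
  (forall i, eqS (Dt i f) (fun=> 0)) -> eqS f (fun=> f (fun=> 0)).
Proof.
move=> Af [k ko] df y Sy.
have [K0 HK0] := nice_vanish o (dv_nice Af).
have := @Gop_Dt R m o k K0 f Af ko (fun z v => HK0 K0.+1 (leqnSn _) k z v) y Sy.
rewrite (@Gop_eqS R m o k K0.+1 _ _ (df k))// /Gop (_ : dv _ = fun _ _ => 0); last first.
  by apply/funext => z; apply/funext => v; rewrite dv_cst.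
rewrite (_ : Lam _ _ _ _ = fun _ _ => 0) ?Hint0; last first.
  by apply/funext => z; apply/funext => v; rewrite /Lam big1// => r _; rewrite Dn0 mulr0.
move=> /eqP; rewrite eq_sym subr_eq0 => /eqP ->.
have step i z : f (keepX z) = f (zeroX i z).
  apply/eqP; rewrite -subr_eq0 -Qx_Dt//; apply/eqP.
  rewrite /Qx /int_pencil (_ : (fun t => _) = fun=> 0) ?int01_0 ?mulr0//.
  apply/funext => t; apply: df => n; rewrite /CE big1// => j _.
  by rewrite /line /= mulr0 addr0.
(* The x-coordinates are set to zero one after the other; once the list exhausts all indices the
   point is the origin. *)
have iter_step (l : seq 'I_m) z : f (keepX z) = f (foldr (@zeroX R m) (keepX z) l).
  elim: l => //= i l ->; have := step i (foldr (@zeroX R m) (keepX z) l).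
  congr (f _ = _); case: l => [|j l]; by apply/funext; case=> [[?|[? ?]]|?].
rewrite (iter_step (enum 'I_m)); congr f; apply/funext => c.
have : c \in [pred c : Coord | if c is inl (inl j) then j \in enum 'I_m else true].
  by case: c => [[j|?]|?]; rewrite inE ?mem_enum.
elim: (enum 'I_m) => [|i l IH] /=; rewrite inE; first by case: c => [[j|[? ?]]|?].
case: c IH => [[j|[? ?]]|?] //= IH; rewrite inE; case: eqP => //= _ jl.
Qed.

(** The Euler derivative along u^o is 1 on u^o and 0 on every divergence; both are compared at the
    origin. *)
Lemma unit_not_divergence (g : 'I_m -> Fun) : (forall k, inA (g k)) ->
  ~ eqS (fun y => y (cU o (mi0 m))) (fun y => \sum_(k < m | k != o) Dt k (g k) y).
Proof.
move=> Ag E.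
pose ks := [seq k <- enum 'I_m | k != o].
have ksu : uniq ks by rewrite filter_uniq// enum_uniq.
have [K HK] : exists K, forall k y v i, dv (g k) y (iter K (B i) v) = 0.
  have /fin_all_exists [K0 HK] : forall k, exists K0, forall K, (K0 <= K)%N ->
      forall i y v, dv (g k) y (iter K (shB o i) v) = 0.
    by move=> k; apply: nice_vanish; exact: dv_nice.
  exists (\max_k K0 k) => k y v i; apply: HK; exact: (leq_bigmax k).
have S00 : onS ((fun=> 0) : Pt) by move=> n; exact: big1.
have SU := tanS_unitU o.
have P y v : onS y -> tanS v ->
    v (cU o (mi0 m)) = \sum_(k < m | k != o) totT k (dv (g k)) y v.
  move=> Sy Sv; rewrite -(dv_coord (cU o (mi0 m)) y v) (dv_eqS E Sy Sv).
  rewrite dv_sum => [|k _]; last exact: inA_Dt.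
  by apply: eq_bigr => k _; rewrite dv_Dt.
have := @Qs_eqS R m o K.+1 ks (fun _ v => v (cU o (mi0 m))) _ P _ _ S00 SU.
rewrite Qs_coord Qs_sum => [|k _]; last by apply: nice_totT; exact: dv_nice.
rewrite big1 => [/eqP|k ko]; first by rewrite /unitU eqxx oner_eq0.
by apply: Qs_totT => //; [exact: dv_nice|rewrite mem_filter ko mem_enum|exact: Ash_unitU].
Qed.

(** Gop_o D_o f is f without f(x, 0) and without the radial integral of the u^o-part of dv f, and it
    is a divergence because Gop_o commutes with the other D_k. f(x, 0) is a divergence by [Dt_Qx],
    and [Euler_exact] handles the u^o-part up to a constant multiple of u^o. *)
Lemma kernel_D_o f (g : 'I_m -> Fun) : inA f -> (forall k, inA (g k)) ->
  (exists k, k != o) ->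
  eqS (Dt o f) (fun y => \sum_(k < m | k != o) Dt k (g k) y) ->
  exists c : R, exists2 h : 'I_m -> Fun, (forall k, inA (h k)) &
    eqS f (fun y => c * y (cU o (mi0 m)) + \sum_(k < m | k != o) Dt k (h k) y).
Proof.
move=> Af Ag exk E; have [k0 k0o] := exk.
pose ks := [seq k <- enum 'I_m | k != o].
have ksu : uniq ks by rewrite filter_uniq// enum_uniq.
have ksm k : (k \in ks) = (k != o) by rewrite mem_filter mem_enum andbT.
have sumks (F : 'I_m -> R) : \sum_(k <- ks) F k = \sum_(k < m | k != o) F k.
  by rewrite big_filter big_enum_cond.
have [K [HK Hf]] : exists K, (forall k y v i, dv (g k) y (iter K (B i) v) = 0) /\
    forall i y v, dv f y (iter K (B i) v) = 0 /\ iter K (B i) v (cU o (mi0 m)) = 0.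
  have /fin_all_exists [K0 HK] : forall k, exists K0, forall K, (K0 <= K)%N ->
      forall i y v, dv (g k) y (iter K (shB o i) v) = 0.
    by move=> k; apply: nice_vanish; exact: dv_nice.
  have [K1 HK1] := nice_vanish o (dv_nice Af).
  (* The 2 is the bound of [iter_shB_vanish] for the coordinate u^o with zero multi-index. *)
  exists (maxn (\max_k K0 k) (maxn K1 2)); split=> [k y v i|i y v].
    apply: HK; apply: leq_trans (leq_maxl _ _); exact: (leq_bigmax k).
  split; first by apply: HK1; rewrite !leq_max leqnn orbT.
  by apply: iter_shB_vanish; rewrite /= ffunE !leq_max !orbT.
have nf := dv_nice Af.
pose b := dv f.
have closed y v : onS y -> tanS v -> base o v -> Qs o K.+1 ks (totT o b) y v = 0.
  move=> Sy Sv bv.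
  rewrite (@Qs_eqS R m o K.+1 ks _ (fun y v => \sum_(k < m | k != o) totT k (dv (g k)) y v))//.
    rewrite Qs_sum => [|k _]; last by apply: nice_totT; exact: dv_nice.
    rewrite big1// => k ko; apply: Qs_totT => //; [exact: dv_nice|by rewrite ksm|exact: bv].
  move=> z u Sz Su; rewrite -dv_Dt// (dv_eqS E Sz Su) dv_sum => [|k _]; last exact: inA_Dt.
  by apply: eq_bigr => k _; rewrite dv_Dt.
have vanb k y v : b y (iter K (B k) v) = 0 by case: (Hf k y v).
have nE := @nice_Qs R m o K.+1 ks b nf.
pose e := Qs o K.+1 ks b ^~ (unitU o).
have Ae : inA e by exact: nice_inA.
have ce := const_of_Dt0 Ae exk (Dt_Euler_unit nf vanb closed).
pose e0 := e (fun=> 0).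
pose d : Pt -> Pt -> R := fun _ v => v (cU o (mi0 m)).
have nd : nice d.
  have := nice_mono (cU o (mi0 m)) (@inA_cst R m 1).
  by under eq_fun do under eq_fun do rewrite mul1r.
(* Subtracting e0 du^o makes the Euler derivative along u^o zero, as [Euler_exact] demands. *)
pose b' := fun y v => b y v + (- e0) * d y v.
have nb' : nice b' by apply: nice_add => //; exact: nice_scale.
pose w := fun y v => b' y (pr v).
have nw : nice w by apply: nice_subst => //; exact: linmap_pr.
have prB k u : k != o -> pr (B k u) = B k (pr u) by move=> ko; rewrite !prE Zb_shB.
have prI k q u : k != o -> pr (iter q (B k) u) = iter q (B k) (pr u).
  by move=> ko; elim: q => //= q IH; rewrite prB// IH.
have [h Ah Eh] : exists2 h : 'I_m -> Fun, (forall k, inA (h k)) &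
    eqS (Hint w) (fun y => \sum_(k <- ks) Dt k (h k) y).
  apply: (@Euler_exact R m o K.+1 ks w) => //.
  - by move=> k; rewrite ksm.
  - move=> k y v; rewrite ksm => ko _; rewrite /w /b' /b /d prI// iterSr.
    by have [-> ->] := Hf k y (B k (pr v)); rewrite mulr0 addr0.
  - move=> y v Sy Sv Av.
    rewrite (@Qs_subst R m o K.+1 ks b' pr)//; last by move=> u _; exact: tanS_pr.
      (* [pr] keeps the u^o_n with n^o = 0, and the vanishing shifts exclude n^k > 0 for k != o;
         only n = 0 remains. *)
      have -> : pr v = fun c => v (cU o (mi0 m)) * unitU o c.
        apply/funext; case=> [[j|[la n]]|n] /=; rewrite ?mulr0//.
        rewrite /unitU cU_eq; case: (eqVneq la o) => [->|] /=; rewrite ?mulr0//.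
        case: (eqVneq n (mi0 m)) => [->|n0]; first by rewrite ffunE eqxx mulr1.
        rewrite mulr0; case: eqP => // no.
        have [k nk] : exists k, n k != 0%N.
          apply/existsP; apply: contraNT n0; rewrite negb_exists => /forallP nn.
          by apply/eqP/ffunP => k; rewrite ffunE; apply/eqP; have := nn k; rewrite negbK.
        have ko : k \in ks by rewrite ksm; apply: contraNneq nk => ->; rewrite no.
        have := congr1 (fun F => F (cU o (decr n k))) (Av k ko).
        by rewrite /= decrK// lt0n.
      rewrite (nice_vscale _ _ _ (@nice_Qs R m o K.+1 ks b' nb')).
      rewrite /b' QsD//; last exact: nice_scale.
      rewrite QsZ// /d Qs_coord -/(e y) ce// -/e0 /unitU eqxx mulr1 subrr mulr0//.
    by move=> k u; rewrite ksm => ko _; exact: prB.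
have Hpr y : Hint (fun y v => dv f y (pr v)) y = Hint w y + e0 * y (cU o (mi0 m)).
  have nfp : nice (fun y v => dv f y (pr v)) by apply: nice_subst => //; exact: linmap_pr.
  have ndp : nice (fun y v => (- e0) * d y (pr v)).
    by apply: nice_scale; apply: (nice_subst nd); exact: linmap_pr.
  rewrite /w /b' (HintD _ nfp ndp) (HintZ _ _ (nice_subst nd (@linmap_pr R m o))).
  have -> : Hint (fun y v => d y (pr v)) y = y (cU o (mi0 m)).
    rewrite /Hint /d (_ : (fun t => _) = fun=> y (cU o (mi0 m))).
      have dl (t : R) : is_derive t 1 (fun t : R => t * y (cU o (mi0 m))) (y (cU o (mi0 m))).
        by apply: is_derive_eq; rewrite scaler0 add0r [_ *: _]mulr1.
      have := @int01_FTC R (fun=> y (cU o (mi0 m))) _ (fun t => @cst_continuous _ _ _ t) dl.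
      by rewrite mul1r mul0r subr0.
    by apply/funext => t /=; rewrite eqxx ffunE eqxx.
  by rewrite mulNr subrK.
pose f0 := fun y => f (keepX y).
have Af0 : inA f0 by apply: inA_subst => //; exact: linmap_keepX.
(* The three summands account for the u^o-part, for Gop_o D_o f, and for f(x, 0), integrated in the
   single direction [k0]. *)
exists e0, (fun k y => h k y + Gop o o K.+1 (g k) y + (if k == k0 then Qx k0 f0 y else 0)) => [k|y Sy].
  apply: inA_add; first by apply: inA_add => //; exact: inA_Gop.
  by case: (_ == _); [exact: inA_Qx|exact: inA_cst].
have van1 : forall y v, dv f y (iter K.+1 (B o) v) = 0 by move=> z v; rewrite iterSr; exact: vanb.
have GE := Gop_Dt_o Af van1 Sy.
have GE' : Gop o o K.+1 (Dt o f) y = \sum_(k < m | k != o) Dt k (Gop o o K.+1 (g k)) y.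
  rewrite (@Gop_eqS R m o o K.+1 _ _ E y Sy).
  rewrite (op_sum (@GopD R m o o K.+1) (@GopZ R m o o K.+1)) => [|k _]; last exact: inA_Dt.
  by apply: eq_bigr => k ko; rewrite Gop_Dt_ne.
rewrite (eq_bigr (fun k => Dt k (h k) y + Dt k (Gop o o K.+1 (g k)) y + (if k == k0 then f (keepX y) else 0))) => [|k ko]; last first.
  rewrite DtD; [|by apply: inA_add => //; exact: inA_Gop|by case: (_ == _); [exact: inA_Qx|exact: inA_cst]].
  rewrite DtD//; last exact: inA_Gop.
  congr (_ + _); case: eqP => [->|_]; last by rewrite Dt0.
  by rewrite Dt_Qx// /f0; congr f; apply/funext; case=> [[?|[? ?]]|?].
rewrite !big_split /= -GE' GE Hpr -sumks -Eh//.
rewrite -big_mkcondr /= (big_pred1 k0) => [|k]; first by ring.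
by rewrite /=; case: (eqVneq k k0) => [->|_]; rewrite ?k0o ?andbF.
Qed.

End KernelOfD1.

(** * Horizontal forms split along dx^1 *)

Section HorizontalComplex.
Variables (R : realType) (p : nat).
Local Notation m := p.+2.
Local Notation Pt := (Defs.Pt R m).
Local Notation Fun := (Defs.Fun R m).
Local Notation Form := (Defs.Form R m).
Local Notation o := (ord0 : 'I_m).
Implicit Types (f g : Fun) (y v : Pt) (i j k nu : 'I_m) (T : {set 'I_m}) (t w eta : Form).
Local Notation allA w := (forall T : {set 'I_m}, inA (w T)).

Lemma isForm_inA q w : isForm q w -> allA w.
Proof.
move=> [Aw Zw] T; have [/Aw//|/eqP Tq] := eqVneq #|T| q.
by rewrite Zw//; exact: inA_cst.
Qed.

Lemma isForm_mk q w : allA w -> (forall T, #|T| != q -> w T = fun=> 0) -> isForm q w.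
Proof. by move=> Aw Zw; split=> [T _|T /eqP]; [exact: Aw|exact: Zw]. Qed.

Lemma eqIP w w' : allA w -> allA w' -> (eqI w w' <-> forall T, eqS (w T) (w' T)).
Proof.
move=> Aw Aw'.
have As T : inA (fun y => w T y - w' T y) by exact: inA_sub.
split=> [H T y Sy|H T].
  by apply/eqP; rewrite -subr_eq0; apply/eqP; have [+ _] := inI_onS o (As T) => /(_ (H T)); exact.
by have [_] := inI_onS o (As T); apply=> y Sy; rewrite H// subrr.
Qed.

Lemma inA_zeroF T : inA (@zeroF R m T).
Proof. exact: inA_cst. Qed.

Lemma dH_off q w T : isForm q w -> #|T| != q.+1 -> dH w T = fun=> 0.
Proof.
move=> [_ Zw] Tq; apply/funext => y; rewrite dHE big1// => nu nT.
rewrite Zw ?Dt0 ?mulr0//; move: Tq; rewrite (cardsD1 nu T) nT add1n => + E.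
by rewrite E eqxx.
Qed.

Lemma closedHP q w : isForm q w -> (eqI (dH w) (@zeroF R m) <-> closedOn [set: 'I_m] q w).
Proof.
move=> Fw; have Aw := isForm_inA Fw.
have [H1 H2] := @eqIP (dH w) (@zeroF R m) (fun T => dH_inA T Aw) inA_zeroF.
split=> [/H1 H T _ _|H]; first exact: H.
apply: H2 => T y Sy; have [Tq|Tq] := eqVneq #|T| q.+1; first by rewrite H// finset.subsetT.
by rewrite (dH_off Fw Tq).
Qed.

(** The factor xi in w = theta + dx^o /\ xi; only its values at T not containing [o] are
    meaningful. *)
Definition zeta w : Form := fun T => w (o |: T).

(** As [o] is the smallest index, adding it to T raises every other position by one; hence the minus
    sign. *)
Lemma dH_setU1 w T y : allA w -> o \notin T ->
  dH w (o |: T) y = Dt o (w T) y - dH (zeta w) T y.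
Proof.
move=> Aw oT; rewrite dHE (big_setU1 _ oT) /=.
have -> : sg o (o |: T) = 0%N.
  by apply/eqP; rewrite cards_eq0; apply/eqP/setP => j; rewrite !inE ltn0 andbF.
have -> : (o |: T) :\ o = T.
  by apply/setP => j; rewrite !inE; case: (eqVneq j o) => //= ->; rewrite (negbTE oT).
rewrite expr0 mul1r dHE -sumrN; congr (_ + _); apply: eq_bigr => nu nT.
have no : nu != o by apply: contraNneq oT => <-.
have on : (o < nu)%N by rewrite lt0n; apply: contra no => /eqP E; apply/eqP/val_inj.
rewrite (sg_setU1 _ oT) on addn1 exprS mulN1r mulNr.
congr (- (_ * Dt nu _ y)); rewrite /zeta; congr (w _).
by apply/setP => j; rewrite !inE; case: (eqVneq j o) => //= ->; rewrite eq_sym no.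
Qed.

Lemma dH_ext w w' T y : (forall nu, nu \in T -> w (T :\ nu) = w' (T :\ nu)) ->
  dH w T y = dH w' T y.
Proof. by move=> ww; rewrite !dHE; apply: eq_bigr => nu nT; rewrite ww. Qed.

Lemma dThE t T : dTh t T = if o \in T then fun=> 0 else dH t T.
Proof.
apply/funext => y; rewrite /dTh.
have -> : [exists i in T, val i == 0%N] = (o \in T).
  apply/existsP/idP => [[i /andP[iT /eqP i0]]|oT]; last by exists o; rewrite oT.
  by rewrite (_ : o = i)//; exact/val_inj.
by case: ifP.
Qed.

Lemma D1E t T : D1 t T = Dt o (t T).
Proof. by apply/funext => y; rewrite /D1 (big_pred1 o). Qed.

Lemma isThetaP q t : isTheta q t <-> isForm q t /\ forall T, o \in T -> t T = fun=> 0.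
Proof.
split=> -[Ft H]; split => // T; first by move=> oT; apply: (H T o).
by move=> i iT i0; apply: H; rewrite (_ : o = i)//; exact/val_inj.
Qed.

Lemma setU1_o T : o \in T -> T = o |: (T :\ o).
Proof. by move=> oT; rewrite finset.setD1K. Qed.

Lemma o_setD1 T : o \notin T :\ o.
Proof. by rewrite !inE eqxx. Qed.

Lemma notin_D1 T nu : o \notin T -> o \notin T :\ nu.
Proof. by move=> oT; rewrite !inE (negbTE oT) andbF. Qed.

Lemma subset_o T : (T \subset [set~ o]) = (o \notin T).
Proof. by rewrite finset.subsetC finset.sub1set inE. Qed.

(** The potentials obtained above are uncontrolled in other degrees, whereas [isForm] and [isTheta]
    prescribe zeros there; truncation repairs this without affecting the differential in the degree
    at hand. *)
Definition trunc q (P : pred {set 'I_m}) eta : Form :=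
  fun T => if (#|T| == q) && P T then eta T else fun=> 0.

Lemma trunc_inA q P eta : allA eta -> allA (trunc q P eta).
Proof. by move=> Ae T; rewrite /trunc; case: ifP => _ //; exact: inA_cst. Qed.

Lemma isForm_trunc q P eta : allA eta -> isForm q (trunc q P eta).
Proof.
move=> Ae; apply: isForm_mk; first exact: trunc_inA.
by move=> T /negbTE Tq; rewrite /trunc Tq.
Qed.

Lemma dH_trunc q (P : pred {set 'I_m}) eta T y : #|T| = q.+1 ->
  (forall nu, nu \in T -> P (T :\ nu)) -> dH (trunc q P eta) T y = dH eta T y.
Proof.
move=> Tq PT; apply: dH_ext => nu nT; rewrite /trunc PT// andbT.
by move: Tq; rewrite (cardsD1 nu T) nT add1n => -[->]; rewrite eqxx.
Qed.

Lemma exactH_mk q w eta : isForm q.+1 w -> allA eta ->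
  (forall T, #|T| = q.+1 -> eqS (w T) (dH eta T)) -> exactH q.+1 w.
Proof.
move=> Fw Ae E; split => //=.
have Ft := isForm_trunc q predT Ae.
exists (trunc q predT eta); split => //.
apply/eqIP; [exact: isForm_inA Fw|move=> T; exact/dH_inA/trunc_inA|].
move=> T y Sy; have [Tq|Tq] := eqVneq #|T| q.+1; first by rewrite dH_trunc// E.
by rewrite (dH_off Ft Tq) (proj2 Fw)//; exact/eqP.
Qed.

Lemma exactTh_mk q t eta : isTheta q.+1 t -> allA eta ->
  (forall T, o \notin T -> #|T| = q.+1 -> eqS (t T) (dH eta T)) -> exactTh q.+1 t.
Proof.
move=> Tt Ae E; split => //=; have [Ft t0] := (isThetaP _ _).1 Tt.
pose P (T : {set 'I_m}) := o \notin T.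
have Fe := isForm_trunc q P Ae.
have At := trunc_inA q P Ae.
exists (trunc q P eta); split.
  apply/isThetaP; split => // T oT; by rewrite /trunc /P oT andbF.
apply/eqIP; [exact: isForm_inA Ft|move=> T; rewrite dThE|].
  by case: ifP => _; [exact: inA_cst|exact: dH_inA].
move=> T y Sy; rewrite dThE; case: ifPn => oT; first by rewrite t0.
have [Tq|Tq] := eqVneq #|T| q.+1.
  by rewrite dH_trunc// => [|nu _]; [exact: E|exact: notin_D1].
by rewrite (dH_off Fe Tq) (proj2 Ft)//; exact/eqP.
Qed.

Lemma Dt_keepX i f y : Dt i (fun y => f (keepX y)) y = Dt i f (keepX y).
Proof.
rewrite !DtE (dv_subst _ _ _ (@linmap_keepX R m)); congr dv.
by apply/funext; case=> [[?|[? ?]]|?].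
Qed.

Lemma inA_keepX f : inA f -> inA (fun y => f (keepX y)).
Proof. by move=> Af; apply: inA_subst => //; exact: linmap_keepX. Qed.

Lemma dH_keepX w T y : dH (fun T y => w T (keepX y)) T y = dH w T (keepX y).
Proof. by rewrite !dHE; apply: eq_bigr => nu _; rewrite Dt_keepX. Qed.

Lemma keepXK y : keepX (keepX y) = keepX y.
Proof. by apply/funext; case=> [[?|[? ?]]|?]. Qed.

Lemma closed_keepX q w : closedOn [set: 'I_m] q w ->
  closedOn [set: 'I_m] q (fun T y => w T (keepX y)).
Proof.
by move=> cw T TN Tq y Sy; rewrite dH_keepX cw//; exact: onS_keepX.
Qed.

Lemma xonly_part q w : (0 < q)%N -> allA w -> closedOn [set: 'I_m] q w ->
  exists2 eta, allA eta & forall T y, #|T| = q -> onS y -> w T (keepX y) = dH eta T y.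
Proof.
move=> q0 Aw cw.
have [|T y _ _ _|eta Ae E] := xonly_exact q0 _ (closed_keepX cw).
- by move=> T; exact: inA_keepX.
- by rewrite keepXK.
by exists eta => // T y Tq Sy; rewrite -E// finset.subsetT.
Qed.

Lemma plus_closed q w : allA w -> closedOn [set: 'I_m] q w ->
  closedOn [set: 'I_m] q (fun T y => w T y - w T (keepX y)).
Proof.
move=> Aw cw T TN Tq y Sy; rewrite dHB//; last by move=> T'; exact: inA_keepX.
by rewrite dH_keepX !cw ?subrr//; exact: onS_keepX.
Qed.

(** Up to functions of x, w is dx^o /\ xi with xi closed in Theta of degree q-1 < m-1, where
    [plus_exact] applies. The loss of one degree is what makes q = m-1 admissible. *)
Lemma no_theta_exact q w : (0 < q <= p.+1)%N -> allA w -> closedOn [set: 'I_m] q w ->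
  (forall T, o \notin T -> #|T| = q -> eqS (w T) (fun=> 0)) ->
  exists2 eta, allA eta & forall T, #|T| = q -> eqS (w T) (dH eta T).
Proof.
move=> /andP[q0 qp] Aw cw w0; case: q q0 qp cw w0 => // q _ qp cw w0.
have [eta0 Ae0 E0] := xonly_part (ltn0Sn q) Aw cw.
pose wp : Form := fun T y => w T y - w T (keepX y).
have Awp : allA wp by move=> T; apply: inA_sub => //; exact: inA_keepX.
have cwp : closedOn [set: 'I_m] q.+1 wp := plus_closed Aw cw.
have wp0 T : o \notin T -> #|T| = q.+1 -> eqS (wp T) (fun=> 0).
  by move=> oT Tq y Sy; rewrite /wp !w0 ?subrr//; exact: onS_keepX.
have Az : allA (zeta wp) by move=> T; exact: Awp.
have cz : closedOn [set~ o] q (zeta wp).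
  move=> T; rewrite subset_o => oT Tq y Sy.
  have := dH_setU1 y Awp oT; rewrite cwp ?finset.subsetT//; last by rewrite cardsU1 oT Tq.
  rewrite (Dt_eqS o (wp0 T oT Tq))// Dt0 sub0r => /eqP.
  by rewrite eq_sym oppr_eq0 => /eqP.
have [|xi Axi Exi] := plus_exact (o := o) qp Az cz.
  by move=> T y _ _ _; rewrite /zeta /wp keepXK subrr.
(* The factor -1 offsets the minus sign of [dH_setU1]. *)
pose eta1 : Form := fun T y => if o \in T then -1 * xi (T :\ o) y else 0.
have Ae1 : allA eta1.
  by move=> T; rewrite /eta1; case: (_ \in _); [exact: inA_scale|exact: inA_cst].
exists (fun T y => eta0 T y + eta1 T y) => [T|T Tq y Sy]; first exact: inA_add.
rewrite dHD// -E0//; suff -> : dH eta1 T y = wp T y by rewrite /wp; ring.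
case: (boolP (o \in T)) => oT; last first.
  rewrite wp0// dHE big1// => nu _.
  rewrite (_ : eta1 _ = fun=> 0) ?Dt0 ?mulr0//.
  by apply/funext => z; rewrite /eta1 (negbTE (notin_D1 nu oT)).
have To := o_setD1 T; rewrite (setU1_o oT) dH_setU1//.
rewrite (_ : eta1 _ = fun=> 0); last by apply/funext => z; rewrite /eta1 (negbTE To).
rewrite Dt0 (@dH_ext _ (fun T y => -1 * xi T y)) => [|nu nT].
  rewrite dHZ// mulN1r sub0r opprK -Exi ?subset_o//.
  by move: Tq; rewrite (cardsD1 o T) oT add1n => -[].
apply/funext => z; rewrite /zeta /eta1 setU11; congr (_ * xi _ z).
by apply/setP => j; rewrite !inE; case: (j == o); rewrite /= ?andbF.
Qed.

(** Apart from functions of x, the theta part is exact in Theta because q < m-1; subtracting the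
    full [dH] of its potential leaves a closed form without theta part. *)
Lemma low_exact q w : (0 < q <= p)%N -> allA w -> closedOn [set: 'I_m] q w ->
  exists2 eta, allA eta & forall T, #|T| = q -> eqS (w T) (dH eta T).
Proof.
move=> /andP[q0 qp] Aw cw.
have [eta0 Ae0 E0] := xonly_part q0 Aw cw.
pose wp : Form := fun T y => w T y - w T (keepX y).
have Awp : allA wp by move=> T; apply: inA_sub => //; exact: inA_keepX.
have cwp : closedOn [set: 'I_m] q wp := plus_closed Aw cw.
have [|T y _ _ _|eta1 Ae1 E1] := @plus_exact R m o q wp qp Awp.
- by move=> T TN Tq; apply: cwp; rewrite ?finset.subsetT.
- by rewrite /wp keepXK subrr.
pose w' : Form := fun T y => wp T y - dH eta1 T y.
have Aw' : allA w' by move=> T; apply: inA_sub => //; exact: dH_inA.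
have [||T oT Tq y Sy|eta2 Ae2 E2] := @no_theta_exact q w' _ Aw'.
- by rewrite q0 (leq_trans qp).
- move=> T TN Tq y Sy; rewrite dHB//; last by move=> T'; exact: dH_inA.
  by rewrite dH_dH// subr0 cwp.
- by rewrite /w' E1 ?subset_o// subrr.
exists (fun T y => eta0 T y + (eta1 T y + eta2 T y)) => [T|T Tq y Sy].
  by apply: inA_add => //; exact: inA_add.
rewrite dHD//; last by move=> T'; exact: inA_add.
by rewrite dHD// -E0// -E2// /w' /wp; ring.
Qed.

Lemma card_co T : o \notin T -> #|T| = p.+1 -> T = [set~ o].
Proof.
move=> oT Tq; apply/eqP; rewrite eqEcard subset_o oT cardsC1 card_ord /=.
by rewrite Tq.
Qed.

Lemma omega0E nu y : omega0 [set~ nu] y = (-1) ^+ nu * y (cU nu (mi0 m)).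
Proof.
rewrite /omega0 (bigD1 nu)//= eqxx big1 ?addr0// => mu mn.
by case: eqP => // /finset.setC_inj /finset.set1_inj E; rewrite E eqxx in mn.
Qed.

Lemma isForm_omega0 : isForm p.+1 (@omega0 R m).
Proof.
apply: isForm_mk => [T|T Tq].
  apply: inA_sum => mu _; case: (_ == _); last exact: inA_cst.
  by apply: inA_scale; exact: inA_coord.
apply/funext => y; rewrite /omega0 big1// => mu _.
by case: eqP => // E; move: Tq; rewrite E cardsC1 card_ord eqxx.
Qed.

(** The only component of the differential is the sum of the D_nu u^nu, which is CE at the zero
    multi-index: the position of nu among all indices cancels the sign of d_nu x. *)
Lemma closed_omega0 : closedOn [set: 'I_m] p.+1 (@omega0 R m).
Proof.
move=> T _ Tq y Sy.
have -> : T = [set: 'I_m].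
  by apply/eqP; rewrite eqEcard finset.subsetT cardsT card_ord Tq /=.
rewrite dHE -[RHS](Sy (mi0 m)) /CE; apply: eq_big => [nu|nu _]; first by rewrite inE.
have -> : [set: 'I_m] :\ nu = [set~ nu] by apply/setP => j; rewrite !inE andbT.
have -> : omega0 [set~ nu] = fun y : Pt => (-1) ^+ nu * y (cU nu (mi0 m)).
  by apply/funext => z; exact: omega0E.
rewrite DtZ; last exact: inA_coord.
have -> : sg nu [set: 'I_m] = nu.
  rewrite /sg -sum1_card (eq_bigl (fun j : 'I_m => (j < nu)%N)) => [|j]; last by rewrite !inE.
  by rewrite (big_ord_narrow (ltnW (ltn_ord nu))) sum1_card card_ord.
by rewrite mulrA signM_self mul1r DtE dv_coord.
Qed.

Lemma sum_co (F : 'I_m -> R) : \sum_(nu in [set~ o]) F nu = \sum_(nu < m | nu != o) F nu.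
Proof. by apply: eq_bigl => nu; rewrite !inE. Qed.

Lemma omega0_not_exact : ~ exactH p.+1 (@omega0 R m).
Proof.
move=> [Fo /= [eta [Fe E]]].
have Ae := isForm_inA Fe.
have {}E := (eqIP (isForm_inA Fo) (fun T => dH_inA T Ae)).1 E [set~ o].
apply: (@unit_not_divergence R m o
  (fun nu y => (-1) ^+ sg nu [set~ o] * eta ([set~ o] :\ nu) y)) => [k|y Sy].
  exact: inA_scale.
have := E y Sy; rewrite omega0E expr0 mul1r => ->.
rewrite dHE sum_co; apply: eq_bigr => nu _; by rewrite DtZ.
Qed.

(** In degree m-1 the theta part is the single function [w [set~ o]], and closedness says that its
    D_o is a divergence. [kernel_D_o] makes it c u^o plus a divergence, and u^o is the theta part of
    [omega0]. *)
Lemma top_minus_one w : allA w -> closedOn [set: 'I_m] p.+1 w ->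
  exists c : R, exists2 eta, allA eta &
    forall T, #|T| = p.+1 -> eqS (fun y => w T y - c * omega0 T y) (dH eta T).
Proof.
move=> Aw cw.
have oo : o \notin [set~ o] by rewrite !inE eqxx.
have Az : allA (zeta w) by move=> T; exact: Aw.
have [|||c [h Ah Eh]] := @kernel_D_o R m o (w [set~ o])
   (fun nu y => (-1) ^+ sg nu [set~ o] * zeta w ([set~ o] :\ nu) y) (Aw _).
- by move=> k; exact: inA_scale.
- by exists ord_max.
- move=> y Sy; have := dH_setU1 y Aw oo.
  rewrite cw ?finset.subsetT//; last by rewrite cardsU1 oo cardsC1 card_ord.
  move=> /eqP; rewrite eq_sym subr_eq0 => /eqP ->.
  by rewrite dHE sum_co; apply: eq_bigr => nu _; rewrite DtZ.
exists c.
(* The components are signed so that [dH eta1] at [[set~ o]] is the divergence of [h]. *)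
pose eta1 : Form := fun T y => \sum_(k < m | (k != o) && (T == [set~ o] :\ k))
   (-1) ^+ sg k [set~ o] * h k y.
have Ae1 : allA eta1 by move=> T; apply: inA_sum => k _; exact: inA_scale.
have E1 y : dH eta1 [set~ o] y = \sum_(k < m | k != o) Dt k (h k) y.
  rewrite dHE sum_co; apply: eq_bigr => nu no.
  have -> : eta1 ([set~ o] :\ nu) = fun y => (-1) ^+ sg nu [set~ o] * h nu y.
    apply/funext => z; rewrite /eta1 (big_pred1 nu)// => k /=.
    apply/andP/eqP => [[ko /eqP/setP /(_ k)]|->]; last by rewrite no eqxx.
    by rewrite !inE eqxx /= ko andbT => /negbT; rewrite negbK => /eqP.
  by rewrite DtZ// mulrA signM_self mul1r.
have Ao : allA (@omega0 R m) := isForm_inA isForm_omega0.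
have Aco : allA (fun T y => c * @omega0 R m T y) by move=> T; exact: inA_scale.
have Aw1 : allA (fun T y => w T y - c * omega0 T y) by move=> T; exact: inA_sub.
pose w' : Form := fun T y => w T y - c * omega0 T y - dH eta1 T y.
have Aw' : allA w' by move=> T; apply: inA_sub => //; exact: dH_inA.
have [||T oT Tq y Sy|eta2 Ae2 E2] := @no_theta_exact p.+1 w' _ Aw'.
- by rewrite /= leqnn.
- move=> T TN Tq y Sy; rewrite dHB//; last by move=> T'; exact: dH_inA.
  by rewrite dH_dH// subr0 dHB// dHZ// cw// closed_omega0// mulr0 subrr.
- by rewrite (card_co oT Tq) /w' E1 omega0E expr0 mul1r Eh//; ring.
exists (fun T y => eta1 T y + eta2 T y) => [T|T Tq y Sy]; first exact: inA_add.
by rewrite dHD// -E2// /w'; ring.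
Qed.

End HorizontalComplex.

(** * Comparison with the cohomology of Theta, and the result *)

Section MainTheorem.
Variables (R : realType) (p : nat).
Local Notation m := p.+2.
Local Notation Pt := (Defs.Pt R m).
Local Notation Fun := (Defs.Fun R m).
Local Notation Form := (Defs.Form R m).
Local Notation o := (ord0 : 'I_m).
Implicit Types (f g : Fun) (y v : Pt) (i j k nu : 'I_m) (T : {set 'I_m}) (t w eta : Form).
Local Notation allA w := (forall T : {set 'I_m}, inA (w T)).

Lemma isForm0 q : isForm q ((fun _ _ => 0) : Form).
Proof. by apply: isForm_mk => // T; exact: inA_cst. Qed.

Lemma isTheta0 q : isTheta q ((fun _ _ => 0) : Form).
Proof. by apply/isThetaP; split=> //; exact: isForm0. Qed.

Lemma dH0 T y : dH ((fun _ _ => 0) : Form) T y = 0.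
Proof. by rewrite dHE big1// => nu _; rewrite Dt0 mulr0. Qed.

Lemma card_o_notin T : o \notin T -> (#|T| <= p.+1)%N.
Proof.
by rewrite -subset_o => /subset_leq_card; rewrite cardsC1 card_ord.
Qed.

Lemma closedTh_top t : isTheta p.+1 t -> closedTh p.+1 t.
Proof.
move=> Tt; split => //; have [Ft _] := (isThetaP _ _).1 Tt; have At := isForm_inA Ft.
apply/eqIP => [T||T y Sy]; rewrite ?dThE.
- by case: ifP => _; [exact: inA_cst|exact: dH_inA].
- exact: inA_zeroF.
case: ifPn => // oT; rewrite (dH_off Ft)//.
by apply: contraTneq (card_o_notin oT) => ->; rewrite ltnn.
Qed.

Lemma closedH_top w : isForm m w -> closedH m w.
Proof.
move=> Fw; split => //; apply: (closedHP Fw).2 => T _ Tq.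
by have := max_card (mem T); rewrite Tq card_ord ltnn.
Qed.

Lemma exactTh0 : exactTh p.+1 ((fun _ _ => 0) : Form).
Proof.
apply: (@exactTh_mk _ _ _ _ (fun _ _ => 0)); first exact: isTheta0.
  by move=> T; exact: inA_cst.
by move=> T _ _ y _; rewrite dH0.
Qed.

Definition theta w : Form := fun T => if o \in T then fun=> 0 else w T.

Lemma isTheta_theta q w : isForm q w -> isTheta q (theta w).
Proof.
move=> Fw; have Aw := isForm_inA Fw; apply/isThetaP; split; last by move=> T oT; rewrite /theta oT.
apply: isForm_mk => T; rewrite /theta; case: ifP => _ //; first exact: inA_cst.
by move=> Tq; rewrite (proj2 Fw)//; exact/eqP.
Qed.

(* theta + dx^1 /\ xi *)
Definition glue t xi : Form := fun T => if o \in T then xi (T :\ o) else t T.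

Lemma isForm_glue q t xi : isForm q.+1 t -> isForm q xi -> isForm q.+1 (glue t xi).
Proof.
move=> Ft Fx; apply: isForm_mk => T; rewrite /glue; case: ifPn => oT.
- exact: isForm_inA Fx _.
- exact: isForm_inA Ft _.
- move=> Tq; rewrite (proj2 Fx)// => E; move: Tq; by rewrite (cardsD1 o T) oT E eqxx.
- by move=> Tq; rewrite (proj2 Ft)//; exact/eqP.
Qed.

Lemma glue_inA t xi : allA t -> allA xi -> allA (glue t xi).
Proof. by move=> At Ax T; rewrite /glue; case: ifP. Qed.

Lemma zeta_glue t xi T : o \notin T -> zeta (glue t xi) T = xi T.
Proof.
move=> oT; rewrite /zeta /glue setU11; congr xi.
by apply/setP => j; rewrite !inE; case: (eqVneq j o) => //= ->; rewrite (negbTE oT).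
Qed.

Lemma dH_glue_o t xi T y : allA t -> allA xi -> o \notin T ->
  dH (glue t xi) (o |: T) y = Dt o (t T) y - dH xi T y.
Proof.
move=> At Ax oT; rewrite dH_setU1//; last exact: glue_inA.
rewrite {1}/glue (negbTE oT); congr (_ - _); apply: dH_ext => nu _.
by rewrite zeta_glue//; exact: notin_D1.
Qed.

(** The theta part of a closed form satisfies D_o theta = d xi, and conversely such a xi glues to a
    closed form. If theta = d eta, then w - dH eta has no theta part and [no_theta_exact]
    applies. *)
Lemma iso_m1 : @IsoQuot R m (@closedH R m p.+1) (@exactH R m p.+1) (@kerD1 R m) (@exactTh R m p.+1).
Proof.
exists theta; split; last split; last split; last split.
- move=> a w w'; apply/funext => T; apply/funext => y; rewrite /theta.
  by case: ifP => // _; rewrite mulr0 addr0.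
- move=> z [Fz /(closedHP Fz) cz]; have Az := isForm_inA Fz.
  have Tt := isTheta_theta Fz; split; first exact: closedTh_top.
  have At : allA (theta z) by case/isThetaP: Tt => /isForm_inA.
  apply: (@exactTh_mk _ _ _ _ (zeta z)).
  + apply/isThetaP; split.
      apply: isForm_mk => T; rewrite D1E; first exact: inA_Dt.
      case/isThetaP: Tt => -[_ Z] _ Tq; rewrite Z; last exact/eqP.
      by apply/funext => y; rewrite Dt0.
    by move=> T oT; rewrite D1E /theta oT; apply/funext => y; rewrite Dt0.
  + by move=> T; exact: Az.
  + move=> T oT Tq y Sy; rewrite D1E /theta (negbTE oT).
    have := dH_setU1 y Az oT; rewrite cz ?finset.subsetT//; last by rewrite cardsU1 oT Tq.
    by move=> /eqP; rewrite eq_sym subr_eq0 => /eqP.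
- move=> b [Fb /= [eta [Fe E]]]; have Ae := isForm_inA Fe.
  have {}E := (eqIP (isForm_inA Fb) (fun T => dH_inA T Ae)).1 E.
  apply: (@exactTh_mk _ _ _ _ eta) => //; first exact: isTheta_theta.
  by move=> T oT Tq y Sy; rewrite /theta (negbTE oT) E.
- move=> z2 [[/isThetaP [F2 z20] _] [/= _ [eta [/isThetaP [Fe e0] E]]]].
  have A2 := isForm_inA F2; have Ae := isForm_inA Fe.
  have AD : allA (D1 z2) by move=> T; rewrite D1E; exact: inA_Dt.
  have Ad : allA (dTh eta).
    by move=> T; rewrite dThE; case: ifP => _; [exact: inA_cst|exact: dH_inA].
  have {}E := (eqIP AD Ad).1 E.
  have Fg := isForm_glue F2 Fe.
  exists (glue z2 eta); split.
    split=> //; apply: (closedHP Fg).2 => T _ Tq y Sy.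
    case: (boolP (o \in T)) => oT; last first.
      by have := card_o_notin oT; rewrite Tq ltnn.
    have To := o_setD1 T; rewrite (setU1_o oT) dH_glue_o//.
    by have := E (T :\ o) y Sy; rewrite D1E dThE (negbTE To) => ->; rewrite subrr.
  rewrite (_ : (fun T y => _) = fun _ _ => 0); first exact: exactTh0.
  apply/funext => T; apply/funext => y; rewrite /theta /glue.
  by case: (boolP (o \in T)) => oT; [rewrite z20// subrr|rewrite subrr].
- move=> z [Fz /(closedHP Fz) cz] [_ /= [eta [/isThetaP [Fe _] E]]].
  have Az := isForm_inA Fz; have Ae := isForm_inA Fe.
  have At : allA (theta z) by case/isThetaP: (isTheta_theta Fz) => /isForm_inA.
  have Ad : allA (dTh eta).
    by move=> T; rewrite dThE; case: ifP => _; [exact: inA_cst|exact: dH_inA].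
  have {}E := (eqIP At Ad).1 E.
  pose w' : Form := fun T y => z T y - dH eta T y.
  have Aw' : allA w' by move=> T; apply: inA_sub => //; exact: dH_inA.
  have [||T oT Tq y Sy|eta2 Ae2 E2] := @no_theta_exact R p p.+1 w' _ Aw'.
  + by rewrite /= leqnn.
  + move=> T TN Tq y Sy; rewrite dHB//; last by move=> T'; exact: dH_inA.
    by rewrite dH_dH// subr0 cz.
  + have := E T y Sy; rewrite dThE /theta (negbTE oT) /w' => ->; by rewrite subrr.
  apply: (@exactH_mk _ _ _ _ (fun T y => eta T y + eta2 T y)) => //.
    by move=> T; exact: inA_add.
  by move=> T Tq y Sy; rewrite dHD// -E2// /w'; ring.
Qed.

(** Differs from [zeta] by the zeros at T containing [o], which [isTheta] requires. *)
Definition contr w : Form := fun T => if o \in T then fun=> 0 else w (o |: T).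

Lemma isTheta_contr q w : isForm q.+1 w -> isTheta q (contr w).
Proof.
move=> Fw; have Aw := isForm_inA Fw; apply/isThetaP; split; last by move=> T oT; rewrite /contr oT.
apply: isForm_mk => T; rewrite /contr; case: ifPn => oT //; first exact: inA_cst.
by move=> Tq; rewrite (proj2 Fw)// cardsU1 oT add1n => -[E]; rewrite E eqxx in Tq.
Qed.

Lemma dH_contr w T y : o \notin T -> dH (contr w) T y = dH (zeta w) T y.
Proof.
by move=> oT; apply: dH_ext => nu _; rewrite /contr (negbTE (notin_D1 nu oT)).
Qed.

Lemma isForm_opp q w : isForm q w -> isForm q (fun T y => -1 * w T y).
Proof.
move=> Fw; apply: isForm_mk => T; first by apply: inA_scale; exact: isForm_inA Fw _.
by move=> Tq; apply/funext => y; rewrite (proj2 Fw) ?mulr0//; exact/eqP.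
Qed.

Lemma imD1_0 : imD1 ((fun _ _ => 0) : Form).
Proof.
split; first exact: isTheta0.
exists (fun _ _ => 0); split; first by apply: closedTh_top; exact: isTheta0.
exists (fun _ _ => 0); split; first exact: isTheta0.
have E T y : D1 ((fun _ _ => 0) : Form) T y + dTh (fun _ _ => 0) T y = 0.
  by rewrite D1E dThE Dt0 add0r; case: ifP => // _; exact: dH0.
apply/eqIP => [T|T|T y _]; last by rewrite E.
  exact: inA_cst.
by rewrite (_ : (fun y => _) = fun=> 0); [exact: inA_cst|apply/funext => y; exact: E].
Qed.

(** A form of top degree is dx^o /\ xi with xi of top degree in Theta, so both are closed. It is the
    differential of theta + dx^o /\ eta exactly when xi = D_o theta - d eta. *)
Lemma iso_m : @IsoQuot R m (@closedH R m m) (@exactH R m m) (@closedTh R m p.+1) (@imD1 R m).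
Proof.
exists contr; split; last split; last split; last split.
- move=> a w w'; apply/funext => T; apply/funext => y; rewrite /contr.
  by case: ifP => // _; rewrite mulr0 addr0.
- by move=> z [Fz _]; apply: closedTh_top; exact: isTheta_contr.
- move=> b [Fb /= [eta [Fe E]]]; have Ae := isForm_inA Fe; have Ab := isForm_inA Fb.
  have {}E := (eqIP Ab (fun T => dH_inA T Ae)).1 E.
  have Tb := isTheta_contr Fb; split => //.
  have Tt := isTheta_theta Fe.
  have At : allA (theta eta) by case/isThetaP: Tt => /isForm_inA.
  have /isThetaP [Fc c0] := isTheta_contr Fe; have Ac := isForm_inA Fc.
  have Fo := isForm_opp Fc; have Ao := isForm_inA Fo.
  exists (theta eta); split; first exact: closedTh_top.
  exists (fun T y => -1 * contr eta T y); split.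
    apply/isThetaP; split => // T oT; rewrite c0//; apply/funext => y; exact: mulr0.
  apply/eqIP => [T|T|T y Sy].
  + by case/isThetaP: Tb => /isForm_inA.
  + rewrite D1E dThE; apply: inA_add; first exact: inA_Dt.
    by case: ifP => _; [exact: inA_cst|exact: dH_inA].
  + rewrite D1E dThE /theta {1}/contr; case: ifPn => oT; first by rewrite Dt0 addr0.
    by rewrite E// dH_setU1// dHZ// dH_contr// mulN1r.
- move=> z2 [/isThetaP [F2 z20] _].
  have op_zero := isForm0 m; have Fg := isForm_glue op_zero F2.
  exists (glue (fun _ _ => 0) z2); split; first exact: closedH_top.
  rewrite (_ : (fun T y => _) = fun _ _ => 0); first exact: imD1_0.
  apply/funext => T; apply/funext => y; rewrite /contr; case: ifPn => oT.
    by rewrite z20// subrr.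
  by rewrite -/(zeta _ T) zeta_glue// subrr.
- move=> z [Fz _] [_ [t' [[/isThetaP [Ft _] _] [eta [/isThetaP [Fe _] E]]]]].
  have Az := isForm_inA Fz; have At := isForm_inA Ft; have Ae := isForm_inA Fe.
  have Ac : allA (contr z) by case/isThetaP: (isTheta_contr Fz) => /isForm_inA.
  have Ar : allA (fun T y => D1 t' T y + dTh eta T y).
    move=> T; rewrite D1E dThE; apply: inA_add; first exact: inA_Dt.
    by case: ifP => _; [exact: inA_cst|exact: dH_inA].
  have {}E := (eqIP Ac Ar).1 E.
  have Ao : allA (fun T y => -1 * eta T y) by move=> T; exact: inA_scale.
  apply: (@exactH_mk _ _ _ _ (glue t' (fun T y => -1 * eta T y))) => //.
    exact: glue_inA.
  move=> T Tq y Sy; have oT : o \in T.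
    by apply: contraTT (leqnn m) => /card_o_notin; rewrite Tq ltnn.
  have To := o_setD1 T; rewrite (setU1_o oT) dH_glue_o// dHZ// mulN1r opprK.
  by have := E (T :\ o) y Sy; rewrite D1E dThE /contr (negbTE To).
Qed.

Lemma constF_form (c : R) : isForm 0 (@constF R m c).
Proof.
apply: isForm_mk => T; rewrite /constF.
  by case: (_ == _); exact: inA_cst.
by rewrite cards_eq0 => /negbTE ->.
Qed.

Lemma closedH0_const w : closedH 0 w -> exists c : R, eqI w (constF c).
Proof.
move=> [Fw /(closedHP Fw) cw]; have Aw := isForm_inA Fw.
pose f := w finset.set0.
have df i : eqS (Dt i f) (fun=> 0).
  move=> y Sy; have := cw [set i]; rewrite finset.subsetT cards1 => /(_ isT erefl y Sy).
  rewrite dHE finset.big_set1 finset.setDv -/f.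
  by move=> /eqP; rewrite mulf_eq0 signr_eq0 /= => /eqP.
have cf := const_of_Dt0 (o := o) (Aw finset.set0) (ex_intro _ ord_max isT) df.
exists (f (fun=> 0)); apply/eqIP => [//||T y Sy].
  exact: isForm_inA (constF_form _).
rewrite /constF; case: (eqVneq T finset.set0) => [->|T0]; first exact: cf.
by rewrite (proj2 Fw)//; apply/eqP; rewrite cards_eq0.
Qed.

End MainTheorem.

Theorem mainTheorem3 (R : realType) (m : nat) (hm : (2 <= m)%N) :
  (* q = 0 : H^0_H(CE) = R *)
  ((forall c : R, @closedH R m 0 (@constF R m c)) /\
   (forall c : R, @eqI R m (@constF R m c) (@zeroF R m) -> c = 0) /\
   (forall w, @closedH R m 0 w -> exists c : R, @eqI R m w (@constF R m c))) /\
  (* 1 <= q <= m-2  and  q > m : H^q_H(CE) = 0 *)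
  (forall q w, (1 <= q <= m - 2)%N -> @closedH R m q w -> @exactH R m q w) /\
  (forall q w, (m < q)%N -> @closedH R m q w -> @exactH R m q w) /\
  (* q = m-1 : H^{m-1}_H(CE) = R.[u^mu d_mu x] ... *)
  (@closedH R m m.-1 (@omega0 R m) /\ ~ @exactH R m m.-1 (@omega0 R m) /\
   (forall w, @closedH R m m.-1 w ->
      exists c : R, @exactH R m m.-1 (fun T y => w T y - c * @omega0 R m T y))) /\
  (* ... and H^{m-1}_H(CE) ~ ker D_1^{m-1} *)
  @IsoQuot R m (@closedH R m m.-1) (@exactH R m m.-1) (@kerD1 R m) (@exactTh R m m.-1) /\
  (* q = m : H^m_H(CE) ~ H^{m-1}(Theta) / im D_1^{m-1} *)
  @IsoQuot R m (@closedH R m m) (@exactH R m m) (@closedTh R m m.-1) (@imD1 R m).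
Proof.
case: m hm => [|[|p]] // _; rewrite /= !subSS subn0.
split; first split; last split; last split; last split; last split.
- move=> c; split; first exact: constF_form.
  apply: (closedHP (constF_form _ _)).2 => T _ _ y _.
  rewrite dHE big1// => nu _; rewrite (_ : constF c _ = fun=> constF c (T :\ nu) (fun=> 0))//.
  by rewrite DtE dv_cst mulr0.
- split; last exact: closedH0_const.
  move=> c E; have S00 : onS ((fun=> 0) : Defs.Pt R p.+2) by move=> n; exact: big1.
  have := (eqIP (isForm_inA (constF_form p c)) (@inA_zeroF R p)).1 E finset.set0 _ S00.
  by rewrite /constF eqxx.
- move=> [|q] w // hq [Fw /(closedHP Fw) cw].
  have [eta Ae E] := low_exact hq (isForm_inA Fw) cw.
  exact: exactH_mk Fw Ae E.
- move=> [|q] w // hq [Fw _].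
  apply: (@exactH_mk _ _ _ _ (fun _ _ => 0)) => // [T|T Tq]; first exact: inA_cst.
  (* Beyond degree m there is no T of the required size, so any potential serves. *)
  by have := max_card (mem T); rewrite card_ord Tq leqNgt hq.
- split; first by split; [exact: isForm_omega0|apply: (closedHP (isForm_omega0 R p)).2; exact: closed_omega0].
  split; first exact: omega0_not_exact.
  move=> w [Fw /(closedHP Fw) cw].
  have [c [eta Ae E]] := top_minus_one (isForm_inA Fw) cw.
  exists c; apply: (exactH_mk _ Ae E).
  have Ao := isForm_inA (isForm_omega0 R p).
  apply: isForm_mk => T; first by apply: inA_sub; [exact: isForm_inA Fw _|exact: inA_scale].
  move=> /eqP Tq; apply/funext => y.
  by rewrite (proj2 Fw)// (proj2 (isForm_omega0 R p))// mulr0 subrr.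
- exact: iso_m1.
- exact: iso_m.
Qed.
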